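(* Let $r\ge 1$ and let $\ell_1,\dots,\ell_r$ be positive integers such that either none or exactly two of the $\ell_i$ are odd. Let $G_{\ell_1,\dots,\ell_r}=G_{\ell_1,\dots,\ell_r}(t;x_1,x_2,\dots)$ be the generating function of even maps of type $(\ell_1,\dots,\ell_r)$, where $t$ marks the number of vertices and, for $i\ge 1$, $x_i$ marks the number of non-boundary faces of degree $2i$. Let $R=R(t;x_1,x_2,\dots)$ be the formal power series specified by $$R=t+\sum_{i\ge 1}x_i\binom{2i-1}{i}R^i .$$ Then $$G_{\ell_1,\dots,\ell_r}=\Big(\prod_{i=1}^r\alpha(\ell_i)\Big)\cdot\frac1s\cdot\frac{\mathrm d^{\,r-2}}{\mathrm dt^{\,r-2}}R^s,\qquad \alpha(\ell)=\frac{\ell!}{\lfloor \ell/2\rfloor!\,\lfloor(\ell-1)/2\rfloor!},\qquad s=\frac{\ell_1+\cdots+\ell_r}{2}.$$ For $r=1$ the formula is understood as $\frac{\mathrm d}{\mathrm dt}G_{\ell_1}=\alpha(\ell_1)\cdot\frac1s R^s$, i.e. $\frac{\mathrm d}{\mathrm dt}G_{2a}=\binom{2a}{a}R^a$ with $\ell_1=2a$.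
   Context: A planar map is a connected graph (loops and multiple edges allowed) embedded on the sphere so that the faces are topological discs, considered up to orientation-preserving homeomorphism. The degree of a face is the number of corners (equivalently edge-sides) incident to it. For $r\ge1$ and positive integers $\ell_1,\dots,\ell_r$, an even map of type $(\ell_1,\dots,\ell_r)$ is a planar map with $r$ distinct numbered marked faces $f_1,\dots,f_r$ (the boundary-faces) of respective degrees $\ell_1,\dots,\ell_r$, each boundary-face having one marked corner, and such that all other faces have even degree. (A parity argument shows that the number of odd $\ell_i$ is necessarily even.) All series are formal power series in $t,x_1,x_2,\dots$ with rational coefficients, and $\mathrm d/\mathrm dt$ is the formal derivative with respect to $t$. $R$ is the unique formal power series satisfying the given equation. *)

(* Defs.v *)
From mathcomp Require Import all_boot all_order all_algebra all_fingroup.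
From mathcomp Require Import finmap monalg.

Set Implicit Arguments.
Unset Strict Implicit.
Unset Printing Implicit Defensive.

Import GRing.Theory.
Local Open Scope ring_scope.

(* Formal power series over Q in the variables t, x_1, x_2, ...: the coefficient
   families indexed by the monomials in variables v_0, v_1, v_2, ..., where
   v_0 stands for t and v_i for x_i when i >= 1.  A monomial is its finitely
   supported exponent vector, so m 0 is the exponent of t in m. *)
Notation monom := {cmonom nat}.
Definition fps := monom -> rat.

Definition mdvd (d m : monom) : bool :=
  [forall i : finsupp d, (d (val i) <= m (val i))%N].

Lemma mdvdP (d m : monom) : reflect (forall i, (d i <= m i)%N) (mdvd d m).
Proof.
apply: (iffP forallP) => [dm i|dm i]; last exact: dm.
by case: (finsuppP d i) => // id; exact: (dm [` id]%fset).
Qed.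

Definition mdivs (m : monom) : {fset monom} :=
  [fset d in [fset [cmonom nat_of_ord ((f : {ffun _}) i) | i : finsupp m]%M
              | f in {ffun finsupp m -> 'I_(mdeg m).+1}] | mdvd d m]%fset.

Lemma mcoef_le_mdeg (m : monom) i : (m i <= mdeg m)%N.
Proof.
rewrite mdegE; case: (finsuppP m i) => // im.
by rewrite (big_fsetD1 i) //= leq_addr.
Qed.

Lemma mem_mdivs (m d : monom) : (d \in mdivs m) = mdvd d m.
Proof.
rewrite !inE /=; case: mdvdP => [dm|_]; last by rewrite andbF.
rewrite andbT; apply/imfsetP.
exists [ffun i : finsupp m => inord (d (val i)) : 'I_(mdeg m).+1] => //=.
apply/eqP/cmP => i; rewrite cmE fsfun_ffun.
case: insubP => [j _ <-|] /=.
  rewrite ffunE inordK // ltnS.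
  exact: leq_trans (dm _) (mcoef_le_mdeg _ _).
by rewrite -cmE_eq0 => /eqP m0; move: (dm i); rewrite m0 leqn0 => /eqP.
Qed.

Lemma mdivsP (m d : monom) :
  reflect (exists d', m = mmul d d') (d \in mdivs m).
Proof.
rewrite mem_mdivs; apply: (iffP (mdvdP d m)) => [dm|[d' ->] i]; last first.
  by rewrite cmM leq_addr.
by exists (divcm m d); apply/eqP/cmP => i; rewrite cmM divcmE subnKC.
Qed.

Definition fps_one : fps := fun m => (m == mone)%:R.
Definition fps_var (i : nat) : fps := fun m => (m == ucm i)%:R.
Definition fps_add (f g : fps) : fps := fun m => f m + g m.
Definition fps_scale (c : rat) (f : fps) : fps := fun m => c * f m.
Definition fps_mul (f g : fps) : fps :=
  fun m => \sum_(d <- mdivs m) f d * g (divcm m d).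
Definition fps_exp (f : fps) (n : nat) : fps := iter n (fps_mul f) fps_one.

(* d/dt *)
Definition fps_deriv (f : fps) : fps :=
  fun m => (m 0%N).+1%:R * f (mmul (ucm 0%N) m).

Definition fps_derivn (n : nat) (f : fps) : fps := iter n fps_deriv f.

(* The sum of x_i * F i over all i >= 1.  The series x_i * F i contributes to
   the coefficient of m only if x_i occurs in m (fps_mul_var_eq0). *)
Definition fps_xsum (F : nat -> fps) : fps :=
  fun m => \sum_(i <- finsupp m | (0 < i)%N) fps_mul (fps_var i) (F i) m.

Lemma fps_mul_varE i (f : fps) (m : monom) :
  fps_mul (fps_var i) f m =
    if i \in finsupp m then f (divcm m (ucm i)) else 0.
Proof.
rewrite /fps_mul /fps_var.
have Ui : (ucm i \in mdivs m) = (i \in finsupp m).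
  rewrite mem_mdivs -cmE_neq0; apply/mdvdP/idP => [/(_ i)|mi j].
    by rewrite cmU eqxx lt0n.
  by rewrite cmU; case: eqVneq => // <-; rewrite lt0n.
rewrite -Ui; case: ifP => [Um|Um].
  rewrite (big_fsetD1 (ucm i)) //= eqxx mul1r big_seq big1 ?addr0 // => d.
  by rewrite !inE => /andP[/negPf -> _]; rewrite mul0r.
rewrite big_seq big1 // => d dm; case: eqVneq => [dU|]; rewrite ?mul0r //.
by rewrite -dU dm in Um.
Qed.

Lemma fps_mul_var_eq0 i (f : fps) (m : monom) :
  i \notin finsupp m -> fps_mul (fps_var i) f m = 0.
Proof. by rewrite fps_mul_varE => /negPf ->. Qed.

(* R = t + sum_(i >= 1) x_i * binom(2i-1, i) * R^i *)
Definition R_rhs (R : fps) : fps :=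
  fps_add (fps_var 0)
    (fps_xsum (fun i => fps_scale ('C(i.*2.-1, i))%:R (fps_exp R i))).

Definition R_equation (R : fps) : Prop := R =1 R_rhs R.

Section RExistsUnique.

Let agree (n : nat) (f g : fps) := forall m, (mdeg m < n)%N -> f m = g m.

Let mdeg_div (m d : monom) : mdvd d m -> (mdeg d + mdeg (divcm m d) = mdeg m)%N.
Proof.
move=> /mdvdP dm; rewrite -mdegM; congr mdeg.
by apply/eqP/cmP => i; rewrite cmM divcmE subnKC.
Qed.

Let agree_mul n f f' g g' :
  agree n f f' -> agree n g g' -> agree n (fps_mul f g) (fps_mul f' g').
Proof.
move=> ff gg m mn; rewrite /fps_mul big_seq [RHS]big_seq.
apply: eq_bigr => d; rewrite mem_mdivs => /mdeg_div dm.
rewrite ff ?gg //; apply: leq_ltn_trans mn; rewrite -dm.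
  exact: leq_addl.
exact: leq_addr.
Qed.

Let agree_rhs n f g : agree n f g -> agree n.+1 (R_rhs f) (R_rhs g).
Proof.
move=> fg m mn; rewrite /R_rhs /fps_add /fps_xsum; congr (_ + _).
rewrite big_seq_cond [RHS]big_seq_cond; apply: eq_bigr => i /andP[im _].
rewrite !fps_mul_varE im /fps_scale; congr (_ * _).
have : agree n (fps_exp f i) (fps_exp g i).
  by elim: i {im} => [|i IH] //=; apply: agree_mul.
apply; have Um : mdvd (ucm i) m.
  apply/mdvdP => j; rewrite cmU; case: eqVneq => // <-.
  by rewrite lt0n cmE_neq0.
by move: mn; rewrite -(mdeg_div Um) mdegU.
Qed.

Theorem R_equation_ex : exists R, R_equation R.
Proof.
pose A n := iter n R_rhs (fun=> 0).
have AS n k : agree n (A n) (A (n + k)%N).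
  by elim: n => [|n IH] // m; exact: agree_rhs.
pose R : fps := fun m => A (mdeg m).+1 m.
have RA n : agree n R (A n).
  by move=> m mn; rewrite -(subnKC mn); apply: AS.
exists R => m; rewrite /R.
exact: (agree_rhs (fun m' h => esym (RA _ m' h))).
Qed.

Theorem R_equation_uniq R R' : R_equation R -> R_equation R' -> R =1 R'.
Proof.
move=> eR eR'; have RR n : agree n R R'.
  elim: n => [|n IH] // m mn; rewrite eR eR'; exact: (agree_rhs IH).
by move=> m; exact: (RR (mdeg m).+1).
Qed.

End RExistsUnique.

(* A map is encoded by two permutations of its set T of darts (half-edges):
   sigma turns a dart into the next one around its origin vertex, and ends
   exchanges the two darts of an edge.  Vertices, edges and faces are the cycles
   of sigma, ends and face_perm sigma ends.  Each corner is identified with the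
   dart that bounds it on a fixed side, so a corner is incident to the face
   containing its dart, and the degree of a face is the length of its cycle. *)
Section Maps.

Variable T : finType.
Implicit Types sigma ends : {perm T}.

(* d |-> sigma (ends d) *)
Definition face_perm sigma ends : {perm T} := (ends * sigma)%g.

(* Connectedness is transitivity of the action on darts, and being drawn on the
   sphere is Euler's relation V - E + F = 2. *)
Definition planar_map sigma ends : bool :=
  [&& [forall d, (ends d != d) && (ends (ends d) == d)],
      [transitive <<[set sigma; ends]>>, on [set: T] | 'P]
    & #|porbits sigma| + #|porbits (face_perm sigma ends)|
        == #|porbits ends| + 2]%N.

Variables (r : nat) (l : 'I_r -> nat).

(* b i is the marked corner of the i-th boundary-face. *)
Definition boundary_face sigma ends (b : {ffun 'I_r -> T}) (i : 'I_r) :=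
  porbit (face_perm sigma ends) (b i).

Definition inner_faces sigma ends (b : {ffun 'I_r -> T}) : {set {set T}} :=
  porbits (face_perm sigma ends) :\: [set boundary_face sigma ends b i | i : 'I_r].

Definition even_map sigma ends (b : {ffun 'I_r -> T}) : bool :=
  [&& planar_map sigma ends,
      injectiveb (boundary_face sigma ends b),
      [forall i, #|boundary_face sigma ends b i| == l i]
    & [forall f in inner_faces sigma ends b, ~~ odd #|f|]].

(* The product of t over all vertices and of x_(deg f / 2) over all inner
   faces f. *)
Definition map_weight sigma ends (b : {ffun 'I_r -> T}) : monom :=
  mmul (\big[mmul/mone]_(v in porbits sigma) ucm 0%N)
       (\big[mmul/mone]_(f in inner_faces sigma ends b) ucm #|f|./2).

End Maps.

Definition num_darts (r : nat) (l : 'I_r -> nat) (m : monom) : nat :=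
  (\sum_i l i + \sum_(i <- finsupp m) i.*2 * m i)%N.

Lemma card_darts (T : finType) (r : nat) (l : 'I_r -> nat) (m : monom)
    (sigma ends : {perm T}) (b : {ffun 'I_r -> T}) :
  even_map l sigma ends b -> map_weight sigma ends b = m -> #|T| = num_darts l m.
Proof.
case/and4P=> _ /injectiveP binj /forallP bl /forall_inP ev <-.
pose mu (m : monom) := (\sum_(i <- finsupp m) i.*2 * m i)%N.
have muw (d : {fset nat}) (m' : monom) : (finsupp m' `<=` d)%fset ->
    mu m' = (\sum_(i <- d) i.*2 * m' i)%N.
  move=> le; rewrite /mu (big_fset_incl _ le) // => i _.
  by rewrite -cmE_eq0 => /eqP ->; rewrite muln0.
have muM : {morph mu : x y / mmul x y >-> (x + y)%N}.
  move=> x y; rewrite {1}/mu mdomD.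
  rewrite (muw _ _ (fsubsetUl _ (finsupp y))) (muw _ _ (fsubsetUr (finsupp x) _)).
  by rewrite -big_split /=; apply: eq_bigr => i _; rewrite cmM mulnDr.
have mu1 : mu mone = 0%N by rewrite /mu mdom1 big_seq_fset0.
have muU i : mu (ucm i) = i.*2.
  by rewrite /mu mdomU big_seq_fset1 cmUU muln1.
rewrite /num_darts -/(mu _) /map_weight muM !(big_morph _ muM mu1).
rewrite [X in (_ + (X + _))%N]big1 ?add0n; last by move=> *; rewrite muU.
have part : partition (porbits (face_perm sigma ends)) [set: T].
  have -> : porbits (face_perm sigma ends)
      = orbit 'P <[face_perm sigma ends]> @: [set: T].
    apply/setP => X; apply/imsetP/imsetP => -[x _ ->]; exists x => //;
      by rewrite porbit.unlock.
  by apply: orbit_partition; apply/actsP => a _ x; rewrite !inE.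
rewrite -cardsT (card_partition part).
rewrite (big_setID [set boundary_face sigma ends b i | i : 'I_r]) /=.
congr (_ + _)%N.
  rewrite (setIidPr _); last first.
    by apply/subsetP => _ /imsetP[i _ ->]; apply: imset_f.
  rewrite big_imset /=; last by move=> i j _ _; apply: binj.
  by apply: eq_bigr => i _; apply/eqP.
apply: eq_bigr => f fin; rewrite muU.
by rewrite -[LHS]odd_double_half (negPf (ev f fin)).
Qed.

(* An even map with a numbering of its darts by 'I_D, as (sigma, ends, b). *)
Definition marked_map (D r : nat) : Type :=
  ({perm 'I_D} * {perm 'I_D} * {ffun 'I_r -> 'I_D})%type.

(* Orientation-preserving homeomorphisms respecting the marks correspond to
   renumberings of the darts. *)
Definition map_iso (D r : nat) : rel (marked_map D r) := fun M N =>
  let: (sigma, ends, b) := M in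
  let: (sigma', ends', b') := N in
  [exists p : {perm 'I_D},
    [&& (sigma ^ p)%g == sigma', (ends ^ p)%g == ends'
      & [forall i, p (b i) == b' i]]].

Lemma map_iso_equiv (D r : nat) : equivalence_rel (@map_iso D r).
Proof.
have refl : reflexive (@map_iso D r).
  case=> [[s e] b]; apply/existsP; exists 1%g; rewrite !conjg1 !eqxx /=.
  by apply/forallP => i; rewrite perm1.
have sym : symmetric (@map_iso D r).
  suff imp M N : @map_iso D r M N -> map_iso N M by move=> M N; apply/idP/idP; apply: imp.
  case: M N => [[s e] b] [[s' e'] b'] /existsP[p /and3P[/eqP<- /eqP<- /forallP h]].
  apply/existsP; exists p^-1%g; rewrite !conjgK !eqxx /=.
  by apply/forallP => i; rewrite -(eqP (h i)) permK.
have trans : transitive (@map_iso D r).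
  case=> [[s e] b] [[s' e'] b'] [[s2 e2] b2].
  move=> /existsP[p /and3P[/eqP<- /eqP<- /forallP h]].
  move=> /existsP[q /and3P[/eqP<- /eqP<- /forallP k]].
  apply/existsP; exists (p * q)%g; rewrite !conjgM !eqxx /=.
  by apply/forallP => i; rewrite permM (eqP (h i)).
by apply/equivalence_relP; split=> // M N MN P; apply/idP/idP; apply: trans; rewrite // sym.
Qed.

Definition even_maps (D r : nat) (l : 'I_r -> nat) (m : monom) :
    {set marked_map D r} :=
  [set M | let: (sigma, ends, b) := M in
     even_map l sigma ends b && (map_weight sigma ends b == m)].

(* The number of even maps of type l and weight m, up to isomorphism; by
   card_darts it is enough to consider maps with num_darts l m darts. *)
Definition num_even_maps (r : nat) (l : 'I_r -> nat) (m : monom) : nat :=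
  #|equivalence_partition (@map_iso (num_darts l m) r)
      (even_maps (num_darts l m) l m)|.

Definition G (r : nat) (l : 'I_r -> nat) : fps :=
  fun m => (num_even_maps l m)%:R.

Definition alpha (n : nat) : rat :=
  n`!%:R / ((n./2)`! * ((n.-1)./2)`!)%:R.

(* Main.v *)
(* Fix the face permutation phi.  A map is then a fixed-point-free involution e
   pairing the darts such that phi and e act transitively and Euler's relation
   holds.  Choosing a dart d of a face and deleting the edge {d, e d} gives Tutte's
   recurrence: two distinct faces are merged, or one face is cut into two and the
   map falls into two planar maps (Euler's inequality excludes the connected
   case).  It follows by induction that if all faces are rooted, have degrees
   l_1, ..., l_n, and none or two of them are odd, the number of maps is Tutte's
   (E-1)!/V! prod alpha(l_i); that this expression satisfies the recurrence is a
   Hurwitz convolution identity combined with the sum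
   sum_b B_b B_(n-b) / (b + h) = B_(n+h) / (h B_h) of central binomials B.
   Since a rooted map has no automorphism, dividing by the rootings and orderings
   of the inner faces gives the coefficients of G, and those of the derivatives of
   R^s come from R^(s+1) = t R^s + sum_i x_i binom(2i-1,i) R^(i+s). *)

Require Import Defs.
From mathcomp Require Import all_boot all_order all_algebra all_fingroup.
From mathcomp Require Import finmap monalg.
From mathcomp Require Import zify ring.

Set Implicit Arguments.
Unset Strict Implicit.
Unset Printing Implicit Defensive.

Import Order.TTheory GRing.Theory Num.Theory.

(** * Central binomial coefficients *)

Local Open Scope ring_scope.

(** Edges are deleted without ever changing the dart type [T]. Deleted darts stay in the cycles of
    the face permutation and are recorded in a set [F], where [e] is the identity, and the
    components are subsets of [T]. A vertex thus survives the loss of its last edge, and a deletion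
    multiplies both permutations by one transposition. The faces are kept distinguishable, so the
    recurrence needs no power series: sharing the other faces between two components is a sum over
    subsets, and closed forms are coefficients of multilinear monomials, with one variable [y_j] per
    face. In these terms Tutte's number comes from the integral of [R^a] over t when the root face
    has degree 2a, and from [R^(i+w+1)/(i+w+1)] when two faces have odd degrees 2i+1 and 2w+1. The
    integral also gives the right value at a = 0, where (E-1)! may have no meaning. In the even case
    the recurrence is quadratic in the closed form. In the odd case, rooted at an odd face, it is
    linear in the odd form, since by parity the two odd faces left after a cut lie in the same
    component. *)

Section CentralBinomial.

Definition cbin (n : nat) : rat := 'C(n.*2, n)%:R.

Lemma cbin0 : cbin 0 = 1. Proof. by rewrite /cbin bin0. Qed.

Lemma cbin_gt0 n : 0 < cbin n.
Proof. by rewrite /cbin ltr0n bin_gt0 -addnn leq_addr. Qed.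

Lemma cbin_neq0 n : cbin n != 0. Proof. by rewrite gt_eqF // cbin_gt0. Qed.

Lemma cbin_fact n : cbin n * n`!%:R ^+ 2 = n.*2`!%:R.
Proof.
have le : (n <= n.*2)%N by rewrite -addnn leq_addr.
by rewrite -(bin_fact le) -addnn addnK /cbin addnn expr2 !natrM.
Qed.

Lemma cbinS n : n.+1%:R * cbin n.+1 = 2 * n.*2.+1%:R * cbin n.
Proof.
have n0 : n`!%:R != 0 :> rat by rewrite pnatr_eq0 -lt0n fact_gt0.
have := cbin_fact n.+1; rewrite doubleS !factS !natrM -(cbin_fact n).
have -> : n.*2.+2%:R = 2 * n.+1%:R :> rat by rewrite -natrM; congr _%:R; lia.
have n1 : n.+1%:R != 0 :> rat by rewrite pnatr_eq0.
move=> H; apply: (mulfI n1); apply: (mulIf (mulf_neq0 n0 n0)).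
apply: etrans (_ : cbin n.+1 * (n.+1%:R * n`!%:R) ^+ 2 = _); first by ring.
by rewrite H; ring.
Qed.

(** In generating functions: [(1-4z)^(-1/2)] times the Catalan series [(1-(1-4z)^(1/2))/(2z)] is
    [((1-4z)^(-1/2)-1)/(2z)]. The proof telescopes instead. *)
Lemma cbin_catalan_conv n :
  \sum_(b < n.+1) cbin b * cbin (n - b) / (n - b).+1%:R = cbin n.+1 / 2.
Proof.
(* [U k.+1 - U k] is [2(n+1)] times the summand of index [k]. *)
pose U k := k%:R * cbin k * cbin (n.+1 - k).
have tel : \sum_(0 <= k < n.+1) (U k.+1 - U k) = n.+1%:R * cbin n.+1.
  by rewrite telescope_sumr // /U subnn cbin0 mulr1 !mul0r subr0.
have nn : n.+1%:R != 0 :> rat by rewrite pnatr_eq0.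
apply: (mulfI nn); rewrite [RHS]mulrA -tel big_mkord mulr_sumr mulr_suml.
apply: eq_bigr => -[k kn] _ /=; rewrite /U subSS cbinS.
have H := cbinS (n - k).
have E : cbin (n.+1 - k) = 2 * (n - k).*2.+1%:R * cbin (n - k) / (n - k).+1%:R.
  by rewrite -H -subSn //; field; rewrite pnatr_eq0 subn_eq0 -ltnNge.
rewrite E {E H}; have [m nE] : exists m, n = (k + m)%N by exists (n - k)%N; lia.
have m1 : m.+1%:R != 0 :> rat by rewrite pnatr_eq0.
move: m1; rewrite nE addKn -(natr1 (k + m)) -(natr1 k.*2) -(natr1 m.*2) -(natr1 m) -!mul2n !natrM !natrD => m1; field.
by rewrite m1.
Qed.

(** Both sides satisfy [(n+1+h) S(n+1) = 2(2(n+h)+1) S(n)]; for the right one this is [cbinS]. *)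
Lemma cbin_conv n h : (0 < h)%N ->
  \sum_(b < n.+1) cbin b * cbin (n - b) / (b + h)%:R
    = cbin (n + h) / (h%:R * cbin h).
Proof.
move=> h0; have h0' : h%:R != 0 :> rat by rewrite pnatr_eq0 -lt0n.
elim: n => [|n IH].
  rewrite big_ord1 subn0 cbin0 !add0n; field.
  by rewrite h0' cbin_neq0.
have N0 : (n.+1 + h)%:R != 0 :> rat by rewrite pnatr_eq0.
apply: (mulfI N0); rewrite big_ord_recr /= subnn cbin0 mulr1 mulrDr.
rewrite [(n.+1 + h)%:R * (cbin _ / _)]mulrCA divff // mulr1.
have -> : (n.+1 + h)%:R * (cbin (n.+1 + h) / (h%:R * cbin h))
   = 2 * (n + h).*2.+1%:R * (cbin (n + h) / (h%:R * cbin h)).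
  by rewrite !mulrA addSn cbinS.
(* The last term of the sum has become [cbin n.+1]. Spread over b as a Catalan convolution, it makes
   the recurrence hold term by term. *)
rewrite -IH; have -> : cbin n.+1 =
    (\sum_(b < n.+1) cbin b * cbin (n - b) / (n - b).+1%:R) * 2.
  by rewrite cbin_catalan_conv; field.
rewrite mulr_suml !mulr_sumr -big_split /=; apply: eq_bigr => -[b bn] _ /=.
have H := cbinS (n - b); have [m nE] : exists m, n = (b + m)%N by exists (n - b)%N; lia.
have -> : (n.+1 - b = m.+1)%N by lia.
move: H; have -> : (n - b = m)%N by lia.
have m1 : m.+1%:R != 0 :> rat by rewrite pnatr_eq0.
move/(canRL (mulKf m1)) => ->.
have bh : (b + h)%:R != 0 :> rat by rewrite pnatr_eq0; lia.
move: m1 bh; rewrite nE addSn -(natr1 (b + m + h)) -(natr1 (b + m + h).*2) -(natr1 m.*2) -(natr1 m) -!mul2n !natrM !natrD => m1 bh; field.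
by rewrite m1 bh.
Qed.

Lemma alpha_double n : alpha n.*2 = if n == 0%N then 1 else n%:R * cbin n.
Proof.
rewrite /alpha doubleK; case: n => [|n] /=; first by rewrite divr1.
rewrite -cbin_fact uphalf_double factS !natrM.
have n0 : n`!%:R != 0 :> rat by rewrite pnatr_eq0 -lt0n fact_gt0.
have n1 : n.+1%:R != 0 :> rat by rewrite pnatr_eq0.
by field; rewrite n0 nat1r n1.
Qed.

Lemma alpha_doubleS n : alpha n.*2.+1 = n.*2.+1%:R * cbin n.
Proof.
have n0 : n`!%:R != 0 :> rat by rewrite pnatr_eq0 -lt0n fact_gt0.
rewrite /alpha /= uphalf_double doubleK factS natrM -cbin_fact natrM; field.
by rewrite n0.
Qed.

End CentralBinomial.

(** * Hurwitz convolutions *)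

Section Hurwitz.

Variables (K : finType) (h : K -> nat).
Implicit Types (I J L : {set K}) (x y : nat).

Definition hsum L := (\sum_(j in L) h j)%N.

(* For R = t + sum_j y_j R^(h j), the coefficient of prod_(j in L) y_j in R^x,
   at t = 1. *)
Definition hpol x L : rat :=
  if #|L| is k.+1 then x%:R * ((x + hsum L).-1 ^_ k)%:R else 1.

Lemma hpol0l L : hpol 0 L = (L == set0)%:R.
Proof. by rewrite -cards_eq0 /hpol; case: #|L| => //= k; rewrite mul0r. Qed.

Lemma hpol_set0 x : hpol x set0 = 1.
Proof. by rewrite /hpol cards0. Qed.

Lemma hsumD1 j L : j \in L -> hsum L = (h j + hsum (L :\ j))%N.
Proof. by move=> jL; rewrite /hsum (big_setD1 j). Qed.

Lemma sum_natr_h L x : \sum_(j in L) (x + h j)%:R = (#|L| * x + hsum L)%:R :> rat.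
Proof. by rewrite -natr_sum big_split /= sum_nat_const. Qed.

Lemma hpolD1 x j L k : #|L| = k.+2 -> j \in L ->
  hpol (x + h j) (L :\ j) = (x + h j)%:R * ((x + hsum L).-1 ^_ k)%:R.
Proof.
move=> cL jL; rewrite (hsumD1 jL) addnA /hpol.
by move: cL; rewrite (cardsD1 j) jL add1n => -[->].
Qed.

(** Coefficients of [R^(x+1) = t R^x + sum_j y_j R^(x+h_j)] at t = 1. *)
Lemma hpolS x L :
  hpol x.+1 L = hpol x L + \sum_(j in L) hpol (x + h j) (L :\ j).
Proof.
case cL: #|L| => [|[|k]].
- by rewrite (cards0_eq cL) !hpol_set0 big_set0 addr0.
- have /cards1P[j ->] : #|L| == 1%N by rewrite cL.
  by rewrite big_set1 setDv hpol_set0 /hpol !cards1 !ffactn0 !mulr1 natr1.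
rewrite (eq_bigr _ (fun j => hpolD1 x cL)) -mulr_suml sum_natr_h /hpol cL.
rewrite -natrM -natrM -natrM -natrD; congr _%:R.
set H := hsum L; rewrite addSn /=.
case xH: (x + H)%N => [|n] /=.
  have [-> ->] : x = 0%N /\ H = 0%N by lia.
  by case: k {cL} => [|k]; rewrite ?ffactnSr /=; lia.
rewrite ffactSS ffactnSr; set f := (n ^_ k)%N.
have [lt|ge] := ltnP n k; first by rewrite /f ffact_small // !mul0n !muln0.
have [d nE] : exists d, n = (k + d)%N by exists (n - k)%N; lia.
have -> : (n - k = d)%N by lia.
nia.
Qed.

(** A marked element j of I is removed from both I and L. This brings the sums over j of [hpolS] and
    [hprimE] out of a convolution. *)
Lemma exchange_subset_elem (V : nmodType) (f : K -> {set K} -> {set K} -> V) L :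
  \sum_(I : {set K} | I \subset L) \sum_(j in I) f j (I :\ j) (L :\: I)
  = \sum_(j in L) \sum_(I : {set K} | I \subset L :\ j) f j I ((L :\ j) :\: I).
Proof.
rewrite (exchange_big_dep (mem L)) /=; last by move=> I j /subsetP IL /IL.
apply: eq_bigr => j jL.
rewrite (reindex_onto (fun I => j |: I) (fun I => I :\ j)) /=; last first.
  by move=> I /andP[_ jI]; rewrite setD1K.
apply: eq_big => [I|I /andP[/andP[_ _] /eqP E]].
  rewrite setU11 andbT subUset sub1set jL /= subsetD1; case IL: (I \subset L) => //=.
  apply/eqP/idP => [<-|]; first by rewrite !inE eqxx.
  exact: setU1K.
rewrite E; congr f; apply/setP => z; rewrite !inE.
by case: eqVneq; case: (z \in I); case: (z \in L).
Qed.

(** This is [R^x R^y = R^(x+y)]. Applied to the first factor, [hpolS] either lowers x or removes an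
    element of L, whence an induction on x inside one on [#|L|]. *)
Lemma hurwitz x y L :
  \sum_(I : {set K} | I \subset L) hpol x I * hpol y (L :\: I) = hpol (x + y) L.
Proof.
elim: {L}_.+1 {-2}L x (ltnSn #|L|) => // n IHn L x ltL.
elim: x => [|x IHx].
  rewrite (bigD1 set0) ?sub0set //= hpol_set0 setD0 mul1r big1 ?addr0 // => I.
  by case/andP=> _ /negPf I0; rewrite hpol0l I0 mul0r.
under eq_bigr => I _ do rewrite hpolS mulrDl mulr_suml.
rewrite big_split /= IHx (exchange_subset_elem (fun j A B => hpol (x + h j) A * hpol y B)).
rewrite addSn hpolS; congr (_ + _); apply: eq_bigr => j jL.
rewrite IHn 1?addnAC //; move: ltL; rewrite (cardsD1 j) jL add1n ltnS; exact: leq_trans.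
Qed.

(* hvert x L is the exponent of t in the corresponding term of the integral of
   R^x over t, and hprim x L is the coefficient of that term. *)
Definition hvert x L : nat := ((x + hsum L).+1 - #|L|)%N.

Definition hprim x L : rat := hpol x L / (hvert x L)%:R.

Definition hpos L := forall j, j \in L -> (0 < h j)%N.

Lemma hpos_le L : hpos L -> (#|L| <= hsum L)%N.
Proof. by move=> hL; rewrite -sum1_card; apply: leq_sum => j /hL. Qed.

Lemma hpos_sub I L : I \subset L -> hpos L -> hpos I.
Proof. by move=> /subsetP IL hL j /IL/hL. Qed.

Lemma hvert_gt0 x L : hpos L -> (0 < hvert x L)%N.
Proof. by move=> /hpos_le; rewrite /hvert; lia. Qed.

(* Substitute dt = (1 - sum_j h_j y_j R^(h_j - 1)) dR in the integral of R^x. *)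
Lemma hprimE x L : hpos L -> hprim x L =
  hpol x.+1 L / x.+1%:R
   - \sum_(j in L) (h j)%:R * hpol (x + h j) (L :\ j) / (x + h j)%:R.
Proof.
move=> hL; have x1 : x.+1%:R != 0 :> rat by rewrite pnatr_eq0.
have := hvert_gt0 x hL; rewrite /hprim /hvert.
case cL: #|L| => [|[|k]].
- rewrite (cards0_eq cL) !hpol_set0 big_set0 subr0 /hsum big_set0 addn0 subn0 //.
- have /cards1P[j Lj] : #|L| == 1%N by rewrite cL.
  have hj : (0 < h j)%N by apply: hL; rewrite Lj set11.
  rewrite Lj big_set1 setDv hpol_set0 /hpol !cards1 !ffactn0 !mulr1 divff //.
  rewrite /hsum big_set1 subn1 /= natrD => _; field.
  by rewrite -natrD pnatr_eq0; lia.
rewrite (eq_bigr (fun j => (h j)%:R * ((x + hsum L).-1 ^_ k)%:R)); last first.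
  move=> j jL; rewrite (hpolD1 x cL) // -mulrA; congr (_ * _).
  by rewrite mulrAC divff ?mul1r // pnatr_eq0; have := hL _ jL; lia.
rewrite -mulr_suml -natr_sum -/(hsum L) /hpol cL => V0.
rewrite [x.+1%:R * _]mulrC mulfK // addSn /=.
have := hpos_le hL; rewrite cL; set H := hsum L => kH.
have [n xH] : exists n, (x + H = n.+1)%N by exists (x + H).-1; lia.
rewrite xH /= ffactSS ffactnSr subSS.
have V1 : (n.+1 - k.+1)%:R != 0 :> rat by rewrite pnatr_eq0; lia.
rewrite !natrM mulrA (_ : (n - k) = (n.+1 - k.+1))%N; last by lia.
rewrite mulfK // -mulrBl -xH natrD addrK //.
Qed.

(** [hprimE] turns the integral of [R^x] into powers of R, which [hurwitz] multiplies by [R^y]. *)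
Lemma hprim_convol x y L : hpos L ->
  \sum_(I : {set K} | I \subset L) hprim x I * hpol y (L :\: I)
  = hpol (x + y).+1 L / x.+1%:R
    - \sum_(j in L) (h j)%:R / (x + h j)%:R * hpol (x + y + h j) (L :\ j).
Proof.
move=> hL; pose f j A B := (h j)%:R / (x + h j)%:R * (hpol (x + h j) A * hpol y B).
transitivity (\sum_(I : {set K} | I \subset L)
    (x.+1%:R^-1 * (hpol x.+1 I * hpol y (L :\: I))
     - \sum_(j in I) f j (I :\ j) (L :\: I))).
  apply: eq_bigr => I IL; rewrite (hprimE _ (hpos_sub IL hL)) mulrBl; congr (_ - _).
    by ring.
  by rewrite mulr_suml; apply: eq_bigr => j _; rewrite /f; ring.
rewrite big_split /= sumrN -mulr_sumr hurwitz exchange_subset_elem addSn mulrC.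
congr (_ - _); apply: eq_bigr => j jL.
by rewrite -mulr_sumr hurwitz addnAC.
Qed.

End Hurwitz.

(** * Loop equations for the closed forms *)

Section SubsetSums.
Variables (K : finType) (V : nmodType).
Implicit Types (L I : {set K}) (f : {set K} -> V).

Lemma sum_subset_compl L f :
  (\sum_(I : {set K} | I \subset L) f I = \sum_(I : {set K} | I \subset L) f (L :\: I)).
Proof.
rewrite (reindex_onto (fun I => L :\: I) (fun I => L :\: I)) /=; last first.
  by move=> I IL; rewrite setDDr setDv set0U (setIidPr IL).
apply: eq_bigl => I; rewrite subsetDl /= setDDr setDv set0U.
by apply/eqP/idP => [<-|/setIidPr //]; apply: subsetIl.
Qed.

Lemma sum_subsetU1 L f j : j \notin L ->
  (\sum_(I : {set K} | I \subset j |: L) f I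
   = \sum_(I : {set K} | I \subset L) f I + \sum_(I : {set K} | I \subset L) f (j |: I)).
Proof.
move=> jL; rewrite (bigID (fun I : {set K} => j \in I)) [LHS]addrC /=; congr (_ + _).
  apply: eq_bigl => I; apply/andP/idP => [[IL jI]|IL].
    apply/subsetP => x xI; have := subsetP IL x xI; rewrite inE => /orP[|//].
    by rewrite inE => /eqP E; rewrite -E xI in jI.
  split; first exact: subset_trans IL (subsetUr _ _).
  by apply: contra jL => /(subsetP IL).
rewrite (reindex_onto (fun I => j |: I) (fun I => I :\ j)) /=; last first.
  by move=> I /andP[_ jI]; rewrite setD1K.
apply: eq_bigl => I; rewrite setU11 andbT; apply/andP/idP => [[jI /eqP E]|IL].
  apply/subsetP => x xI; have := subsetP jI x; rewrite !inE xI orbT => /(_ isT).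
  by case/orP=> // /eqP xj; move: xI; rewrite -E xj !inE eqxx.
by rewrite setUS // setU1K //; apply: contra jL => /(subsetP IL).
Qed.
End SubsetSums.

Section LoopEquations.

Variables (K : finType) (h : K -> nat).
Implicit Types (I J L : {set K}).

(** Cutting a root face of degree 2(x+y+1) along an edge leaves root faces of degrees 2x and 2y, and
    shares the vertices between the two components. *)
Lemma hvert_split x y L I : hpos h L -> I \subset L ->
  hvert h (x + y).+1 L = (hvert h x I + hvert h y (L :\: I))%N.
Proof.
move=> hL IL; have := hpos_le (hpos_sub IL hL).
have := hpos_le (hpos_sub (subsetDl L I) hL).
have hL' : hsum h L = (hsum h I + hsum h (L :\: I))%N.
  by rewrite /hsum (big_setID I) /= (setIidPr IL).
have := cardsID I L; rewrite (setIidPr IL) /hvert hL'; lia.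
Qed.

(** Merging the root face with the face j costs one edge and one face, so the number of vertices is
    kept. *)
Lemma hvertD1 x L j : hpos h L -> j \in L ->
  hvert h (x + h j).-1 (L :\ j) = hvert h x L.
Proof.
move=> hL jL; have := hL j jL; have := hpos_le (hpos_sub (subD1set L j) hL).
by rewrite /hvert (hsumD1 _ jL) (cardsD1 j L) jL; lia.
Qed.

(* Multiplying by the number of vertices, which is additive over the two parts,
   linearizes the quadratic term. *)
Lemma even_loop a L : hpos h L ->
  cbin a.+1 * hprim h a.+1 L =
  \sum_(j in L) 2 * cbin (a + h j) / cbin (h j) * hprim h (a + h j) (L :\ j)
  + \sum_(b < a.+1) cbin b * cbin (a - b) *
      \sum_(I : {set K} | I \subset L) hprim h b I * hprim h (a - b) (L :\: I).
Proof.
move=> hL; set v := (hvert h a.+1 L)%:R : rat.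
have v0 : v != 0 by rewrite pnatr_eq0 -lt0n hvert_gt0.
apply: (mulIf v0); rewrite {1}/hprim mulrA mulfVK // mulrDl.
(* Each of the two vertex numbers adding up to v cancels one denominator. The two sums so obtained
   are exchanged by b -> a - b and I -> L \ I, hence the factor 2. *)
have -> : (\sum_(b < a.+1) cbin b * cbin (a - b) * \sum_(I : {set K} | I \subset L)
      hprim h b I * hprim h (a - b) (L :\: I)) * v =
   2 * \sum_(b < a.+1) cbin b * cbin (a - b) * \sum_(I : {set K} | I \subset L)
      hprim h b I * hpol h (a - b) (L :\: I).
  pose S b := cbin b * cbin (a - b) * \sum_(I : {set K} | I \subset L)
      hprim h b I * hpol h (a - b) (L :\: I).
  rewrite -/(S _) mulr_natl mulr2n -[X in _ = _ + X](big_mkord xpredT S).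
  rewrite big_nat_rev /= big_mkord -big_split /= mulr_suml; apply: eq_bigr => -[b ba] _ /=.
  rewrite /S subSS subKn // [cbin (a - b) * cbin b]mulrC -mulrDr -mulrA; congr (_ * _).
  rewrite [X in _ + X]sum_subset_compl -big_split /= mulr_suml.
  apply: eq_bigr => I IL; rewrite setDDr setDv set0U (setIidPr IL).
  have -> : v = (hvert h b I)%:R + (hvert h (a - b) (L :\: I))%:R.
    by rewrite -natrD -hvert_split // subnKC.
  rewrite /hprim.
  have p1 : (hvert h b I)%:R != 0 :> rat.
    by rewrite pnatr_eq0 -lt0n hvert_gt0 //; apply: hpos_sub hL.
  have p2 : (hvert h (a - b) (L :\: I))%:R != 0 :> rat.
    by rewrite pnatr_eq0 -lt0n hvert_gt0 //; apply: hpos_sub hL; apply: subsetDl.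
  by field; rewrite p1 p2.
under [X in _ + 2 * X]eq_bigr => b _.
  rewrite hprim_convol // (subnKC (ltn_ord b : b <= a)%N) mulrBr mulr_sumr.
  over.
rewrite big_split /= sumrN exchange_big /= mulrBr addrCA.
have -> : 2 * \sum_(b < a.+1) cbin b * cbin (a - b) * (hpol h a.+1 L / b.+1%:R)
  = cbin a.+1 * hpol h a.+1 L.
  (* The main term is the convolution at h = 1, where [cbin 1 = 2]. *)
  have /= H := @cbin_conv a 1 isT.
  have -> : cbin a.+1 = 2 * (cbin (a + 1) / (1 * cbin 1)).
    by rewrite addn1; have -> : cbin 1 = 2 by []; field.
  rewrite -H -mulrA mulr_suml; congr (_ * _); apply: eq_bigr => b _.
  by rewrite addn1; ring.
(* What remains cancels for each j separately, by the convolution at [h j]. *)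
rewrite -[LHS]addr0; congr (_ + _); apply/esym/eqP.
rewrite mulr_suml mulr_sumr subr_eq0; apply/eqP; apply: eq_bigr => j jL.
have hj := hL j jL.
have -> : v = (hvert h (a + h j) (L :\ j))%:R by rewrite /v -(hvertD1 a.+1 hL jL).
rewrite /hprim mulrA mulfVK; last first.
  by rewrite pnatr_eq0 -lt0n hvert_gt0 //; apply: hpos_sub hL; apply: subD1set.
have H := @cbin_conv a (h j) hj.
have hj0 : (h j)%:R != 0 :> rat by rewrite pnatr_eq0 -lt0n.
have -> : cbin (a + h j) = (h j)%:R * cbin (h j) *
  \sum_(b < a.+1) cbin b * cbin (a - b) / (b + h j)%:R.
  by rewrite H; field; rewrite hj0 cbin_neq0.
rewrite -!mulrA !mulr_suml !mulr_sumr; apply: eq_bigr => b _.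
by field; rewrite cbin_neq0 -natrD pnatr_eq0; lia.
Qed.

(** The value of [alpha] at 2i+1, by [alpha_doubleS]. *)
Definition codd i : rat := i.*2.+1%:R * cbin i.

Lemma codd_half i : 2 * codd i = i.+1%:R * cbin i.+1.
Proof. by rewrite cbinS /codd mulrA. Qed.

(** In partial fractions, [(i+w+g)(i-b)/((b+g)(i-b+w))] equals [(i+g)/(b+g) - w/(i-b+w)], and
    [cbin_conv] sums both terms. The sums stop before b = i, but the two missing terms are both
    [cbin i]. *)
Lemma cbin_odd_conv i w g : (0 < g)%N ->
  (i + w + g)%:R * \sum_(b < i) cbin b * ((i - b)%:R * cbin (i - b))
      / ((b + g)%:R * (i - b + w)%:R)
  = (i + g)%:R * cbin (i + g) / (g%:R * cbin g) - cbin (i + w) / cbin w.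
Proof.
move=> g0; rewrite mulr_sumr.
under eq_bigr => b _.
  rewrite (_ : _ * _ = (i + g)%:R * (cbin b * cbin (i - b) / (b + g)%:R)
     - w%:R * (cbin b * cbin (i - b) / (i - b + w)%:R)); first over.
  case: b => b bi /=; have [j iE] : exists j, (i = b + j.+1)%N.
    by exists (i - b).-1; lia.
  have n1 : (b + g)%:R != 0 :> rat by rewrite pnatr_eq0; lia.
  have n2 : (j.+1 + w)%:R != 0 :> rat by rewrite pnatr_eq0.
  move: n1 n2; rewrite iE addKn !natrD -natr1 => n1 n2; field.
  by rewrite n1 [X in X != 0](_ : _ = j%:R + 1 + w%:R) ?n2 //; ring.
have E1 : (i + g)%:R * cbin (i + g) / (g%:R * cbin g) =
   \sum_(b < i) (i + g)%:R * (cbin b * cbin (i - b) / (b + g)%:R) + cbin i.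
  rewrite -mulrA -cbin_conv // big_ord_recr /= mulrDr mulr_sumr subnn cbin0.
  by rewrite mulr1 mulrCA divff ?mulr1 // pnatr_eq0; lia.
rewrite E1 big_split /= sumrN -addrA; congr (_ + _).
(* [cbin_conv] does not apply at w = 0, where the second sum vanishes. *)
case: w => [|w].
  rewrite big1 ?oppr0; last by move=> b _; rewrite mul0r.
  by rewrite addn0 cbin0 divr1 subrr.
have E2 : cbin (i + w.+1) / cbin w.+1 =
   \sum_(b < i) w.+1%:R * (cbin b * cbin (i - b) / (i - b + w.+1)%:R) + cbin i.
  have w0 : w.+1%:R != 0 :> rat by rewrite pnatr_eq0.
  transitivity (w.+1%:R * (cbin (i + w.+1) / (w.+1%:R * cbin w.+1))).
    by field; rewrite cbin_neq0 nat1r w0.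
  rewrite -cbin_conv // -(big_mkord xpredT (fun b => cbin b * cbin (i - b) / (b + w.+1)%:R)).
  rewrite big_nat_rev /= big_mkord big_ord_recr /= mulrDr mulr_sumr add0n !subSS !subnn subn0 cbin0 add0n.
  congr (_ + _); last by rewrite mul1r mulrCA divff ?mulr1.
  by apply: eq_bigr => b _; rewrite subSS subKn 1?ltnW // [cbin (i - b) * _]mulrC.
by rewrite E2 opprD addrCA subrr addr0.
Qed.

(** The coefficient of [Q j] in [odd_loop], with g = [h j]. The same identity at g = 1 gives the
    coefficient of the main term [P]. *)
Lemma odd_loop_coef i w g : (0 < g)%N ->
  2 * codd (i + g).-1 / cbin g * codd w / (i + w + g)%:R
  = w.*2.+1%:R * cbin (i + w) * (g%:R / (i + w + g)%:R)
    + 2 * \sum_(b < i) cbin b * codd (i.-1 - b) * codd w / (i - b + w)%:R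
            * (g%:R / (b + g)%:R).
Proof.
move=> g0; have g0' : g%:R != 0 :> rat by rewrite pnatr_eq0 -lt0n.
have D0 : (i + w + g)%:R != 0 :> rat by rewrite pnatr_eq0; lia.
have -> : 2 * \sum_(b < i) cbin b * codd (i.-1 - b) * codd w / (i - b + w)%:R
            * (g%:R / (b + g)%:R) =
  g%:R * codd w * \sum_(b < i) cbin b * ((i - b)%:R * cbin (i - b))
      / ((b + g)%:R * (i - b + w)%:R).
  rewrite !mulr_sumr; apply: eq_bigr => b _; have bi := ltn_ord b.
  have -> : (i - b = (i.-1 - b).+1)%N by lia.
  set j := (i.-1 - b)%N; rewrite -codd_half; field; rewrite nat1r -!natrD !pnatr_eq0; lia.
rewrite [X in _ = X + _]mulrA; apply: (mulIf D0); rewrite [RHS]mulrDl !mulfVK //.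
rewrite -[X in _ = _ + X]mulrA [X in _ = _ + _ * X]mulrC cbin_odd_conv //.
rewrite codd_half (_ : ((i + g).-1.+1 = i + g)%N); last by lia.
rewrite /codd; field.
by rewrite !cbin_neq0 g0'.
Qed.

(** Only the even component carries an [hprim], so [hprim_convol] applies without first multiplying
    by the number of vertices. The factor 2 says that the even component may lie on either side of
    the cut. *)
Lemma odd_loop i w L : hpos h L ->
  codd i * codd w * (hpol h (i + w).+1 L / (i + w).+1%:R) =
  w.*2.+1%:R * cbin (i + w) * hprim h (i + w) L
  + \sum_(j in L) 2 * codd (i + h j).-1 / cbin (h j) * codd w *
        (hpol h (i + w + h j) (L :\ j) / (i + w + h j)%:R)
  + 2 * \sum_(b < i) cbin b * codd (i.-1 - b) * codd w *
      \sum_(I : {set K} | I \subset L)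
         hprim h b I * (hpol h (i - b + w) (L :\: I) / (i - b + w)%:R).
Proof.
move=> hL; rewrite hprimE // mulrBr.
pose P := hpol h (i + w).+1 L; pose Q j := hpol h (i + w + h j) (L :\ j).
rewrite -/P.
(* Every term becomes a combination of [P] and the [Q j]. The weight 1/(b+1) in front of [P] is
   [g/(b+g)] at g = 1. *)
have -> : 2 * \sum_(b < i) cbin b * codd (i.-1 - b) * codd w *
      \sum_(I : {set K} | I \subset L)
         hprim h b I * (hpol h (i - b + w) (L :\: I) / (i - b + w)%:R)
  = P * (2 * \sum_(b < i) cbin b * codd (i.-1 - b) * codd w / (i - b + w)%:R
            * (1%:R / (b + 1)%:R))
   - \sum_(j in L) Q j * (2 * \sum_(b < i) cbin b * codd (i.-1 - b) * codd w / (i - b + w)%:R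
            * ((h j)%:R / (b + h j)%:R)).
  under [X in _ = _ - X]eq_bigr => j _ do rewrite mulrCA mulr_sumr.
  rewrite -mulr_sumr mulrCA -mulrBr exchange_big /= [in RHS]mulr_sumr -sumrB.
  congr (_ * _); apply: eq_bigr => b _; have bi := ltn_ord b.
  under eq_bigr => I _ do rewrite mulrA.
  rewrite -mulr_suml hprim_convol // addnA subnKC; last by lia.
  rewrite -/P addn1; set c := cbin b * _.
  have -> : \sum_(j in L) Q j * (c * codd w / (i - b + w)%:R * ((h j)%:R / (b + h j)%:R))
    = c * codd w / (i - b + w)%:R * \sum_(j in L) (h j)%:R / (b + h j)%:R * Q j.
    by rewrite mulr_sumr; apply: eq_bigr => j _; ring.
  by rewrite /Q; ring.
have -> : \sum_(j in L) 2 * codd (i + h j).-1 / cbin (h j) * codd w *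
        (hpol h (i + w + h j) (L :\ j) / (i + w + h j)%:R)
  = \sum_(j in L) Q j * (2 * codd (i + h j).-1 / cbin (h j) * codd w / (i + w + h j)%:R).
  by apply: eq_bigr => j _; rewrite -/(Q j); ring.
under [X in _ + X + _]eq_bigr => j jL do rewrite (odd_loop_coef _ _ (hL j jL)) mulrDr.
rewrite big_split /= -/(Q _).
have := @odd_loop_coef i w 1 isT; rewrite !addn1 /=.
have -> : 2 * codd i / cbin 1 = codd i.
  by have -> : cbin 1 = 2 by []; field.
move=> E.
rewrite (_ : codd i * codd w * (P / _) = P * (codd i * codd w / (i + w).+1%:R)); last by ring.
rewrite E.
have -> : w.*2.+1%:R * cbin (i + w) * \sum_(j in L) (h j)%:R * hpol h (i + w + h j) (L :\ j) / (i + w + h j)%:R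
  = \sum_(j in L) Q j * (w.*2.+1%:R * cbin (i + w) * ((h j)%:R / (i + w + h j)%:R)).
  by rewrite mulr_sumr; apply: eq_bigr => j _; rewrite -/(Q j); ring.
by ring.
Qed.

End LoopEquations.

(** * Cutting an edge of a connected map *)

Local Open Scope nat_scope.

Section Stable.

Variable T : finType.
Implicit Types (p q phi e : {perm T}) (X Y Z W F : {set T}).

Definition stable p X := [forall x in X, p x \in X].

Lemma stableP p X : reflect (forall x, x \in X -> p x \in X) (stable p X).
Proof. exact: (iffP forall_inP). Qed.

Lemma stableE p X x : stable p X -> (p x \in X) = (x \in X).
Proof.
move=> /stableP sX; apply/idP/idP; last exact: sX.
have pX : p @: X = X.
  apply/eqP; rewrite eqEcard card_imset; last exact: perm_inj.
  by rewrite leqnn andbT; apply/subsetP => _ /imsetP[y yX ->]; apply: sX.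
by rewrite -{1}pX => /imsetP[y yX /perm_inj ->].
Qed.

Lemma stableU p X Y : stable p X -> stable p Y -> stable p (X :|: Y).
Proof.
move=> sX sY; apply/stableP => x; rewrite !inE (stableE _ sX) (stableE _ sY) //.
Qed.

Lemma stableI p X Y : stable p X -> stable p Y -> stable p (X :&: Y).
Proof.
move=> sX sY; apply/stableP => x; rewrite !inE (stableE _ sX) (stableE _ sY) //.
Qed.

Lemma stableD p X Y : stable p X -> stable p Y -> stable p (X :\: Y).
Proof.
move=> sX sY; apply/stableP => x; rewrite !inE (stableE _ sX) (stableE _ sY) //.
Qed.

Lemma stableT p : stable p setT.
Proof. by apply/stableP => x; rewrite !inE. Qed.

Lemma stable_porbit p x : stable p (porbit p x).
Proof.
by apply/stableP => y; rewrite -!eq_porbit_mem => /eqP <-; rewrite (porbit_perm p 1).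
Qed.

Lemma porbit_sub p X x : stable p X -> x \in X -> porbit p x \subset X.
Proof.
move=> sX xX; apply/subsetP => _ /porbitP[i ->].
elim: i => [|i IH]; first by rewrite expg0 perm1.
by rewrite expgSr permM stableE.
Qed.

Lemma porbit_eq_in p q X x : stable p X -> {in X, p =1 q} -> x \in X ->
  porbit p x = porbit q x.
Proof.
move=> sX pq xX; have H i : (p ^+ i)%g x = (q ^+ i)%g x /\ (p ^+ i)%g x \in X.
  elim: i => [|i [E iX]]; first by rewrite !expg0 !perm1.
  by rewrite !expgSr !permM -E pq // -pq // stableE.
apply/setP => y; apply/porbitP/porbitP => -[i ->]; exists i; by case: (H i).
Qed.

Lemma stable_eq_in p q X : {in X, p =1 q} -> stable p X = stable q X.
Proof. by move=> pq; apply/stableP/stableP => sX x xX; rewrite (pq, =^~ pq) ?sX. Qed.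

Definition num_cycles p X := #|porbit p @: X|.

Lemma cyc_eq_in p q X : stable p X -> {in X, p =1 q} -> num_cycles p X = num_cycles q X.
Proof.
by move=> sX pq; rewrite /num_cycles (eq_in_imset (fun x xX => porbit_eq_in sX pq xX)).
Qed.

Lemma num_cycles_split p X Z : stable p Z -> Z \subset X ->
  num_cycles p X = num_cycles p Z + num_cycles p (X :\: Z).
Proof.
move=> sZ ZX; rewrite /num_cycles -{1}(setID X Z) (setIidPr ZX) imsetU cardsU.
suff -> : (porbit p @: Z) :&: (porbit p @: (X :\: Z)) = set0 by rewrite cards0 subn0.
apply/setP => C; rewrite !inE; apply/andP => -[/imsetP[x xZ ->] /imsetP[y yD E]].
move: yD; rewrite inE => /andP[/negP[]].
by rewrite (subsetP (porbit_sub sZ xZ)) // E porbit_id.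
Qed.

Lemma card_porbits p : #|porbits p| = num_cycles p setT.
Proof. by congr #|pred_of_set _|; apply/setP => C; apply/imsetP/imsetP => -[x _ ->]; exists x. Qed.

(** Outside X the transposition does nothing, so the cycle count on the whole type localizes. *)
Lemma cyc_mul_tperm p X x y : stable p X -> x \in X -> y \in X ->
  num_cycles (tperm x y * p) X + (x \notin porbit p y).*2 = num_cycles p X + (x != y).
Proof.
move=> sX xX yX; have /= := porbits_mul_tperm p x y.
rewrite !card_porbits (num_cycles_split sX (subsetT X)) (@num_cycles_split (tperm x y * p)%g setT X) ?subsetT //; last first.
  apply/stableP => z zX; rewrite permM stableE //; case: tpermP => //.
rewrite (@cyc_eq_in (tperm x y * p)%g p (setT :\: X)); first by lia.
  apply/stableP => z; rewrite !inE !andbT permM => zX.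
  by rewrite tpermD ?stableE //; apply: contraNneq zX => <-.
move=> z; rewrite !inE andbT permM => zX.
by rewrite tpermD //; apply: contraNneq zX => <-.
Qed.

Lemma porbit_join p x y : x \notin porbit p y ->
  porbit (tperm x y * p) x = porbit p x :|: porbit p y.
Proof.
move=> xy; have xNy : x != y by apply: contraNneq xy => ->; apply: porbit_id.
set q := (tperm x y * p)%g.
have pq : p = (tperm x y * q)%g by rewrite /q mulgA tperm2 mul1g.
have yx : y \in porbit q x.
  rewrite porbit_sym.
  (* Going from p to q loses a cycle, so going back gains one, which happens only if x and y share a
     cycle of q. *)
  have /= := porbits_mul_tperm p x y; have /= := porbits_mul_tperm q x y.
  rewrite -pq xy xNy /= -/q; case: (x \in _) => //=; lia.
apply/eqP; rewrite eqEsubset; apply/andP; split.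
  apply: porbit_sub; last by rewrite inE porbit_id.
  have sU := stableU (stable_porbit p x) (stable_porbit p y).
  apply/stableP => z zU; rewrite permM stableE //.
  by case: tpermP => // _; rewrite !inE porbit_id ?orbT.
have sW : stable p (porbit q x).
  apply/stableP => z zU; rewrite pq permM stableE ?stable_porbit //.
  by case: tpermP => // _; rewrite ?porbit_id.
by rewrite subUset !porbit_sub ?porbit_id.
Qed.

Lemma porbit_tperm_disj p x y : x != y -> x \in porbit p y ->
  x \notin porbit (tperm x y * p) y.
Proof.
move=> xy xpy; have := porbits_mul_tperm p x y.
have /= := porbits_mul_tperm (tperm x y * p) x y.
rewrite mulgA tperm2 mul1g xpy xy /=; case: (x \in _) => //=; lia.
Qed.

Lemma porbit_split p x y : x != y -> x \in porbit p y ->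
  porbit p x = porbit (tperm x y * p) x :|: porbit (tperm x y * p) y.
Proof.
move=> xy xpy; rewrite -porbit_join ?porbit_tperm_disj //.
by rewrite mulgA tperm2 mul1g.
Qed.

Lemma porbit_tperm_other p x y z : z \notin porbit p x -> z \notin porbit p y ->
  porbit (tperm x y * p) z = porbit p z.
Proof.
move=> zx zy; apply/esym/(@porbit_eq_in _ _ (porbit p z)); rewrite ?porbit_id ?stable_porbit //.
move=> w wz; rewrite permM tpermD //.
  by apply: contraNneq zx => ->; rewrite porbit_sym.
by apply: contraNneq zy => ->; rewrite porbit_sym.
Qed.

Lemma stable_tperm p X x y : (x \in X) = (y \in X) ->
  stable (tperm x y * p) X = stable p X.
Proof.
move=> xy; suff H q : stable q X -> stable (tperm x y * q) X.
  by apply/idP/idP => /H //; rewrite mulgA tperm2 mul1g.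
move=> /stableP sq; apply/stableP => z zX; rewrite permM sq //.
by case: tpermP zX => // ->; rewrite xy.
Qed.

End Stable.

(** * Connected pairs of permutations and Euler's inequality *)

Section Connected.

Variable T : finType.
Implicit Types (p q phi e : {perm T}) (X Y Z W F : {set T}).

(** Transitivity on X, stated as minimality among nonempty stable sets: components are then subsets
    of the fixed dart type. *)
Definition connected phi e X :=
  [&& X != set0, stable phi X, stable e X &
   [forall Z : {set T}, [&& Z \subset X, Z != set0, stable phi Z & stable e Z] ==> (Z == X)]].

Lemma connP phi e X :
  reflect [/\ X != set0, stable phi X, stable e X &
    forall Z, Z \subset X -> Z != set0 -> stable phi Z -> stable e Z -> Z = X]
  (connected phi e X).
Proof.
apply: (iffP and4P) => -[X0 sp se H]; split=> //.
  by move=> Z ZX Z0 pZ eZ; apply/eqP; apply: (implyP (forallP H Z)); apply/and4P.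
by apply/forallP => Z; apply/implyP => /and4P[ZX Z0 pZ eZ]; apply/eqP/H.
Qed.

Lemma conn_eq_in phi e e' X : {in X, e =1 e'} -> connected phi e X = connected phi e' X.
Proof.
move=> ee; apply/connP/connP => -[X0 sp se H]; split=> //.
- by rewrite -(stable_eq_in ee).
- move=> Z ZX Z0 pZ eZ; apply: H => //; rewrite (stable_eq_in (q := e')) // => z /(subsetP ZX).
  exact: ee.
- by rewrite (stable_eq_in ee).
- move=> Z ZX Z0 pZ eZ; apply: H => //; rewrite -(stable_eq_in (p := e)) // => z /(subsetP ZX).
  exact: ee.
Qed.

(* Euler's relation for a connected hypermap of genus g on X reads
   charsum = #|X| + 2 - 2g. *)
Definition charsum phi e X := num_cycles phi X + num_cycles e X + num_cycles (e * phi) X.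

Lemma stableM p q X : stable p X -> stable q X -> stable (p * q) X.
Proof. by move=> sp sq; apply/stableP => x; rewrite permM !stableE. Qed.

Lemma charsum_eq_in phi e e' X : stable phi X -> stable e X -> {in X, e =1 e'} ->
  charsum phi e X = charsum phi e' X.
Proof.
move=> sp se ee; rewrite /charsum (cyc_eq_in se ee); congr (_ + _).
by apply: cyc_eq_in; [exact: stableM | move=> x xX; rewrite !permM ee].
Qed.

Lemma charsum_split phi e X Z : stable phi Z -> stable e Z -> Z \subset X ->
  charsum phi e X = charsum phi e Z + charsum phi e (X :\: Z).
Proof.
move=> sp se ZX; rewrite /charsum (num_cycles_split sp ZX) (num_cycles_split se ZX).
by rewrite (num_cycles_split (stableM se sp) ZX); lia.
Qed.

Definition invol e := [forall x, e (e x) == x].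

Lemma involP e : reflect (forall x, e (e x) = x) (invol e).
Proof. by apply: (iffP forallP) => H x; apply/eqP. Qed.

Lemma invol_tperm e d : invol e -> (tperm d (e d) * e = e * tperm d (e d))%g.
Proof.
move=> /involP ee; apply/permP => x; rewrite !permM.
case: tpermP => [->|->|xd xed]; first by rewrite ee tpermR.
  by rewrite ee tpermL.
by rewrite tpermD //; apply/eqP => H; [case: xed; rewrite H ee | case: xd; apply: (@perm_inj _ e)].
Qed.

(* Deleting an edge leaves the vertex permutation e * phi unchanged. *)
Lemma tperm_mul_both phi e d : invol e ->
  ((tperm d (e d) * e) * (tperm d (e d) * phi) = e * phi)%g.
Proof. by move=> ee; rewrite (invol_tperm _ ee) -mulgA [(tperm _ _ * (_ * _))%g]mulgA tperm2 mul1g. Qed.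

Lemma tperm_mul_invol e d x : invol e ->
  (tperm d (e d) * e)%g x = if (x == d) || (x == e d) then x else e x.
Proof.
move=> /involP ee; rewrite permM; case: tpermP => [->|->|/eqP/negPf-> /eqP/negPf->] //.
  by rewrite eqxx ee.
by rewrite eqxx orbT.
Qed.

Lemma invol_mul_tperm e d : invol e -> invol (tperm d (e d) * e).
Proof.
move=> ie; have /involP ee := ie; apply/involP => x.
rewrite !(tperm_mul_invol _ _ ie); case H: ((x == d) || (x == e d)); rewrite ?H //.
by rewrite ee (inj_eq perm_inj) -{1}(ee d) (inj_eq perm_inj) orbC H.
Qed.

Lemma porbit_invol_edge e d : invol e -> d \in porbit e (e d).
Proof. by move=> _; rewrite porbit_sym (mem_porbit e 1). Qed.

Lemma charsum_tperm phi e d X : invol e -> stable phi X -> stable e X -> d \in X ->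
  e d != d ->
  charsum (tperm d (e d) * phi) (tperm d (e d) * e) X + (d \notin porbit phi (e d)).*2
   = charsum phi e X + 2.
Proof.
move=> ie sp se dX ed; have edX : e d \in X by rewrite stableE.
rewrite /charsum tperm_mul_both //.
have := cyc_mul_tperm sp dX edX; have := cyc_mul_tperm se dX edX.
rewrite porbit_invol_edge // eq_sym ed /=; lia.
Qed.

(** Deleting one edge creates at most two components, one at each end of the edge. *)
Lemma conn_cut phi e d X : invol e -> connected phi e X -> d \in X -> e d != d ->
  let t := tperm d (e d) in
  ~~ connected (t * phi) (t * e) X ->
  exists Z, [/\ Z \subset X, d \in Z, e d \notin Z,
    connected (t * phi) (t * e) Z & connected (t * phi) (t * e) (X :\: Z)].
Proof.
move=> ie /connP[X0 sp se H] dX ed t nc.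
have edX : e d \in X by rewrite stableE.
have dd' : (d \in X) = (e d \in X) by rewrite dX edX.
have sp1 : stable (t * phi) X by rewrite stable_tperm.
have se1 : stable (t * e) X by rewrite stable_tperm.
(* A set containing both ends of the edge or neither is stable before the deletion as soon as it is
   stable after it. *)
have both W : W \subset X -> W != set0 -> stable (t * phi) W -> stable (t * e) W ->
    (d \in W) = (e d \in W) -> W = X.
  by move=> WX W0 sW eW dW; apply: H => //; rewrite -(stable_tperm _ dW).
have [Z [ZX sZ eZ dZ edZ]] : exists Z, [/\ Z \subset X, stable (t * phi) Z,
    stable (t * e) Z, d \in Z & e d \notin Z].
  move: nc; rewrite /connected X0 sp1 se1 /= => /forallPn[Z]; rewrite negb_imply.
  case/andP=> /and4P[ZX Z0 sZ eZ] ZnX.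
  have [dZ|dZ] := boolP (d \in Z); have [edZ|edZ] := boolP (e d \in Z).
  - by case/eqP: ZnX; apply: both; rewrite ?dZ ?edZ.
  - by exists Z.
  - by exists (X :\: Z); rewrite !inE dZ dX edZ subsetDl !stableD.
  - by case/eqP: ZnX; apply: both; rewrite ?(negPf dZ) ?(negPf edZ).
(* Minimality of a side V: if W separates the two ends, adding X \ V to it gives a set containing
   both, hence all of X. *)
have cc W (V : {set T}) : W \subset V -> V \subset X -> W != set0 -> stable (t * phi) V ->
    stable (t * e) V -> stable (t * phi) W -> stable (t * e) W ->
    (d \in V) != (e d \in V) -> W = V.
  move=> WV VX W0 sV eV sW eW dV.
  have WX := subset_trans WV VX.
  have [E|NE] := eqVneq (d \in W) (e d \in W).
    by move: dV; have WeX := both _ WX W0 sW eW E; rewrite -(_ : X = V) ?dd' ?eqxx //;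
      apply/eqP; rewrite eqEsubset VX -{1}WeX WV.
  have XE : W :|: (X :\: V) = X.
    apply: both.
    - by rewrite subUset WX subsetDl.
    - by rewrite setU_eq0 negb_and W0.
    - by rewrite stableU ?stableD.
    - by rewrite stableU ?stableD.
    - rewrite !inE dX edX !andbT.
      have := subsetP WV d; have := subsetP WV (e d).
      move: dV NE; case: (d \in V); case: (e d \in V); case: (d \in W); case: (e d \in W) => //= _ _ a b;
        by [move: (a isT) | move: (b isT)].
  apply/eqP; rewrite eqEsubset WV; apply/subsetP => z zV.
  by move: (subsetP VX z zV); rewrite -XE !inE zV /= orbF.
exists Z; split=> //; apply/connP; split.
- by apply/set0Pn; exists d.
- by [].
- by [].
- by move=> W WZ W0 sW eW; apply: cc; rewrite ?dZ ?(negPf edZ).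
- by apply/set0Pn; exists (e d); rewrite inE edZ.
- exact: stableD.
- exact: stableD.
- move=> W WZ W0 sW eW; apply: cc => //; rewrite ?subsetDl ?stableD //.
  by rewrite !inE dZ edZ edX.
Qed.

Lemma conn_glue phi e d X Z : invol e -> d \in X ->
  let t := tperm d (e d) in
  stable phi X -> stable e X ->
  Z \subset X -> d \in Z -> e d \notin Z ->
  connected (t * phi) (t * e) Z -> connected (t * phi) (t * e) (X :\: Z) ->
  connected phi e X.
Proof.
move=> ie dX t sp se ZX dZ edZ /connP[Z0 sZ eZ HZ] /connP[D0 sD eD HD].
have edX : e d \in X by rewrite stableE.
apply/connP; split=> //; first by apply/set0Pn; exists d.
move=> W WX W0 sW eW.
have dW : (d \in W) = (e d \in W) by rewrite stableE.
have sW1 : stable (t * phi) W by rewrite stable_tperm.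
have eW1 : stable (t * e) W by rewrite stable_tperm.
have I1 : W :&: Z != set0 -> Z \subset W.
  move=> WZ0; rewrite -(HZ (W :&: Z)) ?subsetIl ?subsetIr ?stableI //.
have I2 : W :&: (X :\: Z) != set0 -> X :\: Z \subset W.
  move=> WZ0; rewrite -(HD (W :&: (X :\: Z))) ?subsetIl ?subsetIr ?stableI //.
have both : (d \in W) -> W = X.
  move=> dW'; apply/eqP; rewrite eqEsubset WX.
  have /I1 ZW : W :&: Z != set0 by apply/set0Pn; exists d; rewrite inE dW'.
  have /I2 ZD : W :&: (X :\: Z) != set0.
    by apply/set0Pn; exists (e d); rewrite !inE -dW dW' edZ.
  by rewrite -(setID X Z) subUset (setIidPr ZX) ZW.
have /set0Pn[w wW] := W0; have wX := subsetP WX w wW.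
have [wZ|wZ] := boolP (w \in Z).
  by apply: both; apply: (subsetP (I1 _)) => //; apply/set0Pn; exists w; rewrite inE wW.
apply: both; rewrite dW; apply: (subsetP (I2 _)); last by rewrite inE edZ.
by apply/set0Pn; exists w; rewrite !inE wW wZ.
Qed.

Lemma conn_tperm_join phi e d X : invol e -> d \in X -> stable phi X -> stable e X ->
  e d \in porbit (tperm d (e d) * phi) d ->
  connected (tperm d (e d) * phi) (tperm d (e d) * e) X = connected phi e X.
Proof.
move=> ie dX sp se dd; set t := tperm d (e d).
have edX : e d \in X by rewrite stableE.
have dd' : (d \in X) = (e d \in X) by rewrite dX edX.
have E1 W : stable (t * phi) W -> (d \in W) = (e d \in W).
  move=> sW; apply/idP/idP => H.
    exact: (subsetP (porbit_sub sW H)).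
  by apply: (subsetP (porbit_sub sW H)); rewrite porbit_sym.
apply/connP/connP => -[X0 sX eX H]; split=> //; try by rewrite stable_tperm.
  move=> Z ZX Z0 sZ eZ; have dZ : (d \in Z) = (e d \in Z) by rewrite stableE.
  by apply: H => //; rewrite stable_tperm.
by move=> Z ZX Z0 sZ eZ; apply: H => //; rewrite -(stable_tperm _ (E1 Z sZ)).
Qed.

Lemma cyc_conn1 phi e X : connected phi e X -> {in X, e =1 id} -> forall x, x \in X -> porbit phi x = X.
Proof.
move=> /connP[X0 sp se H] eid x xX; apply: H.
- exact: porbit_sub.
- by apply/set0Pn; exists x; rewrite porbit_id.
- exact: stable_porbit.
- apply/stableP => y yx; rewrite eid //; exact: (subsetP (porbit_sub sp xX)).
Qed.

Lemma cyc_id e X : {in X, e =1 id} -> num_cycles e X = #|X|.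
Proof.
move=> eid; have E1 : {in X, forall x, porbit e x = [set x]}.
  move=> x xX; rewrite (@porbit_eq_in _ e 1%g [set x]) ?set11 //.
  - apply/setP => y; rewrite inE; apply/porbitP/eqP => [[i ->]|->].
      by rewrite expg1n perm1.
    by exists 0; rewrite expg0 perm1.
  - by apply/stableP => y; rewrite !inE => /eqP ->; rewrite eid.
  - by move=> y; rewrite inE => /eqP ->; rewrite eid // perm1.
rewrite /num_cycles (eq_in_imset E1) card_imset //; exact: set1_inj.
Qed.

Lemma cyc_single phi X : X != set0 -> (forall x, x \in X -> porbit phi x = X) -> num_cycles phi X = 1.
Proof.
move=> /set0Pn[x0 x0X] H; rewrite /num_cycles (_ : _ @: _ = [set X]) ?cards1 //.
apply/setP => C; rewrite inE; apply/imsetP/eqP => [[x xX ->]|->]; first exact: H.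
by exists x0; rewrite ?H.
Qed.

Lemma charsum_id phi e X : X != set0 -> stable phi X -> {in X, e =1 id} ->
  (forall x, x \in X -> porbit phi x = X) -> charsum phi e X = #|X| + 2.
Proof.
move=> X0 sp eid H.
have se : stable e X by apply/stableP => x xX; rewrite eid.
rewrite /charsum (cyc_id eid) (@cyc_eq_in _ (e * phi) phi); first last.
- by move=> x xX; rewrite permM eid.
- exact: stableM.
by rewrite (cyc_single X0 H); lia.
Qed.

(** Induction on the number of darts not fixed by e. By [charsum_tperm] a deletion never lowers
    [charsum]. If it disconnects, [charsum] rises by exactly 2, which the bound [+ 2] of the
    additional component pays for. *)
Lemma euler_le phi e X : invol e -> connected phi e X -> charsum phi e X <= #|X| + 2.
Proof.
have [n] := ubnP #|[set x in X | e x != x]|.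
elim: n => // n IH in phi e X *; rewrite ltnS => le ie cX.
have [X0 sp se _] := connP _ _ _ cX.
case: (pickP [pred x | (x \in X) && (e x != x)]) => [d /= /andP[dX ed]|eid]; last first.
  have {}eid : {in X, e =1 id}.
    by move=> x xX; apply/eqP; move: (eid x); rewrite /= xX /= => /negbFE.
  by rewrite charsum_id //; apply: cyc_conn1 cX eid.
set t := tperm d (e d); have edX : e d \in X by rewrite stableE.
have iE := invol_mul_tperm d ie.
have lt Z : Z \subset X -> #|[set x in Z | (t * e)%g x != x]| < n.
  move=> ZX; apply: leq_trans le; apply: proper_card; apply/properP; split.
    apply/subsetP => x; rewrite !inE tperm_mul_invol // => /andP[xZ].
    by rewrite (subsetP ZX) //; case: ifP => //; rewrite eqxx.
  by exists d; rewrite !inE ?dX // tperm_mul_invol // !eqxx andbF.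
have := charsum_tperm ie sp se dX ed; rewrite -/t => E.
have [cc|nc] := boolP (connected (t * phi) (t * e) X).
  have := IH _ _ _ (lt _ (subxx _)) iE cc; move: E; case: (_ \notin _) => /=; clear; lia.
have [Z [ZX dZ edZ cZ cD]] := conn_cut ie cX dX ed nc.
have := IH _ _ _ (lt _ ZX) iE cZ; have := IH _ _ _ (lt _ (subsetDl X Z)) iE cD.
have [_ sZ eZ _] := connP _ _ _ cZ.
(* Two distinct faces at d and [e d] would be merged by the deletion, and a merged face cannot meet
   both components. *)
have dsj : d \in porbit phi (e d).
  apply: contraNT edZ => H; apply: (subsetP (porbit_sub sZ dZ)).
  by rewrite porbit_join // inE porbit_id orbT.
move: E; rewrite dsj /= addn0 (charsum_split sZ eZ ZX).
have := cardsID Z X; rewrite (setIidPr ZX); rewrite /t; clear; lia.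
Qed.

End Connected.

(** * Planar matchings and the deletion of an edge *)

Section Matchings.

Variable T : finType.
Implicit Types (p q phi e : {perm T}) (X Y Z W F : {set T}) (d x : T).

Definition matching e Y := [forall x, (e (e x) == x) && ((e x != x) == (x \in Y))].

Lemma matchingP e Y :
  reflect (invol e /\ forall x, (e x != x) = (x \in Y)) (matching e Y).
Proof.
apply: (iffP forallP) => [H|[/involP ee H] x]; last by rewrite ee H !eqxx.
split=> [|x]; last by have /andP[_ /eqP] := H x.
by apply/involP => x; have /andP[/eqP] := H x.
Qed.

Lemma matching_out e Y x : matching e Y -> x \notin Y -> e x = x.
Proof. by move=> /matchingP[_ H]; rewrite -H => /negPn/eqP. Qed.

Lemma matching_in e Y x : matching e Y -> (e x \in Y) = (x \in Y).
Proof. by move=> /matchingP[_ H]; rewrite -!H (inj_eq perm_inj). Qed.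

Lemma matching_stable e Y X : matching e Y -> Y \subset X -> stable e X.
Proof.
move=> m /subsetP YX; apply/stableP => x xX.
have [xY|xY] := boolP (x \in Y); last by rewrite (matching_out m).
by rewrite YX // (matching_in _ m).
Qed.

(* F collects the darts of the deleted edges: they remain in the cycles of phi,
   as fixed points of e, but do not count in the degrees.  In particular a face
   all of whose darts lie in F is a face of degree 0, that is, if it is alone, the
   map with one vertex and no edge. *)
Definition planar_matchings phi X F :=
  [set e | [&& matching e (X :\: F), connected phi e X & charsum phi e X == #|X| + 2]].

Lemma matchings_stable0 phi X F : ~~ stable phi X -> planar_matchings phi X F = set0.
Proof.
by move=> ns; apply/setP => e; rewrite !inE /connected (negPf ns) /= !andbF.
Qed.

(** Deletion is left multiplication by a fixed transposition, hence injective; [card_mulgl] turns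
    this into equalities of cardinals. *)
Lemma matching_cut X F d d' e : d \in X :\: F -> d' \in X :\: F -> d' != d ->
  matching e (X :\: F) && (e d == d')
   = matching (tperm d d' * e) (X :\: (d |: (d' |: F))).
Proof.
move=> dX d'X dd'; apply/andP/matchingP => [[/matchingP[ie H] /eqP ed]|[ie H]].
  rewrite -ed; split; first exact: invol_mul_tperm.
  move=> x; rewrite tperm_mul_invol // !inE !negb_or.
  case: (x =P d) => /= [->|_]; first by rewrite eqxx.
  case: (x =P e d) => /= [->|_]; first by rewrite eqxx.
  by rewrite H !inE.
set e1 := (tperm d d' * e)%g in ie H.
have e1d : e1 d = d by apply/eqP/negPn; rewrite H !inE eqxx.
have e1d' : e1 d' = d' by apply/eqP/negPn; rewrite H !inE eqxx orbT.
have eE x : e x = if x == d then d' else if x == d' then d else e1 x.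
  rewrite (_ : e = tperm d d' * e1)%g; last by rewrite /e1 mulgA tperm2 mul1g.
  rewrite permM; case: tpermP => [->|->|/eqP/negPf-> /eqP/negPf-> //].
    by rewrite eqxx.
  by rewrite eqxx (negPf dd').
split; last by rewrite eE eqxx.
apply/matchingP; split.
  apply/involP => x; rewrite (eE x).
  case: (x =P d) => [->|/eqP xd]; first by rewrite eE (negPf dd') eqxx.
  case: (x =P d') => [->|/eqP xd']; first by rewrite eE eqxx.
  rewrite eE -{1}e1d -{2}e1d' !(inj_eq perm_inj) (negPf xd) (negPf xd').
  exact: (involP _ ie).
move=> x; rewrite eE.
case: (x =P d) => [->|/eqP xd]; first by rewrite dd' dX.
case: (x =P d') => [->|/eqP xd']; first by rewrite eq_sym dd' d'X.
by rewrite H !inE (negPf xd) (negPf xd').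
Qed.

Lemma card_mulgl (t : {perm T}) (A B : {set {perm T}}) :
  (forall e, (e \in A) = ((t * e)%g \in B)) -> #|A| = #|B|.
Proof.
move=> AB; rewrite -(card_imset A (mulgI t)); congr #|pred_of_set _|.
apply/setP => e; apply/imsetP/idP => [[e' e'A ->]|eB]; first by rewrite -AB.
by exists (t^-1 * e)%g; rewrite ?AB mulKVg.
Qed.

(** The edge becomes two fixed points of e while two faces become one, so [charsum] is unchanged;
    connectedness is preserved both ways by [conn_tperm_join]. *)
Lemma card_matchings_join phi X F d d' : stable phi X ->
  d \in X :\: F -> d' \in X :\: F -> d' \notin porbit phi d ->
  #|[set e in planar_matchings phi X F | e d == d']|
   = #|planar_matchings (tperm d d' * phi) X (d |: (d' |: F))|.
Proof.
move=> sp dX d'X ndd; have dd' : d' != d by apply: contraNneq ndd => ->; apply: porbit_id.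
apply: (@card_mulgl (tperm d d')) => e; rewrite !inE -matching_cut //.
case m : (matching e (X :\: F)) => //=; case ed : (e d == d'); last by rewrite andbF.
rewrite andbT; have {}ed := eqP ed.
have dX' : d \in X by move: dX; rewrite inE => /andP[].
have [ie _] := matchingP _ _ m.
have se : stable e X by apply: matching_stable m _; apply: subsetDl.
rewrite -ed conn_tperm_join //; last first.
  by rewrite porbit_join ?inE ?porbit_id ?orbT // ed porbit_sym.
congr (_ && _); have := charsum_tperm ie sp se dX'; rewrite ed porbit_sym ndd /= => /(_ dd').
by move/eqP; rewrite eqn_add2r => /eqP ->.
Qed.

Definition split_matchings phi X F Z :=
  [set e | [&& matching e (X :\: F), (connected phi e Z) && (charsum phi e Z == #|Z| + 2)
   & (connected phi e (X :\: Z)) && (charsum phi e (X :\: Z) == #|X :\: Z| + 2)]].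

(** Each matching on the left gives exactly one Z, the component of d after the deletion. This is
    proved by double counting the pairs (Z, e). *)
Lemma card_matchings_split_union phi X F d d' : stable phi X ->
  d \in X :\: F -> d' \in X :\: F -> d' != d -> d' \in porbit phi d ->
  #|[set e in planar_matchings phi X F | e d == d']|
   = \sum_(Z : {set T} | [&& Z \subset X, d \in Z & d' \notin Z])
       #|split_matchings (tperm d d' * phi) X (d |: (d' |: F)) Z|.
Proof.
move=> sp dX d'X dd' dpd'; set t := tperm d d'.
have dX' : d \in X by move: dX; rewrite inE => /andP[].
have d'X' : d' \in X by move: d'X; rewrite inE => /andP[].
pose ok Z := [&& Z \subset X, d \in Z & d' \notin Z].
transitivity (\sum_(Z : {set T} | ok Z) \sum_(e : {perm T})
   ((t * e)%g \in split_matchings (t * phi) X (d |: (d' |: F)) Z : nat)); last first.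
  apply: eq_bigr => Z _; rewrite -big_mkcond sum1_card /=.
  rewrite -(@card_mulgl t [set e | (t * e)%g \in split_matchings (t * phi) X (d |: (d' |: F)) Z]).
    by rewrite cardsE.
  by move=> e; rewrite inE.
rewrite exchange_big -sum1_card big_mkcond; apply: eq_bigr => e _ /=.
rewrite !inE; under eq_bigr => Z _ do rewrite inE -matching_cut //.
case m : (matching e (X :\: F)); last by rewrite /= big1.
case ed : (e d == d'); last by rewrite andbF /= big1.
rewrite /= andbT; have {ed} ed := eqP ed.
have [ie _] := matchingP _ _ m.
have se : stable e X by apply: matching_stable m _; apply: subsetDl.
have edd : e d != d by rewrite ed.
have cs := charsum_tperm ie sp se dX' edd.
move: cs; rewrite ed porbit_sym dpd' /= addn0 -/t => cs.
have ie1 : invol (t * e) by rewrite /t -ed; apply: invol_mul_tperm.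
case: ifP => [/andP[cX /eqP csX]|nA]; last first.
  apply/esym; apply: big1 => Z /and3P[ZX dZ d'Z]; apply/eqP; rewrite eqb0.
  apply/negP => /andP[/andP[cZ /eqP eZ] /andP[cD /eqP eD]].
  move/negP: nA; apply; apply/andP; split.
    by apply: (@conn_glue _ phi e d X Z); rewrite ?ed.
  have [_ sZ seZ _] := connP _ _ _ cZ.
  move: cs; rewrite (charsum_split sZ seZ ZX) eZ eD.
  have := cardsID Z X; rewrite (setIidPr ZX); clear; lia.
(* The deletion has raised [charsum] to [#|X| + 4], above Euler's bound for a connected pair. *)
have nc : ~~ connected (t * phi) (t * e) X.
  by apply/negP => /(euler_le ie1); lia.
have := conn_cut ie cX dX' edd; rewrite /= ed -/t => /(_ nc)[Z [ZX dZ d'Z cZ cD]].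
have [_ sZ seZ minZ] := connP _ _ _ cZ.
rewrite (bigD1 Z) /=; last by rewrite /ok ZX dZ.
(* The two values of [charsum] add up to [#|X| + 4], so both attain Euler's bound. *)
have Eq : charsum (t * phi) (t * e) Z = #|Z| + 2 /\
          charsum (t * phi) (t * e) (X :\: Z) = #|X :\: Z| + 2.
  have := euler_le ie1 cZ; have := euler_le ie1 cD.
  move: cs csX; rewrite (charsum_split sZ seZ ZX).
  have := cardsID Z X; rewrite (setIidPr ZX); clear; lia.
(* Two connected sets which both contain d coincide with their intersection. *)
rewrite cZ cD Eq.1 Eq.2 !eqxx big1 //= => Z' /andP[/and3P[_ dZ' _] nZ].
apply/eqP; rewrite eqb0; apply: contra nZ => /andP[/andP[cZ' _] _].
have [_ sZ' seZ' minZ'] := connP _ _ _ cZ'.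
have I0 : Z' :&: Z != set0 by apply/set0Pn; exists d; rewrite inE dZ'.
rewrite -(minZ (Z' :&: Z)) ?subsetIr ?stableI // eq_sym.
by apply/eqP/minZ'; rewrite ?subsetIl ?stableI.
Qed.

Lemma restr_permE_stable e Z x : stable e Z ->
  restr_perm Z e x = if x \in Z then e x else x.
Proof.
move=> sZ; case: ifP => xZ.
  rewrite restr_permE //; apply/astabsP => y; rewrite /= apermE; exact: stableE.
by rewrite (out_perm (restr_perm_on _ _)) // xZ.
Qed.

(** The bijection is the product [e2 * e3]: each factor is the identity off its own side, and the
    inverse map restricts to Z and X \ Z. If one side is not stable, both counts are 0. *)
Lemma card_split_matchings phi X F Z : Z \subset X ->
  #|split_matchings phi X F Z| = #|planar_matchings phi Z F| * #|planar_matchings phi (X :\: Z) F|.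
Proof.
move=> ZX; have [sp|nsp] := boolP (stable phi Z); last first.
  rewrite matchings_stable0 // cards0 mul0n; apply: eq_card0 => e; rewrite !inE.
  by rewrite /connected (negPf nsp) /= !andbF.
have [sp'|nsp] := boolP (stable phi (X :\: Z)); last first.
  rewrite (@matchings_stable0 _ (X :\: Z)) // cards0 muln0; apply: eq_card0 => e; rewrite !inE.
  by rewrite /connected (negPf nsp) /= !andbF.
rewrite -cardsX.
have out1 e2 x : e2 \in planar_matchings phi Z F -> x \notin Z -> e2 x = x.
  by rewrite inE => /and3P[m _ _] xZ; rewrite (matching_out m) // inE (negPf xZ) andbF.
have out2 e3 x : e3 \in planar_matchings phi (X :\: Z) F -> x \in Z -> e3 x = x.
  by rewrite inE => /and3P[m _ _] xZ; rewrite (matching_out m) // !inE xZ /= andbF.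
have st1 e2 : e2 \in planar_matchings phi Z F -> stable e2 Z.
  by rewrite inE => /and3P[_ /connP[]].
have on1 e2 e3 x : e2 \in planar_matchings phi Z F -> e3 \in planar_matchings phi (X :\: Z) F -> x \in Z ->
    (e2 * e3)%g x = e2 x.
  by move=> h2 h3 xZ; rewrite permM (out2 e3) // stableE // st1.
have on2 e2 e3 x : e2 \in planar_matchings phi Z F -> e3 \in planar_matchings phi (X :\: Z) F -> x \notin Z ->
    (e2 * e3)%g x = e3 x.
  by move=> h2 h3 xZ; rewrite permM (out1 e2).
rewrite -(card_in_imset (f := fun ee : {perm T} * {perm T} => (ee.1 * ee.2)%g)); last first.
  move=> [e2 e3] [e2' e3'] /setXP[/= h2 h3] /setXP[/= h2' h3'] E.
  congr pair; apply/permP => x; have [xZ|xZ] := boolP (x \in Z).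
  - by rewrite -(on1 _ _ _ h2 h3 xZ) -(on1 _ _ _ h2' h3' xZ) E.
  - by rewrite !out1.
  - by rewrite !out2.
  - by rewrite -(on2 _ _ _ h2 h3 xZ) -(on2 _ _ _ h2' h3' xZ) E.
congr #|pred_of_set _|; apply/setP => e; apply/idP/imsetP => [|[[e2 e3] /setXP[/= h2 h3] ->]].
  rewrite inE => /and3P[m /andP[cZ eZ] /andP[cD eD]].
  have [_ _ se _] := connP _ _ _ cZ; have [_ _ seD _] := connP _ _ _ cD.
  have [ie me] := matchingP _ _ m; have ee := involP _ ie.
  have agZ : {in Z, e =1 restr_perm Z e} by move=> x xZ; rewrite restr_permE_stable // xZ.
  have agD : {in X :\: Z, e =1 restr_perm (X :\: Z) e}.
    by move=> x xZ; rewrite restr_permE_stable // xZ.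
  exists (restr_perm Z e, restr_perm (X :\: Z) e); last first.
    apply/permP => x; rewrite permM /= !restr_permE_stable // !inE.
    have [xZ|xZ] := boolP (x \in Z); first by rewrite stableE ?xZ.
    by rewrite xZ /=; case: ifP => // xX; rewrite (matching_out m) // inE xX andbF.
  have mW W : W \subset X -> stable e W -> matching (restr_perm W e) (W :\: F).
    move=> WX sW; apply/matchingP; split.
      apply/involP => x; rewrite !restr_permE_stable //.
      by case xW: (x \in W); rewrite ?stableE ?xW.
    move=> x; rewrite restr_permE_stable // inE; case xW: (x \in W).
      by rewrite me !inE (subsetP WX).
    by rewrite eqxx andbF.
  rewrite !inE /= !mW ?subsetDl //= -(conn_eq_in _ agZ) -(conn_eq_in _ agD) cZ cD.
  by rewrite -(charsum_eq_in sp se agZ) -(charsum_eq_in sp' seD agD) eZ eD.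
have ag2 : {in Z, e2 =1 (e2 * e3)%g} by move=> x xZ; rewrite on1.
have ag3 : {in X :\: Z, e3 =1 (e2 * e3)%g}.
  by move=> x; rewrite inE => /andP[xZ _]; rewrite on2.
move: (h2) (h3); rewrite !inE => /and3P[m2 c2 w2] /and3P[m3 c3 w3].
have [_ _ s2 _] := connP _ _ _ c2; have [_ _ s3 _] := connP _ _ _ c3.
rewrite -(conn_eq_in _ ag2) -(conn_eq_in _ ag3) c2 c3.
rewrite -(charsum_eq_in sp s2 ag2) -(charsum_eq_in sp' s3 ag3) w2 w3 !andbT.
have [i2 M2] := matchingP _ _ m2; have [i3 M3] := matchingP _ _ m3.
have out3 x : x \notin Z -> e3 x \notin Z.
  move=> xZ; have [xX|xX] := boolP (x \in X); last first.
    by rewrite (matching_out m3) // !inE (negPf xX) !andbF.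
  by have := stableE x s3; rewrite !inE xZ xX => /andP[].
apply/matchingP; split.
  apply/involP => x; have [xZ|xZ] := boolP (x \in Z).
    by rewrite !(on1 _ _ _ h2 h3) ?stableE // (involP _ i2).
  by rewrite (on2 _ _ x h2 h3) // (on2 _ _ _ h2 h3) ?out3 // (involP _ i3).
move=> x; have [xZ|xZ] := boolP (x \in Z).
  by rewrite on1 // M2 !inE xZ (subsetP ZX).
by rewrite on2 // M3 !inE xZ.
Qed.

Lemma card_matchings_split phi X F d d' : stable phi X ->
  d \in X :\: F -> d' \in X :\: F -> d' != d -> d' \in porbit phi d ->
  #|[set e in planar_matchings phi X F | e d == d']|
   = \sum_(Z : {set T} | [&& Z \subset X, d \in Z & d' \notin Z])
       #|planar_matchings (tperm d d' * phi) Z (d |: (d' |: F))| *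
       #|planar_matchings (tperm d d' * phi) (X :\: Z) (d |: (d' |: F))|.
Proof.
move=> sp dX d'X dd' dpd'; rewrite card_matchings_split_union //.
by apply: eq_bigr => Z /and3P[ZX _ _]; rewrite card_split_matchings.
Qed.

Lemma card_matchings_root phi X F d : d \in X :\: F ->
  #|planar_matchings phi X F|
   = \sum_(d' in (X :\: F) :\ d) #|[set e in planar_matchings phi X F | e d == d']|.
Proof.
move=> dX; rewrite -sum1_card.
rewrite (partition_big (fun e : {perm T} => e d) (mem ((X :\: F) :\ d))) /=; last first.
  move=> e; rewrite inE => /and3P[m _ _]; rewrite in_setD1.
  by rewrite (matching_in _ m) dX andbT; have [_ ->] := matchingP _ _ m.
by apply: eq_bigr => d' _; rewrite sum1dep_card.
Qed.

Lemma matchings_odd0 phi X F : odd #|X :\: F| -> planar_matchings phi X F = set0.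
Proof.
move=> oX; apply/setP => e; rewrite in_set0; apply/negP; rewrite inE => /and3P[m _ _].
move: (X :\: F) oX m => {phi X F} Y oY m; move: oY.
have [n] := ubnP #|Y|; elim: n => // n IH in e Y m *; rewrite ltnS => le oY.
have [Y0|/set0Pn[d dY]] := eqVneq Y set0; first by rewrite Y0 cards0 in oY.
have [ie M] := matchingP _ _ m.
have edY : e d \in Y by rewrite (matching_in _ m).
have := @matching_cut Y set0 d (e d) e; rewrite !setD0 M dY edY => /(_ isT isT isT).
rewrite m eqxx setU0 => /esym m1.
have := cardsD1 d Y; have := cardsD1 (e d) (Y :\ d).
rewrite in_setD1 M dY edY /= setDDl -[[set d] :|: _]/(d |: [set e d]) => E1 E2.
apply: (IH _ _ m1); move: le oY; clear -E1 E2; lia.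
Qed.

Lemma matchings_no_edge phi X F : stable phi X -> X != set0 -> X \subset F ->
  #|planar_matchings phi X F| = (num_cycles phi X == 1).
Proof.
move=> sp X0 XF; have D0 : X :\: F = set0 by apply/eqP; rewrite setD_eq0.
have m1 e : matching e set0 = (e == 1%g).
  apply/matchingP/eqP => [[_ H]|->]; last first.
    by split=> [|x]; [apply/involP => x; rewrite !perm1 | rewrite perm1 eqxx inE].
  by apply/permP => x; rewrite perm1; apply/eqP; move: (H x); rewrite inE => /negbFE.
have e1 : {in X, (1%g : {perm T}) =1 id} by move=> x _; rewrite perm1.
have c1 : connected phi 1 X = (num_cycles phi X == 1).
  apply/idP/eqP => [c|]; first by apply: cyc_single => //; apply: cyc_conn1 c e1.
  move=> c1; have por x : x \in X -> porbit phi x = X.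
    move=> xX; apply/eqP; rewrite eqEsubset porbit_sub //=; apply/subsetP => y yX.
    have /cards1P[C E] : #|porbit phi @: X| == 1 by rewrite -/(num_cycles _ _) c1.
    have := imset_f (porbit phi) xX; have := imset_f (porbit phi) yX.
    by rewrite E !inE => /eqP <- /eqP ->; rewrite porbit_id.
  apply/connP; split=> //; first by apply/stableP => x; rewrite perm1.
  move=> Z ZX /set0Pn[z zZ] sZ _; apply/eqP; rewrite eqEsubset ZX.
  by rewrite -(por z (subsetP ZX z zZ)) porbit_sub.
case: eqP c1 => [c1 /idP cc|nc /negbT cc]; last first.
  apply: eq_card0 => e; rewrite !inE D0 m1; case: eqP => //= ->.
  by rewrite (negPf cc).
rewrite (_ : planar_matchings _ _ _ = [set 1%g]) ?cards1 //; apply/setP => e; rewrite !inE D0 m1.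
case: eqP => //= ->; rewrite cc /= (charsum_id X0 sp e1) ?eqxx //.
exact: cyc_conn1 cc e1.
Qed.

End Matchings.

(** * Faces and their behaviour under cutting *)

Section Faces.

Variable T : finType.
Implicit Types (p : {perm T}) (X Y Z F C : {set T}) (I J L : {set {set T}}) (x y d : T).

Definition faces p X := porbit p @: X.

Lemma faceP p X C x : C \in faces p X -> x \in C -> C = porbit p x.
Proof. by case/imsetP=> y _ -> xy; apply/eqP; rewrite eq_sym eq_porbit_mem. Qed.

Lemma face_sub p X C : stable p X -> C \in faces p X -> C \subset X.
Proof. by move=> sX /imsetP[y yX ->]; apply: porbit_sub. Qed.

Lemma face_eq p X C C' x : C \in faces p X -> C' \in faces p X ->
  x \in C -> x \in C' -> C = C'.
Proof. by move=> fC fC' xC xC'; rewrite (faceP fC xC) (faceP fC' xC'). Qed.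

Lemma mem_faces p X x : x \in X -> porbit p x \in faces p X.
Proof. exact: imset_f. Qed.

Lemma face_neq0 p X C : C \in faces p X -> exists x, x \in C.
Proof. by case/imsetP=> x _ ->; exists x; apply: porbit_id. Qed.

Lemma sum_faces (V : nmodType) p X (P : pred T) (f : T -> V) : stable p X ->
  (\sum_(y in X | P y) f y = \sum_(C in faces p X) \sum_(y in C | P y) f y)%R.
Proof.
move=> sX; rewrite (partition_big (porbit p) [in faces p X]) /=; last first.
  by move=> y /andP[yX _]; apply: mem_faces.
apply: eq_bigr => C fC; apply: eq_bigl => y.
rewrite andbAC; congr (_ && _); apply/andP/idP => [[yX /eqP <-]|yC].
  exact: porbit_id.
by rewrite (subsetP (face_sub sX fC)) // (faceP fC yC).
Qed.

Lemma card_faces p X F : stable p X -> #|X :\: F| = \sum_(C in faces p X) #|C :\: F|.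
Proof.
move=> sX; have E Y : #|Y :\: F| = \sum_(y in Y | y \notin F) 1.
  by rewrite sum1dep_card; apply: eq_card => y; rewrite !inE andbC.
rewrite E (sum_faces _ _ sX); apply: eq_bigr => C _; by rewrite E.
Qed.

Lemma stable_cover p X I : I \subset faces p X -> stable p (cover I).
Proof.
move=> /subsetP sI; apply/stableP => x /bigcupP[C CI xC]; apply/bigcupP; exists C => //.
by rewrite (faceP (sI _ CI) xC) (mem_porbit p 1).
Qed.

Lemma faces_cover p X I : I \subset faces p X -> faces p (cover I) = I.
Proof.
move=> /subsetP sI; apply/setP => C; apply/imsetP/idP => [[x /bigcupP[C' CI xC] ->]|CI].
  by rewrite -(faceP (sI _ CI) xC).
have [x xC] := face_neq0 (sI _ CI); exists x; last exact: faceP (sI _ CI) xC.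
by apply/bigcupP; exists C.
Qed.

Lemma cover_faces p X : stable p X -> cover (faces p X) = X.
Proof.
move=> sX; apply/setP => x; apply/bigcupP/idP => [[C CX xC]|xX].
  exact: (subsetP (face_sub sX CX)).
by exists (porbit p x); rewrite ?mem_faces ?porbit_id.
Qed.

Lemma facesS p X Z : Z \subset X -> faces p Z \subset faces p X.
Proof. exact: imsetS. Qed.

Lemma mem_cover_faces p X I x : I \subset faces p X -> (x \in cover I) = (porbit p x \in I).
Proof.
move=> sI; apply/bigcupP/idP => [[C CI xC]|h]; last by exists (porbit p x); rewrite ?porbit_id.
by rewrite -(faceP (subsetP sI _ CI) xC).
Qed.

Lemma coverD_faces p X I : stable p X -> I \subset faces p X ->
  X :\: cover I = cover (faces p X :\: I).
Proof.
move=> sX sI; apply/setP => x; rewrite inE !(@mem_cover_faces p X) ?subsetDl // inE.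
congr (_ && _); apply/idP/idP => [|h]; first exact: mem_faces.
exact: (subsetP (face_sub sX h) x (porbit_id p x)).
Qed.

(** A stable subset is a union of faces, so choosing one that separates d from d' means choosing
    which faces of L accompany the face of d. *)
Lemma sum_stable_subsets (V : nmodType) p X d d' L (f : {set T} -> V) :
  stable p X -> porbit p d \notin porbit p d' |: L -> porbit p d' \notin L ->
  faces p X = porbit p d |: (porbit p d' |: L) ->
  (forall Z, ~~ stable p Z -> f Z = 0%R) ->
  (\sum_(Z : {set T} | [&& Z \subset X, d \in Z & d' \notin Z]) f Z
   = \sum_(I : {set {set T}} | I \subset L) f (cover (porbit p d |: I)))%R.
Proof.
move=> sX dn d'n fX f0; set D := porbit p d; set D' := porbit p d'.
rewrite (bigID (stable p)) /= [X in (_ + X)%R]big1 ?addr0; last by move=> Z /andP[_ /f0].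
have LX I : I \subset L -> D |: I \subset faces p X.
  by move=> IL; rewrite fX setUS // (subset_trans IL) // subsetUr.
rewrite (reindex_onto (fun I => cover (D |: I)) (fun Z => faces p Z :\ D)) /=; last first.
  move=> Z /andP[/and3P[ZX dZ _] sZ].
  by rewrite setD1K ?cover_faces // mem_faces.
apply: eq_bigl => I; apply/idP/idP => [/andP[/andP[/and3P[cX dI d'I] sI] /eqP EI]|IL].
  have s : faces p (cover (D |: I)) :\ D \subset L.
    apply/subsetP => C; rewrite in_setD1 => /andP[CD Cf].
    have := subsetP (facesS p cX) C Cf; rewrite fX !inE (negPf CD) /= => /orP[/eqP CD'|//].
    case/negP: d'I; apply: (subsetP (face_sub sI Cf)); rewrite CD'; exact: porbit_id.
  by rewrite -EI.
have sub := LX _ IL; have s := stable_cover sub.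
rewrite s andbT !(mem_cover_faces _ sub) setU11 /= (faces_cover sub).
have dI : D \notin I.
  by apply: contra dn => h; rewrite inE (subsetP IL) // orbT.
rewrite (setU1K dI) eqxx andbT; apply/andP; split.
  apply/bigcupsP => C /(subsetP sub); exact: face_sub.
rewrite !inE negb_or; apply/andP; split; last by apply: contra d'n => /(subsetP IL).
by apply: contra dn => E; rewrite !inE eq_sym E.
Qed.

Lemma faces_join p X d d' C C' L : stable p X -> d \in C -> d' \in C' ->
  C \notin C' |: L -> C' \notin L -> faces p X = C |: (C' |: L) ->
  faces (tperm d d' * p) X = (C :|: C') |: L /\ C :|: C' \notin L.
Proof.
move=> sX dC d'C' CL C'L fX.
have fC : C \in faces p X by rewrite fX !inE eqxx.
have fC' : C' \in faces p X by rewrite fX !inE eqxx orbT.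
have fL E : E \in L -> E \in faces p X by rewrite fX !inE => ->; rewrite !orbT.
have EC := faceP fC dC; have EC' := faceP fC' d'C'.
have dd' : d \notin porbit p d'.
  rewrite -EC'; apply: contra CL => dC'; by rewrite (face_eq fC fC' dC dC') setU11.
have J : porbit (tperm d d' * p) d = C :|: C' by rewrite porbit_join // -EC -EC'.
have dX : d \in X by apply: (subsetP (face_sub sX fC)).
have other x : x \notin C -> x \notin C' -> porbit (tperm d d' * p) x = porbit p x.
  by move=> xC xC'; rewrite porbit_tperm_other // -?EC -?EC'.
split.
  apply/setP => E; apply/imsetP/idP => [[x xX ->]|].
    have [xU|] := boolP (x \in C :|: C').
      rewrite -J -eq_porbit_mem in xU; by rewrite (eqP xU) J setU11.
    rewrite inE negb_or => /andP[xC xC']; rewrite other //.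
    have := mem_faces p xX; rewrite fX !inE => /or3P[/eqP E1|/eqP E1|->]; rewrite ?orbT //.
      by rewrite -E1 porbit_id in xC.
    by rewrite -E1 porbit_id in xC'.
  rewrite inE => /orP[|EL]; first by rewrite inE => /eqP ->; exists d.
  have [x xE] := face_neq0 (fL _ EL).
  exists x; first exact: (subsetP (face_sub sX (fL _ EL))).
  rewrite other ?(faceP (fL _ EL) xE) //.
    apply: contra CL => xC; rewrite (face_eq fC (fL _ EL) xC xE) inE EL orbT //.
  by apply: contra C'L => xC; rewrite (face_eq fC' (fL _ EL) xC xE).
apply: contra CL => UL; have dU : d \in C :|: C' by rewrite inE dC.
by rewrite (face_eq fC (fL _ UL) dC dU) inE UL orbT.
Qed.

Lemma faces_split p X d d' C L : stable p X -> d \in C -> d' \in C -> d != d' ->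
  C \notin L -> faces p X = C |: L ->
  let q := (tperm d d' * p)%g in
  [/\ faces q X = porbit q d |: (porbit q d' |: L),
      porbit q d \notin porbit q d' |: L, porbit q d' \notin L,
      C = porbit q d :|: porbit q d' & [disjoint porbit q d & porbit q d']].
Proof.
move=> sX dC d'C dd' CL fX q.
have fC : C \in faces p X by rewrite fX setU11.
have fL E : E \in L -> E \in faces p X by rewrite fX !inE => ->; rewrite orbT.
have EC := faceP fC dC; have EC' := faceP fC d'C.
have dd : d \in porbit p d' by rewrite -EC'.
have CU : C = porbit q d :|: porbit q d' by rewrite EC (porbit_split dd' dd).
have dn := porbit_tperm_disj dd' dd; rewrite -/q in dn.
have nL x (E : {set T}) : x \in C -> x \in E -> E \notin L.
  move=> xC xE; apply: contra CL => EL; by rewrite (face_eq fC (fL _ EL) xC xE).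
have other x : x \notin C -> porbit q x = porbit p x.
  by move=> xC; rewrite porbit_tperm_other // -?EC -?EC'.
have dX : d \in X by apply: (subsetP (face_sub sX fC)).
have d'X : d' \in X by apply: (subsetP (face_sub sX fC)).
split=> //.
- apply/setP => E; apply/imsetP/idP => [[x xX ->]|].
    have [|xC] := boolP (x \in C).
      by rewrite CU inE -!eq_porbit_mem => /orP[] /eqP ->; rewrite !inE eqxx ?orbT.
    rewrite other //; have := mem_faces p xX; rewrite fX !inE => /orP[/eqP E1|->]; rewrite ?orbT //.
    by rewrite -E1 porbit_id in xC.
  rewrite !inE => /or3P[/eqP->|/eqP->|EL]; [by exists d | by exists d' |].
  have [x xE] := face_neq0 (fL _ EL).
  exists x; first exact: (subsetP (face_sub sX (fL _ EL))).
  rewrite other ?(faceP (fL _ EL) xE) //; apply: contraL (EL) => xC; exact: nL xC xE.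
- rewrite !inE negb_or (nL d) ?porbit_id // andbT.
  by apply: contra dn => /eqP <-; apply: porbit_id.
- by rewrite (nL d') ?porbit_id.
- apply/pred0P => x /=; apply/negbTE/negP => /andP[].
  rewrite -!eq_porbit_mem => /eqP E1 /eqP E2; case/negP: dn; rewrite -E2 E1; exact: porbit_id.
Qed.

(* The faces cut out of a face by the edges from d have degrees 0, 1, 2, ... *)
Lemma sum_rank (V : nmodType) p d F (g : nat -> V) : d \notin F ->
  let Y := (porbit p d :\: F) :\ d in
  (\sum_(d' in Y) g #|porbit (tperm d d' * p) d' :\: (d |: (d' |: F))|
   = \sum_(k < #|Y|) g k)%R.
Proof.
move=> dF Y; set C := porbit p d; pose n := #|C|.
pose idx y := index y (traject p d n).
have memC y : (y \in C) = (idx y < n).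
  by rewrite /C porbit_traject -index_mem size_traject.
have nthC i : i < n -> idx (iter i p d) = i.
  move=> ni; rewrite /idx -(nth_traject p ni) index_uniq ?size_traject //.
  exact: uniq_traject_porbit.
have iterC y : y \in C -> iter (idx y) p d = y.
  move=> yC; have lt : idx y < n by rewrite -memC.
  by rewrite -(nth_traject p lt) nth_index // -porbit_traject.
have n0 : 0 < n by rewrite lt0n card_porbit_neq0.
have idxd : idx d = 0 by rewrite -[d in LHS]/(iter 0 p d) nthC.
have idxS y : y \in C -> (idx y).+1 < n -> idx (p y) = (idx y).+1.
  by move=> yC lt; rewrite -{1}(iterC y yC) -[p _]/(iter (idx y).+1 p d) nthC.
have idx_inj y z : y \in C -> z \in C -> idx y = idx z -> y = z.
  by move=> yC zC E; rewrite -(iterC y yC) E iterC.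
(* The modified permutation sends d' to [p d], so the cycle of d' consists of the positions 1 to
   [idx d'] on the cycle started at d. *)
have main d' : d' \in Y -> porbit (tperm d d' * p) d' :\: (d |: (d' |: F))
    = [set y in C :\: F | 0 < idx y < idx d'].
  rewrite !inE -/C => /and3P[dd' d'F d'C]; set q := (tperm d d' * p)%g.
  have dC : d \in C by apply: porbit_id.
  have i0 : 0 < idx d'.
    by rewrite lt0n; apply: contra dd' => /eqP E; apply/eqP/idx_inj; rewrite ?idxd.
  have n1 : idx d' < n by rewrite -memC.
  have sC : stable q C by rewrite stable_tperm ?stable_porbit // dC d'C.
  pose A := [set y in C | 0 < idx y <= idx d'].
  have sA : stable q A.
    apply/stableP => y; rewrite !inE => /andP[yC /andP[y0 yd']].
    rewrite (stableE _ sC) yC /= permM; case: tpermP => [E|E|_ /eqP nd'].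
    - by rewrite E idxd in y0.
    - by rewrite idxS ?idxd //; apply: leq_ltn_trans n1.
    have lt : idx y < idx d'.
      by rewrite ltn_neqAle yd' andbT; apply: contra nd' => /eqP E; apply/eqP/idx_inj.
    by rewrite idxS // (leq_ltn_trans lt).
  have d'A : d' \in A by rewrite inE d'C i0 leqnn.
  have dA : d \in C :\: A by rewrite !inE dC idxd.
  have D'E : porbit q d' = A.
    apply/eqP; rewrite eqEsubset porbit_sub //=; apply/subsetP => y yA.
    have yC : y \in C by move: yA; rewrite inE => /andP[].
    have : y \in porbit q d :|: porbit q d'.
      by rewrite -porbit_split // ?(eq_sym d) // porbit_sym.
    rewrite inE => /orP[yd|//].
    have := subsetP (porbit_sub (stableD sC sA) dA) y yd; by rewrite inE yA.
  rewrite D'E; apply/setP => y; rewrite !inE !negb_or.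
  have [yC|] := boolP (y \in C); last by rewrite !andbF.
  have [->|yd] := eqVneq y d; first by rewrite idxd /= andbF.
  have [->|yd'] := eqVneq y d'; first by rewrite ltnn !andbF.
  rewrite /= andbT; congr (_ && (_ && _)); rewrite ltn_neqAle.
  by case: eqP => // /idx_inj E; rewrite E ?eqxx in yd'.
pose r d' := #|porbit (tperm d d' * p) d' :\: (d |: (d' |: F))|.
have YC d' : d' \in Y -> (d' \in C) && (d' \notin F) && (0 < idx d').
  rewrite !inE -/C => /and3P[dd' -> d'C]; rewrite d'C lt0n /=.
  by apply: contra dd' => /eqP E; apply/eqP/idx_inj; rewrite ?idxd ?porbit_id.
(* The degrees r are strictly increasing along the cycle and smaller than [#|Y|], so they take each
   value below [#|Y|] once. *)
have r_lt d1 d2 : d1 \in Y -> d2 \in Y -> idx d1 < idx d2 -> r d1 < r d2.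
  move=> h1 h2 lt; rewrite /r !main //; apply: proper_card; apply/properP; split.
    apply/subsetP => y; rewrite !inE => /andP[-> /andP[-> /= lt1]]; exact: ltn_trans lt.
  have /andP[/andP[a b] c] := YC _ h1.
  by exists d1; rewrite !inE a b c ?lt // ltnn andbF.
have r_inj : {in Y &, injective r}.
  move=> d1 d2 h1 h2 E; have /andP[/andP[a1 _] _] := YC _ h1; have /andP[/andP[a2 _] _] := YC _ h2.
  apply: idx_inj => //; case: (ltngtP (idx d1) (idx d2)) => // lt.
    by have := r_lt _ _ h1 h2 lt; rewrite E ltnn.
  by have := r_lt _ _ h2 h1 lt; rewrite E ltnn.
have r_ub d' : d' \in Y -> r d' < #|Y|.
  move=> h; rewrite /r main //; apply: proper_card; apply/properP; split.
    apply/subsetP => y; rewrite !inE -/C => /andP[-> /andP[y0 _]]; rewrite andbT.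
    by apply: contraTneq y0 => ->; rewrite idxd.
  by exists d' => //; rewrite !inE ltnn !andbF.
rewrite -[RHS](big_mkord xpredT) /= -[LHS](big_enum _ _ _ (fun d' => g (r d'))) /=.
rewrite -(big_map r xpredT) /=.
have U : uniq [seq r i | i <- enum Y].
  by rewrite map_inj_in_uniq ?enum_uniq // => x y; rewrite !mem_enum; apply: r_inj.
apply: perm_big; rewrite /index_iota subn0; apply: uniq_perm; rewrite ?iota_uniq //.
have sub : {subset [seq r i | i <- enum Y] <= iota 0 #|Y|}.
  by move=> k /mapP[d']; rewrite mem_enum => h ->; rewrite mem_iota add0n; apply: r_ub.
by apply: (uniq_min_size U sub _).2; rewrite size_iota size_map -cardE.
Qed.

End Faces.

Section EqIn.
Variables (K : finType) (h h' : K -> nat).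
Implicit Types (L I : {set K}).

Lemma hsum_eq_in L : {in L, h =1 h'} -> hsum h L = hsum h' L.
Proof. by move=> hh; apply: eq_bigr. Qed.

Lemma hpol_eq_in x L : {in L, h =1 h'} -> hpol h x L = hpol h' x L.
Proof. by move=> hh; rewrite /hpol (hsum_eq_in hh). Qed.

Lemma hprim_eq_in x L : {in L, h =1 h'} -> hprim h x L = hprim h' x L.
Proof. by move=> hh; rewrite /hprim /hvert (hpol_eq_in _ hh) (hsum_eq_in hh). Qed.
End EqIn.

Lemma sum_double (V : nmodType) n (g : nat -> V) :
  (\sum_(k < n.*2) g k = \sum_(b < n) (g b.*2 + g b.*2.+1))%R.
Proof.
elim: n => [|n IH]; first by rewrite !big_ord0.
by rewrite doubleS !big_ord_recr /= IH addrA.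
Qed.

(** * Decomposition at a root dart *)

Section RootDecomposition.

Variable T : finType.
Implicit Types (p : {perm T}) (X Y Z F C : {set T}) (I J L : {set {set T}}) (x y d : T).

Definition fdeg F C := #|C :\: F|.
Definition hdeg F C := (fdeg F C)./2.
(** Positivity is the condition [hpos] of the convolutions; only the root face may have degree 0. *)
Definition evens F L := forall C, C \in L -> ~~ odd (fdeg F C) /\ 0 < fdeg F C.
Definition fweight F L : rat := (\prod_(C in L) alpha (fdeg F C))%R.

Lemma hdeg_double F L C : evens F L -> C \in L -> (hdeg F C).*2 = fdeg F C.
Proof. by move=> ev /ev[/even_halfK]. Qed.

Lemma evens_hpos F L : evens F L -> hpos (hdeg F) L.
Proof. by move=> ev C CL; have := hdeg_double ev CL; have [_] := ev C CL; lia. Qed.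

Lemma evens_sub F L I : I \subset L -> evens F L -> evens F I.
Proof. by move=> /subsetP IL ev C /IL/ev. Qed.

Definition same_deg F F' L := {in L, forall C, fdeg F' C = fdeg F C}.

Section SameDeg.
Variables (F F' : {set T}) (L : {set {set T}}).
Hypothesis sd : same_deg F F' L.

Lemma same_hdeg I : I \subset L -> {in I, hdeg F' =1 hdeg F}.
Proof. by move=> /subsetP IL C /IL CL; rewrite /hdeg sd. Qed.

Lemma same_evens : evens F L -> evens F' L.
Proof. by move=> ev C CL; rewrite sd //; apply: ev. Qed.

Lemma same_fweight I : I \subset L -> fweight F' I = fweight F I.
Proof. by move=> /subsetP IL; apply: eq_bigr => C /IL CL; rewrite sd. Qed.
End SameDeg.

Lemma fdegU2 F C C' d d' : d \in C :\: F -> d' \in C' :\: F -> [disjoint C & C'] ->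
  fdeg (d |: (d' |: F)) (C :|: C') + 2 = fdeg F C + fdeg F C'.
Proof.
move=> dC d'C' dis; rewrite /fdeg.
have -> : (C :|: C') :\: (d |: (d' |: F)) = (C :\: F) :\ d :|: (C' :\: F) :\ d'.
  have disE x : x \in C -> x \in C' -> False.
    by move=> xC xC'; have /pred0P/(_ x) := dis; rewrite /= xC xC'.
  apply/setP => x; rewrite !inE !negb_or.
  have dC2 : d \in C by move: dC; rewrite inE => /andP[].
  have d'C2 : d' \in C' by move: d'C'; rewrite inE => /andP[].
  have [xC|xC] := boolP (x \in C); have [xC'|xC'] := boolP (x \in C') => //=.
  - by case: (disE x).
  - have -> : x != d' by apply: contraNneq xC' => ->.
    by rewrite !andbT !andbF orbF.
  - have -> : x != d by apply: contraNneq xC => ->.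
    by rewrite !andbT !andbF.
  - by rewrite !andbF.
rewrite cardsU; have -> : ((C :\: F) :\ d) :&: ((C' :\: F) :\ d') = set0; last rewrite cards0.
  apply/setP => x; rewrite !inE; apply/negbTE/negP => /andP[/andP[_ /andP[_ xC]] /andP[_ /andP[_ xC']]].
  by have /pred0P/(_ x) := dis; rewrite /= xC xC'.
by rewrite (cardsD1 d (C :\: F)) (cardsD1 d' (C' :\: F)) dC d'C'; clear; lia.
Qed.

Lemma fdeg_other F C d d' : d \notin C -> d' \notin C ->
  fdeg (d |: (d' |: F)) C = fdeg F C.
Proof.
move=> dC d'C; apply: eq_card => x; rewrite !inE !negb_or.
have [xC|] := boolP (x \in C); last by rewrite !andbF.
have -> : x != d by apply: contraNneq dC => <-.
by have -> : x != d' by apply: contraNneq d'C => <-.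
Qed.

Section Root.

Variables (p : {perm T}) (X F C0 : {set T}) (L : {set {set T}}) (d : T).
Hypotheses (sX : stable p X) (fX : faces p X = C0 |: L) (C0L : C0 \notin L)
  (dC0 : d \in C0 :\: F).

Let dC : d \in C0. Proof. by move: dC0; rewrite inE => /andP[]. Qed.
Let fC0 : C0 \in faces p X. Proof. by rewrite fX setU11. Qed.
Let C0E : C0 = porbit p d. Proof. exact: faceP fC0 dC. Qed.
Let fL C : C \in L -> C \in faces p X. Proof. by rewrite fX inE => ->; rewrite orbT. Qed.
Let sub C y : C \in faces p X -> y \in C :\: F -> y \in X :\: F.
Proof. by move=> fC; rewrite !inE => /andP[-> yC]; apply: (subsetP (face_sub sX fC)). Qed.

Let N d' := #|[set e in planar_matchings p X F | e d == d']|.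

Lemma card_matchings_decomp : #|planar_matchings p X F|
  = \sum_(d' in (C0 :\: F) :\ d) N d' + \sum_(C in L) \sum_(d' in C :\: F) N d'.
Proof.
rewrite (@card_matchings_root _ p X F d (sub fC0 dC0)).
transitivity (\sum_(y in X | (y != d) && (y \notin F)) N y).
  by apply: eq_bigl => y; rewrite !inE; case: (y \in X); rewrite ?andbT ?andbF.
rewrite (sum_faces _ _ sX) fX big_setU1 //=; congr (_ + _).
  by apply: eq_bigl => y; rewrite !inE; case: (y \in C0); rewrite ?andbT ?andbF.
apply: eq_bigr => C CL; apply: eq_bigl => y; rewrite inE [in RHS]andbC.
apply: andb_id2l => yC; case: eqP => // yd; case/negP: C0L.
by rewrite (face_eq fC0 (fL CL) dC) // -yd.
Qed.

Lemma face_disj C : C \in L -> [disjoint C0 & C].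
Proof.
move=> CL; apply/pred0P => y /=; apply/negbTE/negP => /andP[y0 yC].
by case/negP: C0L; rewrite (face_eq fC0 (fL CL) y0 yC).
Qed.

Lemma join_step C d' : C \in L -> d' \in C :\: F ->
  let q := (tperm d d' * p)%g in let F1 := d |: (d' |: F) in
  [/\ N d' = #|planar_matchings q X F1|, stable q X,
      faces q X = (C0 :|: C) |: (L :\ C) /\ C0 :|: C \notin L :\ C,
      fdeg F1 (C0 :|: C) + 2 = fdeg F C0 + fdeg F C
    & same_deg F F1 (L :\ C) /\ #|X :\: F1| < #|X :\: F|].
Proof.
move=> CL d'C q F1; have dis := face_disj CL.
have d'C2 : d' \in C by move: d'C; rewrite inE => /andP[].
have dX := sub fC0 dC0; have d'X := sub (fL CL) d'C.
have d'C0 : d' \notin C0.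
  by apply/negP => h; have /pred0P/(_ d') := dis; rewrite /= h d'C2.
split.
- by rewrite /N card_matchings_join // -C0E.
- by rewrite stable_tperm //; move: dX d'X; rewrite !inE => /andP[_ ->] /andP[_ ->].
- apply: (faces_join sX dC d'C2); rewrite ?setD11 ?setD1K //.
- exact: fdegU2.
- split.
    move=> E; rewrite in_setD1 => /andP[EC EL]; apply: fdeg_other.
      by apply: contra C0L => h; rewrite (face_eq fC0 (fL EL) dC h).
    by apply: contra EC => h; rewrite (face_eq (fL EL) (fL CL) h d'C2).
  rewrite /F1; apply: proper_card; apply/properP; split.
    by apply: setDS; rewrite setUA subsetUr.
  by exists d; rewrite // !inE eqxx.
Qed.

(** The numbers of remaining darts are given as sums of degrees because a component with an odd
    number of them carries no matching. *)
Lemma split_step d' : d' \in (C0 :\: F) :\ d ->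
  let q := (tperm d d' * p)%g in let F1 := d |: (d' |: F) in
  let D := porbit q d in let D' := porbit q d' in
  [/\ N d' = \sum_(I : {set {set T}} | I \subset L)
               #|planar_matchings q (cover (D |: I)) F1| * #|planar_matchings q (cover (D' |: (L :\: I))) F1|,
      fdeg F1 D + fdeg F1 D' + 2 = fdeg F C0,
      same_deg F F1 L,
      (D \notin L) /\ (D' \notin L)
    & forall I, I \subset L ->
       [/\ stable q (cover (D |: I)), faces q (cover (D |: I)) = D |: I,
           #|cover (D |: I) :\: F1| < #|X :\: F|,
           #|cover (D |: I) :\: F1| = fdeg F1 D + \sum_(C in I) fdeg F1 C
         & [/\ stable q (cover (D' |: I)), faces q (cover (D' |: I)) = D' |: I,
               #|cover (D' |: I) :\: F1| < #|X :\: F|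
             & #|cover (D' |: I) :\: F1| = fdeg F1 D' + \sum_(C in I) fdeg F1 C]]].
Proof.
rewrite in_setD1 => /andP[dd' d'C] q F1 D D'.
have d'C2 : d' \in C0 by move: d'C; rewrite inE => /andP[].
have d'd : d != d' by rewrite eq_sym.
have [fq DL D'L CU dis] := faces_split sX dC d'C2 d'd C0L fX.
rewrite -/q -/D -/D' in fq DL D'L CU dis.
have dX := sub fC0 dC0; have d'X := sub fC0 d'C.
have sq : stable q X.
  by rewrite stable_tperm //; move: dX d'X; rewrite !inE => /andP[_ ->] /andP[_ ->].
have DL' : D \notin L by apply: contra DL => h; rewrite inE h orbT.
have ltF : #|X :\: F1| < #|X :\: F|.
  rewrite /F1; apply: proper_card; apply/properP; split.
    by apply: setDS; rewrite setUA subsetUr.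
  by exists d; rewrite // !inE eqxx.
have gen E I : E \in faces q X -> E \notin L -> I \subset L ->
    [/\ stable q (cover (E |: I)), faces q (cover (E |: I)) = E |: I,
           #|cover (E |: I) :\: F1| < #|X :\: F|
         & #|cover (E |: I) :\: F1| = fdeg F1 E + \sum_(C in I) fdeg F1 C].
  move=> fE EL IL.
  have sE : E |: I \subset faces q X.
    rewrite subUset sub1set fE fq /= setUA; exact: subset_trans IL (subsetUr _ _).
  have st := stable_cover sE; have fc := faces_cover sE.
  split=> //.
    apply: leq_ltn_trans ltF; apply: subset_leq_card; apply: setSD.
    by rewrite -(cover_faces sq); apply/bigcupsP => C CE; apply: (bigcup_max C) => //; apply: (subsetP sE).
  rewrite (card_faces _ st) fc big_setU1 //; apply: contra EL; exact: (subsetP IL).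
have fD : D \in faces q X by rewrite fq setU11.
have fD' : D' \in faces q X by rewrite fq !inE eqxx orbT.
have nL x E : x \in C0 -> E \in L -> x \notin E.
  by move=> x0 EL; apply: contra C0L => h; rewrite (face_eq fC0 (fL EL) x0 h).
split.
- rewrite /N card_matchings_split // -?C0E //.
  rewrite (@sum_stable_subsets _ _ q X d d' L (fun Z => #|planar_matchings q Z F1| * #|planar_matchings q (X :\: Z) F1|)) //.
    apply: eq_bigr => I IL; congr (_ * #|pred_of_set (planar_matchings _ _ _)|).
    have sE : D |: I \subset faces q X by rewrite fq setUS // (subset_trans IL) // subsetUr.
    rewrite (coverD_faces sq sE) fq; congr cover.
    apply/setP => E; rewrite !inE !negb_or; have [->|ED] /= := eqVneq E D.
      move: DL; rewrite !inE negb_or => /andP[/negPf-> /negPf->] /=; by rewrite andbF.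
    have [->|ED'] := eqVneq E D'; last by rewrite /= andbC.
    by rewrite /= andbT; apply: contra D'L; exact: (subsetP IL).
  by move=> Z ns; rewrite matchings_stable0 // cards0 mul0n.
- rewrite CU; have dD : d \in D by apply: porbit_id.
  have d'D' : d' \in D' by apply: porbit_id.
  have [dF d'F] : d \notin F /\ d' \notin F.
    by move: dC0 d'C; rewrite !inE => /andP[-> _] /andP[-> _].
  have addf G : fdeg G (D :|: D') = fdeg G D + fdeg G D'.
    rewrite /fdeg setDUl cardsU.
    suff -> : (D :\: G) :&: (D' :\: G) = set0 by rewrite cards0 subn0.
    apply/setP => x; rewrite !inE; apply/negbTE/negP => /andP[/andP[_ xD] /andP[_ xD']].
    by have /pred0P/(_ x) := dis; rewrite /= xD xD'.
  rewrite addf -(@fdegU2 F D D' d d') ?inE ?dD ?d'D' ?dF ?d'F // addf //.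
- by move=> E EL; apply: fdeg_other; apply: nL.
- by [].
- move=> I IL; have [h1 h2 h3 h4] := gen _ _ fD DL' IL.
  by have [h1' h2' h3' h4'] := gen _ _ fD' D'L IL.
Qed.

Lemma sum_split_rank (V : nmodType) (f : T -> V) (g : nat -> V) :
  (forall d', d' \in (C0 :\: F) :\ d ->
     f d' = g (fdeg (d |: (d' |: F)) (porbit (tperm d d' * p) d'))) ->
  (\sum_(d' in (C0 :\: F) :\ d) f d' = \sum_(k < (fdeg F C0).-1) g k)%R.
Proof.
move=> fg; rewrite (eq_bigr _ fg) /fdeg C0E.
rewrite sum_rank; last by move: dC0; rewrite inE => /andP[].
by rewrite -C0E (cardsD1 d (C0 :\: F)) dC0.
Qed.

End Root.

End RootDecomposition.

(** * Tutte's formula by induction on the remaining darts *)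

Section ClosedForm.

Variable T : finType.
Implicit Types (p : {perm T}) (X Y Z F C : {set T}) (I J L : {set {set T}}) (x y d : T).

(** A face without remaining darts is stable under e as well, so by connectedness it is the whole of
    X. *)
Lemma matchings_no_edge_root p X F C0 L : stable p X -> faces p X = C0 |: L -> C0 \notin L ->
  C0 \subset F -> #|planar_matchings p X F| = (L == set0).
Proof.
move=> sX fX C0L C0F.
have fC0 : C0 \in faces p X by rewrite fX setU11.
have [x xC0] := face_neq0 fC0.
have C0X := face_sub sX fC0.
have [L0|L0] := eqVneq L set0.
  have XC : X = C0 by rewrite -(cover_faces sX) fX L0 setU0 /cover big_set1.
  rewrite matchings_no_edge // ?XC //; last by apply/set0Pn; exists x.
  by rewrite /num_cycles -/(faces p C0) -XC fX L0 setU0 cards1.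
apply: eq_card0 => e; apply/negbTE/negP; rewrite inE => /and3P[m /connP[_ _ _ H] _].
have XC : C0 = X.
  apply: H => //; first by apply/set0Pn; exists x.
    by rewrite (faceP fC0 xC0) stable_porbit.
  apply/stableP => y yC0; rewrite (matching_out m) // inE (subsetP C0F) //.
have /set0Pn[C CL] := L0; have fC : C \in faces p X by rewrite fX inE CL orbT.
have [y yC] := face_neq0 fC; case/negP: C0L.
by rewrite (face_eq fC0 fC _ yC) // XC (subsetP (face_sub sX fC)).
Qed.

Local Open Scope ring_scope.

Lemma fweightD1 F L C : C \in L -> fweight F L = alpha (fdeg F C) * fweight F (L :\ C).
Proof. by move=> CL; rewrite /fweight (big_setD1 C). Qed.

Lemma fweight_split F L I : I \subset L -> fweight F L = fweight F I * fweight F (L :\: I).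
Proof. by move=> IL; rewrite /fweight (big_setID I) /= (setIidPr IL). Qed.

(** There are 2h choices for the end of the edge in C, against the loss of the factor
    [alpha (2h) = h cbin h]; the ratio is [2 / cbin h]. *)
Lemma join_weight F L C h : C \in L -> evens F L -> hdeg F C = h ->
  forall u : rat, (fdeg F C)%:R * (fweight F (L :\ C) * u)
     = fweight F L * (2 / cbin h * u).
Proof.
move=> CL ev hC u; rewrite (fweightD1 _ CL) -(hdeg_double ev CL) hC alpha_double.
have h0 : (0 < h)%N by rewrite -hC; apply: evens_hpos ev _ CL.
rewrite eqn0Ngt h0 /= -mul2n natrM.
by field; rewrite cbin_neq0.
Qed.

(** Tutte's [(E-1)!/V! prod alpha] with root face of degree 2a, extended to a = 0: it is then 1 if L
    is empty and 0 otherwise. *)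
Definition even_form F a L : rat := fweight F L * (cbin a * hprim (hdeg F) a L).

Definition odd_form F i w L : rat :=
  fweight F L * (codd i * codd w * (hpol (hdeg F) (i + w).+1 L / (i + w).+1%:R)).

Lemma even_form_same F F' a L I : same_deg F F' L -> I \subset L ->
  even_form F' a I = even_form F a I.
Proof.
by move=> sd IL; rewrite /even_form (same_fweight sd IL) (hprim_eq_in _ (same_hdeg sd IL)).
Qed.

Lemma odd_form_same F F' i w L I : same_deg F F' L -> I \subset L ->
  odd_form F' i w I = odd_form F i w I.
Proof.
by move=> sd IL; rewrite /odd_form (same_fweight sd IL) (hpol_eq_in _ (same_hdeg sd IL)).
Qed.

Lemma even_sum_evens F L : evens F L -> ~~ odd (\sum_(C in L) fdeg F C).
Proof.
move=> ev; elim/big_ind: _ => // [x y|C /ev[] //].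
by rewrite oddD => /negPf-> /negPf->.
Qed.

(** Here k is the degree of the face cut off at d', and [a - k./2] the half-degree of the one left
    at d. *)
Lemma sum_even_rev (f : nat -> rat) a :
  \sum_(k < a.*2.+1) (if odd k then 0 else f (a - k./2)%N) = \sum_(b < a.+1) f b.
Proof.
rewrite [RHS](reindex_inj rev_ord_inj) /=.
rewrite [RHS](eq_bigr (fun b : 'I_a.+1 => f (a - b)%N)); last by move=> b _; rewrite subSS.
rewrite !big_ord_recr /= odd_double doubleK; congr (_ + _).
rewrite (sum_double a (fun k => if odd k then 0 else f (a - k./2)%N)).
by apply: eq_bigr => b _; rewrite /= odd_double doubleK addr0.
Qed.

(** The two statements are proved together because an edge between the two odd faces, or a cut of an
    odd root face, leads back to the even case. *)
Lemma closed_forms n :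
  (forall p X F C0 L a, (#|X :\: F| < n)%N -> stable p X -> faces p X = C0 |: L ->
     C0 \notin L -> fdeg F C0 = a.*2 -> evens F L ->
     #|planar_matchings p X F|%:R = even_form F a L)
  /\ (forall p X F C0 C1 L i w, (#|X :\: F| < n)%N -> stable p X ->
     faces p X = C0 |: (C1 |: L) -> C0 \notin C1 |: L -> C1 \notin L ->
     fdeg F C0 = i.*2.+1 -> fdeg F C1 = w.*2.+1 -> evens F L ->
     #|planar_matchings p X F|%:R = odd_form F i w L).
Proof.
elim: n => [|n [IHe IHo]]; first by split.
split.
  move=> p X F C0 L [|a]; rewrite ltnS => le sX fX C0L dg0 ev.
    rewrite (matchings_no_edge_root sX fX C0L); last first.
      by rewrite -setD_eq0 -cards_eq0; apply/eqP.
    rewrite /even_form cbin0 mul1r /hprim hpol0l.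
    have [->|L0] := eqVneq L set0; last by rewrite mul0r mulr0.
    by rewrite /fweight big_set0 /hvert /hsum big_set0 cards0.
  have /card_gt0P[d dC0] : (0 < fdeg F C0)%N by rewrite dg0.
  rewrite (card_matchings_decomp sX fX C0L dC0) natrD !natr_sum addrC.
  rewrite /even_form (even_loop _ (evens_hpos ev)) mulrDr; congr (_ + _).
    rewrite mulr_sumr; apply: eq_bigr => C CL.
    set h := hdeg F C.
    rewrite (_ : fweight F L * _ = fweight F L * (2 / cbin h *
       (cbin (a + h) * hprim (hdeg F) (a + h) (L :\ C)))); last by ring.
    rewrite -(join_weight CL ev erefl) natr_sum.
    rewrite (eq_bigr (fun _ => even_form F (a + h) (L :\ C))); last first.
      move=> d' d'C; have [-> sq [fq nq] dgq [sd lt]] := join_step sX fX C0L dC0 CL d'C.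
      rewrite (IHe _ _ _ _ _ (a + h)%N (leq_trans lt le) sq fq nq).
      - exact: even_form_same sd (subxx _).
      - by move: dgq; rewrite dg0 -(hdeg_double ev CL) -/h; clear; lia.
      - by apply: same_evens sd _; apply: evens_sub ev; apply: subD1set.
    by rewrite sumr_const -[LHS]mulr_natl -/(fdeg F C).
  pose S b := cbin b * cbin (a - b) * \sum_(I : {set {set T}} | I \subset L)
     hprim (hdeg F) b I * hprim (hdeg F) (a - b) (L :\: I).
  pose g k := if odd k then 0 else fweight F L * S (a - k./2)%N.
  rewrite (sum_split_rank (L := L) (g := g) fX dC0); last first.
    move=> d' d'C; have [-> dgq sd [DL D'L] H] := split_step sX fX C0L dC0 d'C.
    set q := (tperm d d' * p)%g in dgq H DL D'L *; set F1 := d |: (d' |: F) in dgq H sd *.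
    set D := porbit q d in dgq H DL *; set D' := porbit q d' in dgq H D'L *.
    have ev1 I : I \subset L -> evens F1 I.
      by move=> IL; apply: evens_sub IL _; apply: same_evens sd ev.
    (* If D' has odd degree, so has D, and the component of D has an odd number of darts whatever I
       is. *)
    rewrite natr_sum /g; case: ifP => oD'.
      apply: big1 => I IL; have [_ _ _ cD _] := H I IL.
      rewrite matchings_odd0 ?cards0 ?mul0n // cD oddD (negPf (even_sum_evens (ev1 _ IL))) addbF.
      by move: (congr1 odd dgq); rewrite dg0 !oddD oD' odd_double addbF; case: odd.
    pose c := (fdeg F1 D')./2; pose b := (fdeg F1 D)./2.
    have cE : fdeg F1 D' = c.*2 by rewrite /c even_halfK ?oD'.
    have bE : fdeg F1 D = b.*2.
      rewrite /b even_halfK //; move: (congr1 odd dgq); rewrite dg0 !oddD oD' odd_double addbF.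
      by case: odd.
    have abc : a = (b + c)%N by move: dgq; rewrite dg0 cE bE; clear; lia.
    rewrite -/c /S abc addnK addKn !mulr_sumr; apply: eq_bigr => I IL.
    have [s1 f1 lt1 _ _] := H I IL.
    have [_ _ _ _ [s2 f2 lt2 _]] := H _ (subsetDl L I).
    rewrite natrM.
    rewrite (IHe _ _ _ _ _ b (leq_trans lt1 le) s1 f1); first last.
    - exact: ev1.
    - exact: bE.
    - by apply: contra DL; apply: (subsetP IL).
    rewrite (IHe _ _ _ _ _ c (leq_trans lt2 le) s2 f2); first last.
    - exact/ev1/subsetDl.
    - exact: cE.
    - by apply: contra D'L; apply: (subsetP (subsetDl _ _)).
    rewrite (even_form_same _ sd IL) (even_form_same _ sd (subsetDl L I)).
    by rewrite /even_form (fweight_split _ IL); ring.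
  by rewrite dg0 doubleS /= (sum_even_rev (fun b => fweight F L * S b)) mulr_sumr.
move=> p X F C0 C1 L i w; rewrite ltnS => le sX fX C0L C1L dg0 dg1 ev.
have /card_gt0P[d dC0] : (0 < fdeg F C0)%N by rewrite dg0.
rewrite (card_matchings_decomp sX fX C0L dC0) natrD addrC.
rewrite big_setU1 //= natrD !natr_sum.
rewrite /odd_form (odd_loop _ _ (evens_hpos ev)) !mulrDr.
have hpos' := evens_hpos ev.
congr (_ + _ + _).
- rewrite (eq_bigr (fun _ => even_form F (i + w) L)); last first.
    move=> d' d'C; have [-> sq [fq nq] dgq [sd lt]] := join_step sX fX C0L dC0 (setU11 _ _) d'C.
    rewrite (setU1K C1L) in fq nq sd.
    rewrite (IHe _ _ _ _ _ (i + w)%N (leq_trans lt le) sq fq nq).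
    + exact: even_form_same sd (subxx _).
    + by move: dgq; rewrite dg0 dg1; clear; lia.
    + exact: same_evens sd _.
  rewrite sumr_const -[LHS]mulr_natl -/(fdeg F C1) dg1 /even_form; ring.
- rewrite mulr_sumr; apply: eq_bigr => C CL.
  set h := hdeg F C; have h0 : (0 < h)%N by apply: hpos'.
  rewrite (_ : fweight F L * _ = fweight F L * (2 / cbin h *
       (codd (i + h).-1 * codd w * (hpol (hdeg F) ((i + h).-1 + w).+1 (L :\ C)
          / ((i + h).-1 + w).+1%:R)))); last first.
    rewrite (_ : ((i + h).-1 + w).+1 = i + w + h)%N; last by move: h0; clear; lia.
    ring.
  rewrite -(join_weight CL ev erefl) natr_sum.
  rewrite (eq_bigr (fun _ => odd_form F (i + h).-1 w (L :\ C))); last first.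
    have CL1 : C \in C1 |: L by rewrite inE CL orbT.
    move=> d' d'C; have [-> sq [fq nq] dgq [sd lt]] := join_step sX fX C0L dC0 CL1 d'C.
    have E : (C1 |: L) :\ C = C1 |: (L :\ C).
      apply/setP => x; rewrite !inE; case: (x =P C1) => //= ->.
      by rewrite andbT; apply: contraNneq C1L => ->.
    rewrite E in fq nq sd.
    rewrite (IHo _ _ _ _ _ _ (i + h).-1 w (leq_trans lt le) sq fq nq).
    + exact: odd_form_same sd (subsetUr _ _).
    + by rewrite inE (negPf C1L) andbF.
    + by move: dgq; rewrite dg0 -(hdeg_double ev CL) -/h; move: h0; clear; lia.
    + by rewrite (sd C1 (setU11 _ _)).
    + have sd' : same_deg F (d |: (d' |: F)) (L :\ C).
        by move=> C' C'L; apply: sd; rewrite inE C'L orbT.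
      by apply: same_evens sd' _; apply: evens_sub ev; apply: subD1set.
  by rewrite sumr_const -[LHS]mulr_natl -/(fdeg F C).
pose S b := cbin b * codd (i.-1 - b) * codd w * \sum_(I : {set {set T}} | I \subset L)
     hprim (hdeg F) b I * (hpol (hdeg F) (i - b + w) (L :\: I) / (i - b + w)%:R).
(* In [S b] the even one of the two new faces has degree 2b. As k is the degree of D', the even face
   is D' or D according to the parity of k. *)
pose g k := fweight F L * S (if odd k then i.-1 - k./2 else k./2)%N.
rewrite (sum_split_rank (L := C1 |: L) (g := g) fX dC0); last first.
  move=> d' d'C; have [-> dgq sd [DL D'L] H] := split_step sX fX C0L dC0 d'C.
  set q := (tperm d d' * p)%g in dgq H DL D'L *; set F1 := d |: (d' |: F) in dgq H sd *.
  set D := porbit q d in dgq H DL *; set D' := porbit q d' in dgq H D'L *.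
  have sdL : same_deg F F1 L by move=> C CL; rewrite sd // inE CL orbT.
  have ev1 I : I \subset L -> evens F1 I.
    by move=> IL; apply: evens_sub IL _; apply: same_evens sdL ev.
  have dgC1 : fdeg F1 C1 = w.*2.+1 by rewrite sd ?setU11.
  have oddD' : odd (fdeg F1 D) = ~~ odd (fdeg F1 D').
    by move: (congr1 odd dgq); rewrite dg0 !oddD /= odd_double addbF; do 2 case: odd.
  have C1I I : I \subset L -> C1 \notin I by move=> IL; apply: contra C1L => /(subsetP IL).
  have UL I : I \subset L -> C1 |: I \subset C1 |: L by move=> IL; rewrite setUS.
  have UL' I : I \subset L -> I \subset C1 |: L by move=> IL; rewrite (subset_trans IL) ?subsetUr.
  have DL2 : D \notin L by apply: contra DL => h; rewrite inE h orbT.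
  have D'L2 : D' \notin L by apply: contra D'L => h; rewrite inE h orbT.
  have notU E I : E \notin C1 |: L -> I \subset L -> E \notin C1 |: I.
    by move=> EL IL; apply: contra EL => /(subsetP (UL _ IL)).
  have notI E I : E \notin L -> I \subset L -> E \notin I.
    by move=> EL IL; apply: contra EL => /(subsetP IL).
  have sDl I : L :\: I \subset L by apply: subsetDl.
  (* By parity C1 goes with whichever of D and D' is odd, so one of these two sums vanishes. *)
  rewrite natr_sum sum_subsetU1 //.
  pose c := (fdeg F1 D')./2; pose b := (fdeg F1 D)./2.
  rewrite /g; case: ifP => oD'.
    rewrite oD' /= in oddD'.
    have cE : fdeg F1 D' = c.*2.+1 by rewrite -[LHS]odd_double_half oD'.
    have bE : fdeg F1 D = b.*2 by rewrite -[LHS]odd_double_half oddD'.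
    have abc : i = (b + c).+1%N by move: dgq; rewrite dg0 cE bE; clear; lia.
    rewrite addrC big1 ?add0r => [|I IL]; last first.
      have [_ _ _ cD _] := H _ (UL _ IL).
      rewrite matchings_odd0 ?cards0 ?mul0n // cD big_setU1 ?C1I //= !oddD oddD' dgC1 /=.
      by rewrite odd_double (negPf (even_sum_evens (ev1 _ IL))).
    rewrite -/c /S abc /= addnK mulr_sumr mulr_sumr; apply: eq_bigr => I IL.
    have [s1 f1 lt1 _ _] := H _ (UL' _ IL).
    have [_ _ _ _ [s2 f2 lt2 _]] := H _ (subsetDl (C1 |: L) I).
    have E : (C1 |: L) :\: I = C1 |: (L :\: I).
      by apply/setP => x; rewrite !inE; case: (x =P C1) => //= ->; rewrite C1I.
    rewrite E in s2 f2 lt2 *.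
    rewrite natrM (IHe _ _ _ _ _ b (leq_trans lt1 le) s1 f1 (notI _ _ DL2 IL) bE (ev1 _ IL)).
    rewrite (IHo _ _ _ _ _ _ c w (leq_trans lt2 le) s2 f2 (notU _ _ D'L (sDl _)) (C1I _ (sDl _)) cE dgC1 (ev1 _ (sDl _))).
    rewrite (even_form_same _ sdL IL) (odd_form_same _ _ sdL (sDl I)).
    rewrite /even_form /odd_form (fweight_split _ IL) addKn.
    by rewrite subSn ?leq_addr // addKn addSn; ring.
  rewrite oD' /= in oddD'.
  have cE : fdeg F1 D' = c.*2 by rewrite -[LHS]odd_double_half oD'.
  have bE : fdeg F1 D = b.*2.+1 by rewrite -[LHS]odd_double_half oddD'.
  have abc : i = (c + b).+1%N by move: dgq; rewrite dg0 cE bE; clear; lia.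
  rewrite big1 ?add0r => [|I IL]; last first.
    have [_ _ _ cD _] := H _ (UL' _ IL).
    rewrite matchings_odd0 ?cards0 ?mul0n // cD oddD oddD'.
    by rewrite (negPf (even_sum_evens (ev1 _ IL))).
  (* Here D is odd; complementing makes I the set of faces of the even component, as in S. *)
  rewrite -/c /S abc /= addKn sum_subset_compl mulr_sumr mulr_sumr; apply: eq_bigr => I IL.
  have E : (C1 |: L) :\: (C1 |: (L :\: I)) = I.
    apply/setP => x; rewrite !inE !negb_or !negb_and negbK; case: (x =P C1) => //= [->|_].
      by rewrite (negPf (C1I _ IL)).
    by have := subsetP IL x; case: (x \in I); case: (x \in L) => //= /(_ isT).
  have [s1 f1 lt1 _ _] := H _ (UL _ (sDl I)).
  have [_ _ _ _ [s2 f2 lt2 _]] := H _ (subsetDl (C1 |: L) (C1 |: (L :\: I))).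
  rewrite E in s2 f2 lt2 *.
  rewrite natrM (IHe _ _ _ _ _ c (leq_trans lt2 le) s2 f2 (notI _ _ D'L2 IL) cE (ev1 _ IL)).
  rewrite (IHo _ _ _ _ _ _ b w (leq_trans lt1 le) s1 f1 (notU _ _ DL (sDl _)) (C1I _ (sDl _)) bE dgC1 (ev1 _ (sDl _))).
  rewrite (even_form_same _ sdL IL) (odd_form_same _ _ sdL (sDl I)).
  rewrite /even_form /odd_form (fweight_split _ IL).
  by rewrite subSn ?leq_addr // addKn addSn; ring.
rewrite dg0 /= sum_double big_split /=.
have E1 : \sum_(b < i) g b.*2 = fweight F L * \sum_(b < i) S b.
  by rewrite mulr_sumr; apply: eq_bigr => b _; rewrite /g odd_double doubleK.
have E2 : \sum_(b < i) g b.*2.+1 = fweight F L * \sum_(b < i) S b.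
  rewrite mulr_sumr [RHS](reindex_inj rev_ord_inj) /=; apply: eq_bigr => b _.
  by rewrite /g /= odd_double /= uphalf_double; congr (_ * S _); have := ltn_ord b; clear; lia.
rewrite E1 E2; transitivity (fweight F L * (2 * \sum_(b < i) S b)); first by ring.
by [].
Qed.

End ClosedForm.

(** * Counting rooted face permutations *)

Section MonomialFunctions.

Variables (V : Type) (idx : V) (op : Monoid.com_law idx) (f : nat -> nat -> V).
Hypothesis f0 : forall i, f i 0 = idx.
Implicit Types m : monom.

Definition mbig m := \big[op/idx]_(i <- finsupp m) f i (m i).

Lemma mbig_widen (d : {fset nat}) m : (finsupp m `<=` d)%fset ->
  mbig m = \big[op/idx]_(i <- d) f i (m i).
Proof.
move=> le; rewrite /mbig (big_fset_incl _ le) // => i _.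
by rewrite -cmE_eq0 => /eqP ->.
Qed.

Lemma mbig1 : mbig mone = idx.
Proof. by rewrite /mbig mdom1 big_seq_fset0. Qed.

(** Only the factor at i changes; the equation is written crosswise since [op] need not have
    inverses. *)
Lemma mbigU i m : op (mbig (mmul (ucm i) m)) (f i (m i)) = op (f i (m i).+1) (mbig m).
Proof.
set d := (i |` finsupp m)%fset.
have id : i \in d by rewrite !inE eqxx.
have le : (finsupp m `<=` d)%fset by apply: fsubsetU1.
have le' : (finsupp (mmul (ucm i) m) `<=` d)%fset by rewrite mdomD mdomU.
rewrite (mbig_widen le) (mbig_widen le').
rewrite !(big_fsetD1 i id) /= cmM cmUU add1n -Monoid.mulmA; congr (op _ _).
rewrite [LHS]Monoid.mulmC; congr (op _ _); apply: eq_big_seq => j.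
by rewrite !inE => /andP[ji _]; rewrite cmM cmU eq_sym (negPf ji).
Qed.

End MonomialFunctions.

Lemma monom_eqP (m m' : monom) : (forall i, m i = m' i) -> m = m'.
Proof. by move=> H; apply/eqP/cmP. Qed.

Lemma divcmK i (m : monom) : 0 < m i -> mmul (ucm i) (divcm m (ucm i)) = m.
Proof.
move=> mi; apply: monom_eqP => j; rewrite cmM divcmE cmU.
by case: eqVneq => [<-|]; lia.
Qed.

Lemma mmulU_inj i (m m' : monom) : mmul (ucm i) m = mmul (ucm i) m' -> m = m'.
Proof.
move=> E; apply: monom_eqP => j; have := congr1 (fun m : monom => m j) E.
by rewrite !cmM; lia.
Qed.

Lemma mcoef_prod (I : Type) (r : seq I) (P : pred I) (F : I -> monom) j :
  (\big[mmul/mone]_(x <- r | P x) F x) j = \sum_(x <- r | P x) F x j.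
Proof.
by elim/big_rec2: _ => [|x k m _ <-]; rewrite ?cm1 // cmM.
Qed.

Lemma mcoef_prod_ucm (I : finType) (A : {set I}) (k : I -> nat) j :
  (\big[mmul/mone]_(x in A) ucm (k x)) j = #|[set x in A | k x == j]|.
Proof.
rewrite mcoef_prod -sum1dep_card big_mkcondr; apply: eq_bigr => x _.
by rewrite cmU; case: eqP.
Qed.

Section RootedFaces.

Variable T : finType.

Definition bface (K : finType) (phi : {perm T}) (b : {ffun K -> T}) k := porbit phi (b k).

Definition inner (K : finType) (phi : {perm T}) (b : {ffun K -> T}) : {set {set T}} :=
  porbits phi :\: [set bface phi b k | k : K].

Definition inner_weight (K : finType) phi (b : {ffun K -> T}) : monom :=
  \big[mmul/mone]_(f in inner phi b) ucm #|f|./2.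

(** The roots are indexed by an arbitrary finite type so that one more inner face can be rooted by
    passing to [option K]. *)
Definition rooted (K : finType) (l : K -> nat) (m : monom) :
    {set {perm T} * {ffun K -> T}} :=
  [set y | [&& injectiveb (bface y.1 y.2), [forall k, #|bface y.1 y.2 k| == l k],
     [forall f in inner y.1 y.2, ~~ odd #|f|] & inner_weight y.1 y.2 == m]].

Lemma rootedP (K : finType) (l : K -> nat) m phi b :
  reflect [/\ injective (bface phi b), forall k, #|bface phi b k| = l k,
     forall f, f \in inner phi b -> ~~ odd #|f| & inner_weight phi b = m]
   ((phi, b) \in rooted l m).
Proof.
rewrite inE /=; apply: (iffP and4P) => [[/injectiveP a /forallP c /forall_inP d /eqP e]|[a c d e]].
  by split=> // k; apply/eqP.
by split; [exact/injectiveP|apply/forallP => k; apply/eqP|exact/forall_inP|exact/eqP].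
Qed.

Definition olift (K : finType) (A : Type) (b : K -> A) (a : A) (k : option K) :=
  if k is Some k' then b k' else a.

Definition addroot (K : finType) (b : {ffun K -> T}) (x : T) : {ffun option K -> T} :=
  [ffun k => olift b x k].

Lemma porbits_eqface (phi : {perm T}) (C C' : {set T}) x : C \in porbits phi -> C' \in porbits phi ->
  x \in C -> x \in C' -> C = C'.
Proof.
case/imsetP=> y _ -> /imsetP[z _ ->].
by rewrite -!eq_porbit_mem => /eqP <- /eqP <-.
Qed.

Lemma inner_addroot (K : finType) (phi : {perm T}) (b : {ffun K -> T}) x :
  inner phi (addroot b x) = inner phi b :\ porbit phi x.
Proof.
apply/setP => C; rewrite !inE andbA; congr (_ && _); rewrite -negb_or; congr (~~ _).
apply/imsetP/orP => [[[k|] _ ->]|[/eqP ->|/imsetP[k _ ->]]].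
- by right; apply/imsetP; exists k; rewrite // /bface ffunE.
- by left; rewrite /bface ffunE.
- by exists None; rewrite // /bface ffunE.
- by exists (Some k); rewrite // /bface ffunE.
Qed.

Lemma rooted_addroot (K : finType) (l : K -> nat) m i (phi : {perm T}) (b : {ffun K -> T}) x :
  ((phi, addroot b x) \in rooted (olift l i.*2) m) =
  ((phi, b) \in rooted l (mmul (ucm i) m)) &&
   ((porbit phi x \in inner phi b) && (#|porbit phi x| == i.*2)).
Proof.
have bS k : bface phi (addroot b x) (Some k) = bface phi b k by rewrite /bface ffunE.
have bN : bface phi (addroot b x) None = porbit phi x by rewrite /bface ffunE.
have wE : porbit phi x \in inner phi b -> #|porbit phi x| = i.*2 ->
   inner_weight phi b = mmul (ucm i) (inner_weight phi (addroot b x)).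
  by move=> xin cx; rewrite /inner_weight inner_addroot (big_setD1 _ xin) /= cx doubleK.
apply/rootedP/andP => [[inj sz ev wt]|[/rootedP[inj sz ev wt] /andP[xin /eqP cx]]].
  have cx : #|porbit phi x| = i.*2 by rewrite -bN sz.
  have xin : porbit phi x \in inner phi b.
    rewrite inE imset_f // andbT; apply/imsetP => -[k _ E].
    by have := inj None (Some k); rewrite bN bS => /(_ E).
  split; last by rewrite xin cx eqxx.
  apply/rootedP; split=> [k k' E|k|f fin|].
  - by have := inj (Some k) (Some k'); rewrite !bS => /(_ E) [].
  - by rewrite -bS sz.
  - have [->|fx] := eqVneq f (porbit phi x); first by rewrite cx odd_double.
    by apply: ev; rewrite inner_addroot in_setD1 fx.
  - by rewrite wE // wt.
split=> [[k|] [k'|]|[k|]|f|].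
- by rewrite !bS => /inj ->.
- rewrite bS bN => E; move: xin; rewrite inE -E.
  by case/andP=> /imsetP[]; exists k.
- rewrite bS bN => E; move: xin; rewrite inE E.
  by case/andP=> /imsetP[]; exists k'.
- by [].
- by rewrite bS sz.
- by rewrite bN.
- by rewrite inner_addroot in_setD1 => /andP[_ /ev].
- by apply: (@mmulU_inj i); rewrite -wE.
Qed.

(* Root one more inner face, of degree 2i. *)
Lemma card_addroot (K : finType) (l : K -> nat) m i : 0 < i ->
  #|rooted (olift l i.*2) m| = #|rooted l (mmul (ucm i) m)| * (i.*2 * (m i).+1).
Proof.
move=> i0; set l' := olift l _; set M := mmul _ _.
pose ext (u : ({perm T} * {ffun K -> T}) * T) := (u.1.1, addroot u.1.2 u.2).
have ext_inj : injective ext.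
  move=> [[phi b] x] [[phi' b'] x'] [-> E]; congr (_, _, _).
    by apply/ffunP => k; have := congr1 (fun g : {ffun option K -> T} => g (Some k)) E; rewrite !ffunE.
  by have := congr1 (fun g : {ffun option K -> T} => g None) E; rewrite !ffunE.
have -> : rooted l' m = ext @: [set u | ext u \in rooted l' m].
  apply/setP => -[phi b]; apply/idP/imsetP => [h|[u]]; last by rewrite in_set => ? ->.
  have bE : b = addroot [ffun k => b (Some k)] (b None).
    by apply/ffunP => -[k|]; rewrite !ffunE /= ?ffunE.
  have E : ext ((phi, [ffun k => b (Some k)]), b None) = (phi, b) by rewrite /ext /= -bE.
  by exists ((phi, [ffun k => b (Some k)]), b None); rewrite 1?in_set E.
rewrite card_imset // -sum1dep_card -sum_nat_const.
rewrite [LHS](eq_bigl (fun u => (u.1 \in rooted l M) &&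
   ((porbit u.1.1 u.2 \in inner u.1.1 u.1.2) && (#|porbit u.1.1 u.2| == i.*2)))); last first.
  by move=> [[phi b] x]; rewrite /ext /= rooted_addroot.
rewrite -(pair_big_dep (fun y => y \in rooted l M)
  (fun (y : {perm T} * {ffun K -> T}) x => (porbit y.1 x \in inner y.1 y.2) && (#|porbit y.1 x| == i.*2))
  (fun _ _ => 1)) /=.
apply: eq_bigr => -[phi b] /rootedP[inj sz ev wt] /=.
pose S := [set f in inner phi b | #|f|./2 == i].
have cS : #|S| = (m i).+1.
  by rewrite -mcoef_prod_ucm -/(inner_weight phi b) wt cmM cmUU.
rewrite (partition_big (porbit phi) [in S]) /=; last first.
  by move=> x /andP[xin /eqP cx]; rewrite inE xin cx doubleK eqxx.
rewrite -cS mulnC -sum_nat_const; apply: eq_bigr => f.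
rewrite inE => /andP[fin /eqP f2]; have cf : #|f| = i.*2.
  by rewrite -f2 even_halfK // ev.
rewrite -[RHS]cf -sum1_card; apply: eq_bigl => x.
have fP : f \in porbits phi by move: fin; rewrite inE => /andP[].
apply/idP/idP => [/andP[_ /eqP <-]|xf]; first exact: porbit_id.
suff -> : porbit phi x = f by rewrite fin cf !eqxx.
by apply: (porbits_eqface _ fP (porbit_id phi x) xf); apply: imset_f.
Qed.

(** When every face is rooted, a dart is determined by its face and its distance from the root, so a
    rooted permutation amounts to a bijection from these positions to T. *)
Lemma card_rooted_full (K : finType) (l : K -> nat) : (forall k, 0 < l k) ->
  #|T| = \sum_k l k -> #|rooted l mone| = (#|T|)`!.
Proof.
move=> l0 cT; pose O := {k : K & 'I_(l k)}.
have cO : #|{: O}| = #|T|.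
  rewrite card_tagged cT -big_enum /= sumnE big_map; apply: eq_bigr => k _.
  by rewrite card_ord.
rewrite -[RHS]ffactnn -[X in _ ^_ X]cO -card_inj_ffuns.
pose Phi (y : {perm T} * {ffun K -> T}) : {ffun O -> T} :=
  [ffun o : O => (y.1 ^+ (tagged o : 'I_(l (tag o))))%g (y.2 (tag o))].
(* The weight [mone] leaves no inner face, so every dart lies in a rooted one. *)
have full y : y \in rooted l mone -> forall x, exists o, Phi y o = x.
  case: y => phi b /rootedP[inj sz ev wt] x.
  have : porbit phi x \notin inner phi b.
    apply/negP => fin.
    have S0 : [set f in inner phi b | #|f|./2 == #|porbit phi x|./2] = set0.
      by apply/eqP; rewrite -cards_eq0 -mcoef_prod_ucm -/(inner_weight phi b) wt cm1.
    have : porbit phi x \in [set f in inner phi b | #|f|./2 == #|porbit phi x|./2].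
      by rewrite in_set fin eqxx.
    by rewrite S0 inE.
  rewrite inE negb_and negbK imset_f //= orbF => /imsetP[k _ E].
  have : x \in porbit phi (b k) by rewrite -[porbit _ (b k)]E porbit_id.
  rewrite porbit_traject -[#|_|]/(#|bface phi b k|) sz => /trajectP[j jl ->].
  exists (Tagged (fun k => 'I_(l k)) (Ordinal jl)); rewrite ffunE /=.
  by rewrite -permX.
rewrite -(@card_in_imset _ _ Phi); last first.
  move=> [phi b] [phi' b'] h h' E.
  have bb : b = b'.
    apply/ffunP => k; have := congr1 (fun g : {ffun O -> T} => g (Tagged (fun k => 'I_(l k)) (Ordinal (l0 k)))) E.
    by rewrite !ffunE /= !expg0 !perm1.
  rewrite -{b'}bb in h' E *; congr (_, _); apply/permP => x.
  have [[k j] <-] := full _ h x.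
  have Ej i : i < l k -> (phi ^+ i)%g (b k) = (phi' ^+ i)%g (b k).
    move=> ik; have := congr1 (fun g : {ffun O -> T} => g (Tagged (fun k => 'I_(l k)) (Ordinal ik))) E.
    by rewrite !ffunE.
  rewrite ffunE /=.
  transitivity ((phi ^+ j.+1)%g (b k)); first by rewrite expgSr permM.
  transitivity ((phi' ^+ j.+1)%g (b k)); last by rewrite expgSr permM Ej.
  (* After the last position of a face both permutations return to its root. *)
  have [lt|ge] := ltnP j.+1 (l k); first exact: Ej.
  have -> : j.+1 = l k by apply/eqP; rewrite eqn_leq ge ltn_ord.
  have cyc' ph : (ph, b) \in rooted l mone -> (ph ^+ (l k))%g (b k) = b k.
    case/rootedP => _ sz _ _; rewrite -(sz k) permX; exact: iter_porbit.
  by rewrite !cyc'.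
congr #|pred_of_set _|; apply/setP => f; apply/imsetP/idP => [[y h ->]|].
  rewrite inE; apply/injectiveP => o o' E.
  have onto : #|image (Phi y) {: O}| == #|{: O}|.
    rewrite [X in _ == X]cO eqn_leq max_card /=; apply: subset_leq_card.
    apply/subsetP => x _; have [o1 <-] := full _ h x; exact: codom_f.
  by move/image_injP: onto => /(_ o o' isT isT E).
rewrite inE => /injectiveP finj.
have le : #|T| <= #|{: O}| by rewrite cO.
have [g fK gK] := inj_card_bij finj le.
pose tg k (j : 'I_(l k)) : O := Tagged (fun k => 'I_(l k)) j.
(* Conversely, the face permutation is the cyclic shift within each face, transported by f. *)
pose su (o : O) : O := tg (tag o) (ordS (tagged o)).
have suinj : injective su.
  move=> [k j] [k' j'] E; have kk : k = k' by exact: (congr1 tag E).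
  subst k'; congr (tg k _); apply: (can_inj (@ordSK _)).
  by have /eqP := E; rewrite /su /tg /= eq_Tagged => /eqP.
have phinj : injective (fun x => f (su (g x))).
  by move=> x y /finj/suinj/(can_inj gK).
pose phi := perm phinj.
have phiE o : phi (f o) = f (su o) by rewrite permE fK.
pose b := [ffun k => f (tg k (Ordinal (l0 k)))].
have powE k j (jl : j < l k) : (phi ^+ j)%g (b k) = f (tg k (Ordinal jl)).
  elim: j jl => [|j IH] jl; first by rewrite expg0 perm1 ffunE; congr (f (tg k _)); apply: val_inj.
  rewrite expgSr permM (IH (ltnW jl)) phiE; congr (f (tg k _)); apply: val_inj => /=.
  by rewrite modn_small.
pose A k := [set f (tg k j) | j : 'I_(l k)].
have bA k : bface phi b k = A k.
  apply/eqP; rewrite eqEsubset; apply/andP; split.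
    apply: porbit_sub; last by rewrite ffunE; apply: imset_f.
    by apply/stableP => _ /imsetP[j _ ->]; rewrite phiE; apply: imset_f.
  apply/subsetP => _ /imsetP[[j jl] _ ->]; rewrite -powE; exact: mem_porbit.
have tginj k : injective (tg k).
  by move=> j j' /eqP; rewrite /tg eq_Tagged => /eqP.
exists (phi, b); last by apply/ffunP => -[k [j jl]]; rewrite ffunE /= powE.
have in0 : inner phi b = set0.
  apply/eqP; rewrite setD_eq0; apply/subsetP => _ /imsetP[x _ ->].
  case ox : (g x) => [k j]; apply/imsetP; exists k => //.
  rewrite bA; have xA : x \in A k by rewrite -[x]gK ox; apply: imset_f.
  by rewrite -bA /bface -eq_porbit_mem in xA; rewrite (eqP xA) -bA.
apply/rootedP; split.
- move=> k k' E; have : f (tg k (Ordinal (l0 k))) \in A k' by rewrite -bA -E bA; apply: imset_f.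
  by case/imsetP=> j _ /finj /(congr1 tag).
- move=> k; rewrite bA card_imset ?card_ord //; exact: inj_comp finj (tginj k).
- by move=> C; rewrite in0 inE.
- by rewrite /inner_weight in0 big_set0.
Qed.

End RootedFaces.

(** The number of ways to root all inner faces and to order those of equal degree. *)
Definition inner_sym : monom -> nat :=
  mbig (muln : Monoid.com_law 1) (fun i k => i.*2 ^ k * k`!).

Definition inner_darts : monom -> nat :=
  mbig (addn : Monoid.com_law 0) (fun i k => i.*2 * k).

(** Inner faces are rooted one at a time by [card_addroot] until [card_rooted_full] applies. *)
Lemma card_rooted (T K : finType) (l : K -> nat) (m : monom) : (forall k, 0 < l k) -> m 0 = 0 ->
  #|T| = \sum_k l k + inner_darts m ->
  #|rooted T l m| * inner_sym m = (#|T|)`!.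
Proof.
have [n] := ubnP (mdeg m); elim: n => // n IH in K l m *; rewrite ltnS => le l0 m0 cT.
have [m1|[i im]] := fset_0Vmem (finsupp m).
  have {}m1 : m = mone by apply: monom_eqP => i; rewrite cm1; apply/eqP; rewrite cmE_eq0 m1.
  rewrite m1 [inner_sym _]mbig1 muln1 card_rooted_full // cT m1.
  by rewrite [inner_darts _]mbig1 addn0.
have mi : 0 < m i by rewrite lt0n cmE_neq0.
have i0 : 0 < i by case: i im mi => // _; rewrite m0.
set m' := divcm m (ucm i); have mE : m = mmul (ucm i) m' by rewrite divcmK.
have H := @card_addroot T K l m' i i0; rewrite -mE in H.
have l0' k : 0 < olift l i.*2 k by case: k => //=; rewrite double_gt0.
have := IH _ (olift l i.*2) m' _ l0'.
have -> : mdeg m' < n by move: le; rewrite mE mdegM mdegU.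
have -> : m' 0 = 0 by rewrite divcmE m0.
have S1 := @mbigU _ _ (muln : Monoid.com_law 1) (fun i k => i.*2 ^ k * k`!) (fun=> erefl) i m'.
have S2 := @mbigU _ _ (addn : Monoid.com_law 0) (fun i k => i.*2 * k) (fun i => muln0 _) i m'.
have -> : \sum_k olift l i.*2 k = \sum_k l k + i.*2.
  rewrite (bigD1 None) //= addnC; congr (_ + _).
  rewrite (reindex_omap Some id) /=; last by case.
  by apply: eq_bigl => k; rewrite eqxx.
rewrite -mE /= -/(inner_darts m') -/(inner_darts m) -/(inner_sym m') -/(inner_sym m) in S1 S2.
have S2' : inner_darts m = i.*2 + inner_darts m'.
  by move: S2; rewrite mulnS; clear; lia.
rewrite -addnA -S2' => /(_ isT erefl cT) <-.
rewrite H -mulnA; congr (_ * _).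
have p0 : 0 < i.*2 ^ m' i * (m' i)`! by rewrite muln_gt0 expn_gt0 double_gt0 i0 fact_gt0.
apply/eqP; rewrite -(eqn_pmul2r p0); apply/eqP; rewrite S1 factS expnS.
by rewrite mulnACA mulnAC.
Qed.

(** * From matchings to planar maps *)

Section Planar.

Variable T : finType.
Implicit Types (phi sigma e : {perm T}) (X Z : {set T}).

Lemma stable_acts p Z : stable p Z = (p \in 'N(Z | 'P)%g).
Proof.
apply/idP/idP => [sZ|/astabsP H]; last by apply/stableP => x xZ; have := H x; rewrite /= /aperm xZ.
by apply/astabsP => x; rewrite /= apermE stableE.
Qed.

Lemma transitive_conn phi e :
  ([transitive <<[set phi; e]>>, on [set: T] | 'P])%g = connected phi e [set: T].
Proof.
set A := [set phi; e].
have [phiA eA] : phi \in <<A>>%g /\ e \in <<A>>%g by split; apply: mem_gen; rewrite !inE eqxx ?orbT.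
apply/idP/connP => [tr|[T0 _ _ H]].
  have T0 : [set: T] != set0.
    by case/imsetP: tr => x _ ->; apply/set0Pn; exists x; apply: orbit_refl.
  split; rewrite ?stableT // => Z _ /set0Pn[z zZ] sZ eZ.
  apply/eqP; rewrite eqEsubset subsetT /= -(atransP tr z (in_setT z)).
  rewrite acts_sub_orbit // gen_subG; apply/subsetP => g.
  by rewrite in_set2 => /orP[] /eqP ->; rewrite -stable_acts.
have /set0Pn[x _] := T0; apply/imsetP; exists x => //; apply/esym.
have st g : g \in <<A>>%g -> stable g (orbit 'P <<A>> x)%g.
  move=> gA; apply/stableP => y yo; rewrite -[g y]/(aperm y g).
  by rewrite -(orbit_transl _ (mem_orbit 'P y gA)) in yo *.
apply: H; rewrite ?subsetT ?st //.
by apply/set0Pn; exists x; apply: orbit_refl.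
Qed.

Lemma card_matching_cyc e : matching e [set: T] -> (num_cycles e [set: T]).*2 = #|T|.
Proof.
move=> m; have [ie M] := matchingP _ _ m.
have -> : #|T| = #|[set: T] :\: set0| by rewrite setD0 cardsT.
rewrite (card_faces _ (stableT e)) -muln2 -sum_nat_const.
apply: eq_bigr => C /imsetP[x _ ->]; rewrite setD0.
have -> : porbit e x = [set x; e x].
  apply/eqP; rewrite eqEsubset; apply/andP; split.
    apply: porbit_sub; last by rewrite !inE eqxx.
    apply/stableP => y; rewrite !inE => /orP[] /eqP ->; rewrite ?eqxx ?orbT //.
    by rewrite (involP _ ie) eqxx.
  by rewrite subUset !sub1set porbit_id (mem_porbit e 1).
by rewrite cards2 eq_sym M inE.
Qed.

(** Since [e * e = 1], sigma is [e * phi], and sigma and phi generate the same group together with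
    e. As T has 2E darts, [charsum] = V + E + F equals [#|T| + 2] exactly when V - E + F = 2. *)
Lemma planar_mapE sigma e :
  planar_map sigma e = (e \in planar_matchings (face_perm sigma e) [set: T] set0).
Proof.
rewrite inE setD0 /planar_map; set phi := face_perm sigma e.
have -> : [forall d, (e d != d) && (e (e d) == d)] = matching e [set: T].
  by apply: eq_forallb => x; rewrite inE andbC; congr (_ && _); case: (_ != _).
have [m|] //= := boolP (matching e _).
have [ie M] := matchingP _ _ m.
have ee : (e * e)%g = 1%g by apply/permP => x; rewrite permM (involP _ ie) perm1.
have sE : sigma = (e * phi)%g by rewrite /phi /face_perm mulgA ee mul1g.
clearbody phi; subst sigma.
have -> : <<[set (e * phi)%g; e]>>%g = <<[set phi; e]>>%g.
  apply/eqP; rewrite eqEsubset !gen_subG; apply/andP; split; apply/subsetP => g;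
    rewrite in_set2 => /orP[] /eqP ->; try by rewrite mem_gen // in_set2 eqxx orbT.
    by rewrite groupM ?mem_gen // in_set2 eqxx ?orbT.
  suff : (e * (e * phi))%g \in <<[set (e * phi)%g; e]>>%g by rewrite [in X in X -> _]mulgA ee mul1g.
  by rewrite groupM ?mem_gen // in_set2 eqxx ?orbT.
rewrite transitive_conn; congr (_ && _).
rewrite !card_porbits /charsum cardsT -(card_matching_cyc m).
by apply/eqP/eqP; clear; lia.
Qed.

(** Brings the convolution form back to Tutte's quotient of factorials. *)
Lemma hpol_fact (K : finType) (h : K -> nat) x (L : {set K}) : 0 < x -> #|L| <= hsum h L ->
  (hpol h x L / x%:R = ((x + hsum h L).-1)`!%:R / (x + hsum h L - #|L|)`!%:R)%R.
Proof.
move=> x0 le; rewrite /hpol; have x0' : (x%:R != 0 :> rat)%R by rewrite pnatr_eq0 -lt0n.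
have f0 n : (n`!%:R != 0 :> rat)%R by rewrite pnatr_eq0 -lt0n fact_gt0.
case cL: #|L| => [|k] in le *.
  have -> : hsum h L = 0 by rewrite (cards0_eq cL) /hsum big_set0.
  rewrite addn0 subn0; case: x x0 x0' => // x _ x0'; rewrite factS natrM /=.
  by field; rewrite nat1r x0' f0.
rewrite mulrAC divff // mul1r; have := ffact_fact (n := (x + hsum h L).-1) (m := k).
have -> : (x + hsum h L).-1 - k = x + hsum h L - k.+1 by move: x0; clear; lia.
have kl : k <= (x + hsum h L).-1 by move: x0 le; clear; lia.
by move/(_ kl) <-; rewrite natrM mulfK.
Qed.

Lemma odd_sum_card (I : finType) (P : pred I) (d : I -> nat) :
  odd (\sum_(i | P i) d i) = odd #|[set i | P i & odd (d i)]|.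
Proof.
rewrite -sum1dep_card big_mkcondr /=.
elim/big_rec2: _ => // i x y Pi; rewrite !oddD => ->; by case: (odd (d i)).
Qed.

(** Tutte's formula: [#|T|./2] is E, and by Euler's relation the denominator is V!. The root face is
    any face in the even case and one of the two odd faces otherwise. *)
Lemma card_planar_matchings phi : 0 < #|T| ->
  let O := [set C in porbits phi | odd #|C| ] in
  #|O| = 0 \/ #|O| = 2 ->
  (#|planar_matchings phi [set: T] set0|%:R = (\prod_(C in porbits phi) alpha #|C|)
    * ((#|T|./2.-1)`!%:R / (#|T|./2 + 2 - #|porbits phi|)`!%:R))%R.
Proof.
move=> T0 O Oc; have sT := stableT phi.
have fT : faces phi [set: T] = porbits phi.
  by apply/setP => C; apply/imsetP/imsetP => -[x _ ->]; exists x.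
have f0 (C : {set T}) : fdeg set0 C = #|C| by rewrite /fdeg setD0.
have pos C : C \in porbits phi -> 0 < #|C|.
  by case/imsetP=> x _ ->; rewrite lt0n card_porbit_neq0.
have Tsum : #|T| = \sum_(C in porbits phi) #|C|.
  have -> : #|T| = #|[set: T] :\: set0| by rewrite setD0 cardsT.
  rewrite (card_faces _ sT) fT.
  by apply: eq_bigr => C _; rewrite setD0.
have sumL (L : {set {set T}}) : evens set0 L -> \sum_(C in L) #|C| = (hsum (hdeg set0) L).*2.
  move=> ev; rewrite /hsum -muln2 big_distrl /=; apply: eq_bigr => C CL.
  by rewrite muln2 (hdeg_double ev CL) f0.
have evL (L : {set {set T}}) : L \subset porbits phi -> (forall C : {set T}, C \in L -> ~~ odd #|C|) -> evens set0 L.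
  by move=> /subsetP LP no C CL; rewrite f0 no // pos ?LP.
have lt : #|[set: T] :\: set0| < #|T|.+1 by rewrite setD0 cardsT.
have [IHe IHo] := @closed_forms T (#|T|.+1).
have [O0|O2] := Oc.
  have noO C : C \in porbits phi -> ~~ odd #|C|.
    by move=> CP; apply/negP => oC; have := in_set0 C; rewrite -(cards0_eq O0) inE CP oC.
  have /card_gt0P[x _] := T0; set C0 := porbit phi x.
  have C0P : C0 \in porbits phi by apply: imset_f.
  set L := porbits phi :\ C0.
  have LP : L \subset porbits phi by apply: subD1set.
  have ev : evens set0 L by apply: evL => // C /(subsetP LP); apply: noO.
  set a := #|C0|./2; have aE : #|C0| = a.*2 by rewrite even_halfK // noO.
  rewrite (IHe phi setT set0 C0 L a) ?f0 ?fT ?setD1K ?setD11 //.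
  rewrite (big_setD1 C0) //= -/L aE alpha_double.
  have a0 : 0 < a by have := pos _ C0P; rewrite aE; clear; lia.
  rewrite eqn0Ngt a0 /= /even_form (_ : fweight set0 L = \prod_(C in L) alpha #|C|)%R; last first.
    by apply: eq_bigr => C _; rewrite f0.
  have hl := hpos_le (evens_hpos ev).
  have := hpol_fact a0 hl; rewrite /hprim /hvert.
  have TE : #|T|./2 = a + hsum (hdeg set0) L.
    by rewrite Tsum (big_setD1 C0) //= -/L sumL // aE -doubleD doubleK.
  rewrite -TE => H; have -> : #|porbits phi| = #|L|.+1 by rewrite (cardsD1 C0) C0P.
  have -> : #|T|./2 + 2 - #|L|.+1 = (#|T|./2 - #|L|).+1 by move: hl; rewrite TE; clear; lia.
  have -> : #|T|./2.+1 - #|L| = (#|T|./2 - #|L|).+1 by move: hl; rewrite TE; clear; lia.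
  have a0' : (a%:R != 0 :> rat)%R by rewrite pnatr_eq0 -lt0n.
  rewrite factS natrM (_ : hpol _ _ _ = a%:R * (hpol (hdeg set0) a L / a%:R))%R; last by field.
  rewrite H; field; rewrite nat1r !pnatr_eq0 /= -lt0n fact_gt0 //.
have /cards2P[C0 [C1 [C01 OE]]] : #|O| == 2 by rewrite O2.
have /andP[C0P o0] : (C0 \in porbits phi) && odd #|C0|.
  by have := set21 C0 C1; rewrite -OE inE.
have /andP[C1P o1] : (C1 \in porbits phi) && odd #|C1|.
  by have := set22 C0 C1; rewrite -OE inE.
have noO C : C \in porbits phi -> C != C0 -> C != C1 -> ~~ odd #|C|.
  move=> CP n0 n1; apply/negP => oC; have : C \in O by rewrite inE CP.
  by rewrite OE !inE (negPf n0) (negPf n1).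
have C1P' : C1 \in porbits phi :\ C0 by rewrite !inE eq_sym C01.
set L := porbits phi :\ C0 :\ C1.
have LP : L \subset porbits phi by apply: subset_trans (subD1set _ _) (subD1set _ _).
have ev : evens set0 L.
  by apply: evL => // C; rewrite !inE => /and3P[? ? ?]; apply: noO.
set i := #|C0|./2; set w := #|C1|./2.
have iE : #|C0| = i.*2.+1 by rewrite -[LHS]odd_double_half o0.
have wE : #|C1| = w.*2.+1 by rewrite -[LHS]odd_double_half o1.
rewrite (IHo phi setT set0 C0 C1 L i w) ?f0 ?fT ?setD1K ?setD11 //.
rewrite (big_setD1 C0) //= (big_setD1 C1) //= -/L iE wE !alpha_doubleS.
rewrite /odd_form (_ : fweight set0 L = \prod_(C in L) alpha #|C|)%R; last first.
  by apply: eq_bigr => C _; rewrite f0.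
have hl := hpos_le (evens_hpos ev).
rewrite (hpol_fact _ hl) //.
have TE : #|T|./2 = (i + w).+1 + hsum (hdeg set0) L.
  rewrite Tsum (big_setD1 C0) //= (big_setD1 C1) //= -/L sumL // iE wE.
  by rewrite -[RHS]doubleK; congr _./2; clear; lia.
rewrite -TE; have -> : #|porbits phi| = #|L|.+2.
  by rewrite (cardsD1 C0) C0P (cardsD1 C1 (_ :\ _)) C1P'.
rewrite addn2 !subSS /codd; ring.
Qed.

End Planar.

(** * Free action of the renumberings of darts *)

Section Renumbering.

Variable T : finType.
Implicit Types (s e p phi : {perm T}).

Lemma porbitJ s p x : porbit (s ^ p)%g (p x) = p @: porbit s x.
Proof.
apply/setP => y; apply/porbitP/imsetP => [[i ->]|[z /porbitP[i ->] ->]].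
  by exists ((s ^+ i)%g x); rewrite ?mem_porbit // -conjXg permJ.
by exists i; rewrite -conjXg permJ.
Qed.

Lemma porbitsJ s p : porbits (s ^ p)%g = [set p @: (C : {set T}) | C in porbits s].
Proof.
apply/setP => C; apply/imsetP/imsetP => [[x _ ->]|[_ /imsetP[x _ ->] ->]].
  by exists (porbit s (p^-1 x)%g); rewrite ?imset_f // -porbitJ permKV.
by exists (p x); rewrite ?porbitJ.
Qed.

Lemma imset_perm_inj p : injective (fun C : {set T} => p @: C).
Proof. exact/imset_inj/perm_inj. Qed.

Lemma card_porbitsJ s p : #|porbits (s ^ p)%g| = #|porbits s|.
Proof. rewrite porbitsJ card_imset //; exact: imset_perm_inj. Qed.

Lemma conn_setTJ s e p : connected s e [set: T] -> connected (s ^ p)%g (e ^ p)%g [set: T].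
Proof.
move=> /connP[T0 _ _ H]; apply/connP; split; rewrite ?stableT // => Z _ /set0Pn[z zZ] sZ eZ.
have st q : stable (q ^ p)%g Z -> stable q (p @^-1: Z).
  by move=> sq; apply/stableP => x; rewrite !inE -(stableE _ sq) permJ.
have ZT : p @^-1: Z = [set: T].
  apply: H; rewrite ?subsetT ?st //.
  by apply/set0Pn; exists (p^-1 z)%g; rewrite inE permKV.
apply/setP => x; have : (p^-1 x)%g \in p @^-1: Z by rewrite ZT inE.
by rewrite !inE permKV => ->.
Qed.

Lemma face_permJ s e p : face_perm (s ^ p)%g (e ^ p)%g = (face_perm s e ^ p)%g.
Proof. by rewrite /face_perm conjMg. Qed.

Lemma planar_mapJ s e p : planar_map s e -> planar_map (s ^ p)%g (e ^ p)%g.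
Proof.
case/and3P=> /forallP H tr eu; apply/and3P; split.
- apply/forallP => x; rewrite -[x](permKV p) !permJ !(inj_eq perm_inj); exact: H.
- by move: tr; rewrite !transitive_conn; apply: conn_setTJ.
- by rewrite face_permJ !card_porbitsJ.
Qed.

Variables (r : nat) (l : 'I_r -> nat).
Implicit Type b : {ffun 'I_r -> T}.

Definition renum p b : {ffun 'I_r -> T} := [ffun i => p (b i)].

Lemma bfaceJ phi p b i : bface (phi ^ p)%g (renum p b) i = p @: bface phi b i.
Proof. by rewrite /bface ffunE porbitJ. Qed.

Lemma innerJ phi p b :
  inner (phi ^ p)%g (renum p b) = [set p @: (C : {set T}) | C in inner phi b].
Proof.
rewrite /inner porbitsJ; apply/setP => C.
apply/setDP/imsetP => [[/imsetP[C0 C0P ->] nb]|[C0 /setDP[C0P nb] ->]].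
  exists C0 => //; apply/setDP; split=> //; apply: contra nb => /imsetP[i _ ->].
  by apply/imsetP; exists i; rewrite ?bfaceJ.
split; first exact: imset_f.
apply: contra nb => /imsetP[i _ E]; apply/imsetP; exists i => //.
by apply: (@imset_perm_inj p); rewrite E bfaceJ.
Qed.

Lemma even_mapJ s e p b : even_map l s e b -> even_map l (s ^ p)%g (e ^ p)%g (renum p b).
Proof.
rewrite /even_map /inner_faces /boundary_face !face_permJ.
case/and4P=> pl /injectiveP inj /forallP sz /forall_inP ev; apply/and4P; split.
- exact: planar_mapJ.
- apply/injectiveP => i j; rewrite -!/(bface _ _ _) !bfaceJ => /imset_perm_inj; exact: inj.
- apply/forallP => i; rewrite -/(bface _ _ _) bfaceJ card_imset; [exact: sz | exact: perm_inj].
- apply/forall_inP => f; rewrite -[_ :\: _]/(inner (face_perm s e ^ p)%g (renum p b)) innerJ => /imsetP[C Cin ->].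
  by rewrite card_imset; [apply: ev | apply: perm_inj].
Qed.

Lemma map_weightJ s e p b : map_weight (s ^ p)%g (e ^ p)%g (renum p b) = map_weight s e b.
Proof.
rewrite /map_weight /inner_faces /boundary_face !face_permJ; congr mmul; last first.
  rewrite -[_ :\: _]/(inner (face_perm s e ^ p)%g (renum p b)) innerJ.
  rewrite big_imset /=; last by move=> ? ? _ _; apply: imset_perm_inj.
  by apply: eq_bigr => C _; rewrite card_imset //; apply: perm_inj.
by rewrite porbitsJ big_imset //= => ? ? _ _; apply: imset_perm_inj.
Qed.

(** The fixed points of an automorphism form a stable set containing a marked corner, hence all
    darts. *)
Lemma renum_free s e p b : 0 < r -> planar_map s e ->
  (s ^ p)%g = s -> (e ^ p)%g = e -> renum p b = b -> p = 1%g.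
Proof.
move=> r0 /and3P[_ tr _] sp ep bp; move: tr; rewrite transitive_conn => /connP[_ _ _ H].
have ZT : [set x | p x == x] = [set: T].
  have st q : (q ^ p)%g = q -> stable q [set x | p x == x].
    by move=> qp; apply/stableP => x; rewrite !inE => /eqP px; rewrite -permJ qp px.
  apply: H; rewrite ?subsetT ?st //; apply/set0Pn; exists (b (Ordinal r0)).
  by rewrite inE -{2}bp ffunE.
by apply/permP => x; rewrite perm1; apply/eqP; have := in_setT x; rewrite -ZT inE.
Qed.

End Renumbering.

(** Each isomorphism class is a free orbit of the symmetric group on the darts. *)
Lemma num_even_maps_fact r (l : 'I_r -> nat) m : 0 < r ->
  num_even_maps l m * (num_darts l m)`! = #|even_maps (num_darts l m) l m|.
Proof.
move=> r0; rewrite /num_even_maps; set D := num_darts l m; set S := even_maps D l m.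
have eqR : {in S & &, equivalence_rel (@map_iso D r)}.
  by move=> x y z _ _ _; apply: map_iso_equiv.
rewrite -(card_uniform_partition _ (equivalence_partitionP eqR)) //.
move=> _ /imsetP[[[s e] b] sebS ->].
pose act (p : {perm 'I_D}) : marked_map D r := ((s ^ p)%g, (e ^ p)%g, renum p b).
have := sebS; rewrite inE => /andP[em /eqP wt].
have -> : [set N in S | map_iso (s, e, b) N] = [set act p | p : {perm 'I_D}].
  apply/setP => -[[s' e'] b']; rewrite inE; apply/andP/imsetP.
    case=> _ /existsP[p /and3P[/eqP <- /eqP <- /forallP bp]]; exists p => //.
    by congr (_, _, _); apply/ffunP => i; rewrite ffunE; apply/esym/eqP.
  case=> p _ [-> -> ->]; split; first by rewrite inE even_mapJ // map_weightJ wt eqxx.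
  by apply/existsP; exists p; rewrite !eqxx /=; apply/forallP => i; rewrite ffunE.
rewrite card_imset ?card_Sn // => p q [E1 E2 E3].
have pl : planar_map s e by case/and4P: em.
have cv (u : {perm 'I_D}) : (u ^ p = u ^ q -> u ^ (p * q^-1) = u)%g.
  by move=> E; rewrite conjgM E conjgK.
apply/eqP; rewrite eq_mulgV1; apply/eqP; apply: (renum_free (b := b) r0 pl); rewrite ?cv //.
apply/ffunP => i; have := congr1 (fun g : {ffun 'I_r -> 'I_D} => g i) E3.
by rewrite !ffunE permM => ->; rewrite permK.
Qed.

Definition inner_part (m : monom) : monom :=
  [cmonom (if i == 0 then 0 else m i) | i in finsupp m]%M.

Lemma inner_partE m i : inner_part m i = if i == 0 then 0 else m i.
Proof.
rewrite cmE fsfun_fun; case: ifP => //; case: (i == 0) => // /negbT.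
by rewrite -cmE_eq0 => /eqP.
Qed.

(** * Even maps as matchings on rooted face permutations *)

Section CountMaps.

Variables (T : finType) (r : nat) (l : 'I_r -> nat).
Implicit Types (s e p phi : {perm T}) (b : {ffun 'I_r -> T}).

Lemma even_map_weightE s e b m : let phi := face_perm s e in
  (even_map l s e b && (map_weight s e b == m)) =
  [&& e \in planar_matchings phi [set: T] set0, (phi, b) \in rooted T l (inner_part m)
    & #|porbits s| == m 0].
Proof.
move=> phi; rewrite /even_map planar_mapE -/phi [_ \in rooted _ _ _]inE /=.
case: (e \in _) => //; rewrite -[inner_faces _ _ _]/(inner phi b) !andTb.
rewrite -[boundary_face s e b]/(bface phi b).
case: (injectiveb _) => //; case: [forall i, _] => //; rewrite !andTb.
case: (altP forall_inP) => // ev; rewrite !andTb.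
(* The variable of index 0 is t. No inner face contributes to it, for its degree is even and
   positive. *)
have i0 : inner_weight phi b 0 = 0.
  rewrite mcoef_prod_ucm; apply: eq_card0 => C; rewrite inE; apply/negbTE/negP => /andP[Cin].
  have := ev C Cin; move: Cin; rewrite inE => /andP[_ /imsetP[x _ ->]] od.
  by rewrite -(eqn_pmul2r (isT : 0 < 2)) !muln2 even_halfK // double0 (negPf (card_porbit_neq0 _ _)).
have wE i : map_weight s e b i = (if i == 0 then #|porbits s| else 0) + inner_weight phi b i.
  rewrite cmM mcoef_prod_ucm; congr (_ + _); case: ifP => [/eqP ->|].
    by apply: eq_card => C; rewrite inE eqxx andbT.
  by move=> i0'; apply: eq_card0 => C; rewrite inE eq_sym i0' andbF.
apply/eqP/andP => [<-|[/eqP E /eqP V]].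
  split; last by rewrite wE /= i0 addn0.
  apply/eqP/monom_eqP => i; rewrite inner_partE wE; by case: (i =P 0) => [->|_] /=; rewrite ?i0 ?add0n.
apply: monom_eqP => i; rewrite wE E inner_partE; case: ifP => [/eqP ->|//].
by rewrite addn0.
Qed.

Lemma card_porbits_rooted phi b m : (phi, b) \in rooted T l m ->
  #|porbits phi| = r + mdeg m.
Proof.
case/rootedP=> inj sz ev <-; rewrite /inner_weight.
have -> : mdeg (\big[mmul/mone]_(f in inner phi b) ucm #|f|./2) = #|inner phi b|.
  by rewrite mdeg_prod -sum1_card; apply: eq_bigr => C _; rewrite mdegU.
rewrite -(cardsID [set bface phi b i | i : 'I_r] (porbits phi)); congr (_ + _).
rewrite (setIidPr _); first by rewrite card_imset // card_ord.
by apply/subsetP => _ /imsetP[i _ ->]; apply: imset_f.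
Qed.

Lemma planar_matching_euler phi e : e \in planar_matchings phi [set: T] set0 ->
  #|porbits (e * phi)%g| + #|porbits phi| = #|T|./2 + 2 /\ ~~ odd #|T|.
Proof.
rewrite inE setD0 => /and3P[m _ /eqP]; rewrite !card_porbits /charsum cardsT.
rewrite -(card_matching_cyc m) odd_double doubleK; split=> //; lia.
Qed.

(** Maps are reparametrized by the face permutation instead of sigma. Euler's relation then fixes
    the number of vertices, so the exponent of t either suits all matchings or none. *)
Lemma card_even_maps m :
  #|[set M : {perm T} * {perm T} * {ffun 'I_r -> T} |
      even_map l M.1.1 M.1.2 M.2 && (map_weight M.1.1 M.1.2 M.2 == m)]|
  = if m 0 + r + mdeg (inner_part m) == #|T|./2 + 2 then
      \sum_(y in rooted T l (inner_part m)) #|planar_matchings y.1 [set: T] set0| else 0.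
Proof.
set bal := (_ == _).
pose h (u : {perm T} * {ffun 'I_r -> T} * {perm T}) : {perm T} * {perm T} * {ffun 'I_r -> T} :=
  ((u.2^-1 * u.1.1)%g, u.2, u.1.2).
have hinj : injective h.
  by move=> [[phi b] e] [[phi' b'] e'] [E1 E2 E3]; subst e' b'; move/mulgI: E1 => ->.
set A := [set M | _]; have -> : A = h @: [set u | h u \in A].
  apply/setP => -[[s e] b]; apply/idP/imsetP => [MA|[u]]; last by rewrite in_set => uA ->.
  have E : h ((e * s)%g, b, e) = (s, e, b) by rewrite /h /= mulKg.
  by exists ((e * s)%g, b, e); rewrite 1?in_set E.
rewrite card_imset // -sum1dep_card.
rewrite (eq_bigl (fun u => (u.1 \in rooted T l (inner_part m)) &&
   (bal && (u.2 \in planar_matchings u.1.1 [set: T] set0)))); last first.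
  move=> [[phi b] e]; rewrite /h in_set /= even_map_weightE /face_perm mulKVg.
  rewrite andbCA; apply: andb_id2l => /card_porbits_rooted yR; rewrite andbC; apply: andb_id2r => em.
  have [ev _] := planar_matching_euler em.
  have ie : (e^-1 = e)%g.
    move: em; rewrite inE => /and3P[/matchingP[ie _] _ _].
    by apply/permP => x; apply: (@perm_inj _ e); rewrite permKV (involP _ ie).
  by rewrite ie /bal -ev yR -[r + _ in RHS]/(r + _) -addnA [m 0 + _]addnC [RHS]eq_sym [_ + (_ + _)]addnC eqn_add2l.
rewrite -(pair_big_dep (fun y => y \in rooted T l (inner_part m))
   (fun (y : {perm T} * {ffun 'I_r -> T}) e => bal && (e \in planar_matchings y.1 [set: T] set0)) (fun _ _ => 1)) /=.
case: bal => /=; last by apply: big1 => y _; rewrite big_pred0.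
by apply: eq_bigr => y _; rewrite sum1_card.
Qed.

End CountMaps.

(** * Coefficients of the powers of R *)

Local Open Scope ring_scope.

Section Fps.

Implicit Types (m d : monom) (f g h : fps).

Lemma mdvd_mul d m : mdvd d m -> mmul d (divcm m d) = m.
Proof.
by move=> /mdvdP dm; apply: monom_eqP => i; rewrite cmM divcmE subnKC.
Qed.

Lemma mdvd_mulr d m : mdvd d (mmul d m).
Proof. by apply/mdvdP => i; rewrite cmM leq_addr. Qed.

Lemma mulmK d m : divcm (mmul d m) d = m.
Proof. by apply: monom_eqP => i; rewrite divcmE cmM addKn. Qed.

Lemma mdvd_trans d d' m : mdvd d d' -> mdvd d' m -> mdvd d m.
Proof. by move=> /mdvdP a /mdvdP b; apply/mdvdP => i; apply: leq_trans (a i) (b i). Qed.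

Lemma fps_mul_ext f f' g g' : f =1 f' -> g =1 g' -> fps_mul f g =1 fps_mul f' g'.
Proof. by move=> ff gg m; apply: eq_bigr => d _; rewrite ff gg. Qed.

Lemma sum_mdivs_div d m (F : monom -> rat) : mdvd d m ->
  \sum_(u <- mdivs m | mdvd d u) F u = \sum_(u <- mdivs (divcm m d)) F (mmul d u).
Proof.
move=> dm; rewrite -big_filter -[RHS](big_map (mmul d) xpredT).
apply: perm_big; apply: uniq_perm.
- by rewrite filter_uniq.
- rewrite map_inj_uniq ?fset_uniq // => u v /(congr1 (fun w => divcm w d)).
  by rewrite !mulmK.
move=> u; rewrite mem_filter mem_mdivs; apply/andP/mapP => [[du um]|[v]].
  exists (divcm u d); last by rewrite mdvd_mul.
  rewrite mem_mdivs; apply/mdvdP => i; rewrite !divcmE; apply: leq_sub2r.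
  exact: (mdvdP _ _ um).
rewrite mem_mdivs => /mdvdP vm ->; split; first exact: mdvd_mulr.
apply/mdvdP => i; rewrite cmM; have := vm i; rewrite divcmE.
have := mdvdP _ _ dm i; lia.
Qed.

Lemma sum_mdivs_sub d m (F : monom -> rat) : mdvd d m ->
  \sum_(u <- mdivs d) F u = \sum_(u <- mdivs m | mdvd u d) F u.
Proof.
move=> dm; rewrite -[RHS]big_filter; apply: perm_big; apply: uniq_perm.
- exact: fset_uniq.
- by rewrite filter_uniq.
move=> u; rewrite mem_filter !mem_mdivs; apply/idP/andP => [ud|[]//].
by split=> //; apply: mdvd_trans ud dm.
Qed.

Lemma fps_mulA f g h : fps_mul f (fps_mul g h) =1 fps_mul (fps_mul f g) h.
Proof.
move=> m; rewrite /fps_mul.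
(* Both sides become sums over chains of divisors d | u | m. *)
transitivity (\sum_(d <- mdivs m) \sum_(u <- mdivs m | mdvd d u)
    f d * g (divcm u d) * h (divcm m u)).
  rewrite big_seq [RHS]big_seq; apply: eq_bigr => d; rewrite mem_mdivs => dm.
  rewrite (sum_mdivs_div (fun u => f d * g (divcm u d) * h (divcm m u)) dm).
  rewrite mulr_sumr; apply: eq_bigr => u _; rewrite mulmK mulrA; congr (_ * h _).
  by apply: monom_eqP => i; rewrite !divcmE cmM subnDA.
rewrite (exchange_big_dep xpredT) //= big_seq [RHS]big_seq; apply: eq_bigr => u.
rewrite mem_mdivs => um; rewrite mulr_suml.
by rewrite (sum_mdivs_sub (fun d => f d * g (divcm u d) * h (divcm m u)) um).
Qed.

Lemma fps_mulDl f g h : fps_mul (fps_add f g) h =1 fps_add (fps_mul f h) (fps_mul g h).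
Proof. by move=> m; rewrite /fps_add /fps_mul -big_split; apply: eq_bigr => d _; rewrite mulrDl. Qed.

Lemma fps_mulZl c f g : fps_mul (fps_scale c f) g =1 fps_scale c (fps_mul f g).
Proof. by move=> m; rewrite /fps_scale /fps_mul mulr_sumr; apply: eq_bigr => d _; rewrite mulrA. Qed.

Lemma fps_xsum_mul (F : nat -> fps) g :
  fps_mul (fps_xsum F) g =1 fps_xsum (fun i => fps_mul (F i) g).
Proof.
move=> m; rewrite /fps_xsum.
under [RHS]eq_bigr => i _ do rewrite fps_mulA.
rewrite {1}/fps_mul; rewrite [RHS]exchange_big /= big_seq [RHS]big_seq.
apply: eq_bigr => d; rewrite mem_mdivs => dm; rewrite -mulr_suml; congr (_ * _).
(* The sum at d runs over the variables of d only; those of m that do not occur in d add zero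
   terms. *)
have sub : (finsupp d `<=` finsupp m)%fset.
  apply/fsubsetP => i; rewrite -!cmE_neq0 -!lt0n => h; apply: leq_trans h _.
  exact: (mdvdP _ _ dm).
rewrite big_mkcond [RHS]big_mkcond; apply: (big_fset_incl _ sub) => i _ id /=.
by case: ifP => // _; apply: fps_mul_var_eq0.
Qed.

Lemma fps_1mul f : fps_mul fps_one f =1 f.
Proof.
move=> m; rewrite /fps_mul /fps_one.
have om : mone \in mdivs m by rewrite mem_mdivs; apply/mdvdP => i; rewrite cm1.
rewrite (big_fsetD1 mone om) /= eqxx mul1r big_seq big1 ?addr0.
  by congr f; apply: monom_eqP => i; rewrite divcmE cm1 subn0.
by move=> d; rewrite in_fsetD1 => /andP[/negPf-> _]; rewrite mul0r.
Qed.

Lemma fps_expD f i j : fps_mul (fps_exp f i) (fps_exp f j) =1 fps_exp f (i + j).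
Proof.
elim: i => [|i IH]; first exact: fps_1mul.
move=> m; rewrite addSn /= -fps_mulA; exact: fps_mul_ext.
Qed.

(** One factor of [R^(s+1)] is replaced by the right side of its equation. *)
Lemma R_pow_rec R s m : R_equation R ->
  fps_exp R s.+1 m = (if 0%N \in finsupp m then fps_exp R s (divcm m (ucm 0)) else 0)
   + \sum_(i <- finsupp m | (0 < i)%N)
        ('C(i.*2.-1, i))%:R * fps_exp R (i + s) (divcm m (ucm i)).
Proof.
move=> eR; rewrite [fps_exp R s.+1 m]/= (fps_mul_ext eR (frefl (fps_exp R s))).
rewrite /R_rhs fps_mulDl /fps_add fps_mul_varE; congr (_ + _).
rewrite fps_xsum_mul /fps_xsum big_seq_cond [RHS]big_seq_cond.
apply: eq_bigr => i /andP[im _].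
by rewrite fps_mul_varE im fps_mulZl /fps_scale fps_expD.
Qed.

Lemma fps_derivnE n f m : fps_derivn n f m =
  ((m 0 + n) ^_ n)%N%:R * f (iter n (mmul (ucm 0)) m).
Proof.
elim: n => [|n IH] in m *; first by rewrite ffactn0 mul1r.
rewrite /fps_derivn iterS -/(fps_derivn n f) /fps_deriv IH -iterSr mulrA.
rewrite cmM cmUU add1n addSnnS; congr (_ * _).
rewrite -natrM ffactnSr; congr _%:R; rewrite mulnC; congr (_ * _)%N; lia.
Qed.

End Fps.

Section PowersOfR.

Implicit Types m : monom.

(* The product of binomial(2i-1,i)^(m_i) / m_i! over i >= 1. *)
Definition face_factor : monom -> rat :=
  mbig ( *%R : Monoid.com_law 1)
    (fun i k => if i == 0%N then 1 else (cbin i / 2) ^+ k / k`!%:R).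

Definition num_inner : monom -> nat :=
  mbig (addn : Monoid.com_law 0%N) (fun i k => if i == 0%N then 0%N else k).

Definition half_inner : monom -> nat :=
  mbig (addn : Monoid.com_law 0%N) (fun i k => i * k)%N.

Lemma face_factorU i m : face_factor (mmul (ucm i) m) * (if i == 0%N then 1 else (m i).+1%:R)
  = (if i == 0%N then 1 else cbin i / 2) * face_factor m.
Proof.
have := @mbigU _ _ ( *%R : Monoid.com_law 1)
    (fun i k => if i == 0%N then 1 else (cbin i / 2) ^+ k / k`!%:R) _ i m.
rewrite /= -!/(face_factor _).
case: (i =P 0%N) => _ H; first by rewrite mulr1 mul1r -[LHS]mulr1 H ?mul1r // => j; case: ifP => // _; rewrite divr1.
have f0 : (m i)`!%:R != 0 :> rat by rewrite pnatr_eq0 -lt0n fact_gt0.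
have c0 : (cbin i / 2) ^+ m i != 0 by rewrite expf_neq0 // mulf_neq0 // cbin_neq0.
have n0 : (cbin i / 2) ^+ m i / (m i)`!%:R != 0 by rewrite mulf_neq0 // invr_neq0.
apply: (mulIf n0); rewrite mulrAC H; last by move=> j; case: ifP => // _; rewrite divr1.
have aux (c u F N x : rat) : F != 0 -> N != 0 -> c * u / (N * F) * x * N = c * x * (u / F).
  by move=> F0 N0; field; rewrite F0.
by rewrite exprS factS natrM aux // pnatr_eq0.
Qed.

Lemma num_innerU i m : num_inner (mmul (ucm i) m) = ((i != 0%N) + num_inner m)%N.
Proof.
have := @mbigU _ _ (addn : Monoid.com_law 0%N) (fun i k => if i == 0%N then 0%N else k) _ i m.
rewrite /= -!/(num_inner _) => H; have := H (fun i => if_same _ _).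
by case: (i == 0%N) => /=; clear; lia.
Qed.

Lemma half_innerU i m : half_inner (mmul (ucm i) m) = (i + half_inner m)%N.
Proof.
have := @mbigU _ _ (addn : Monoid.com_law 0%N) (fun i k => i * k)%N (fun i => muln0 i) i m.
by rewrite /= -!/(half_inner _) mulnS; clear; lia.
Qed.

Lemma face_factor1 : face_factor mone = 1. Proof. exact: mbig1. Qed.
Lemma num_inner1 : num_inner mone = 0%N. Proof. exact: mbig1. Qed.
Lemma half_inner1 : half_inner mone = 0%N. Proof. exact: mbig1. Qed.

(* Lagrange inversion; the value 1 is the constant coefficient of R^0. *)
Definition R_pow_coef s m : rat :=
  if (m 0 + num_inner m == half_inner m + s)%N then
    if (m 0 + num_inner m)%N is k.+1 then s%:R * face_factor m * (k`!%:R / (m 0%N)`!%:R) else 1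
  else 0.

Lemma num_inner_sum m : num_inner m = (\sum_(i <- finsupp m | (0 < i)%N) m i)%N.
Proof. by rewrite [RHS]big_mkcond; apply: eq_bigr => i _; rewrite lt0n; case: eqP. Qed.

Lemma half_inner_sum m : half_inner m = (\sum_(i <- finsupp m | (0 < i)%N) i * m i)%N.
Proof. by rewrite [RHS]big_mkcond; apply: eq_bigr => i _; case: i. Qed.

Lemma bin_cbin i : (0 < i)%N -> ('C(i.*2.-1, i))%:R = cbin i / 2 :> rat.
Proof.
case: i => // i _; rewrite doubleS /= /cbin doubleS.
have -> : 'C(i.*2.+2, i.+1) = ('C(i.*2.+1, i.+1) + 'C(i.*2.+1, i))%N by rewrite binS.
have -> : 'C(i.*2.+1, i) = 'C(i.*2.+1, i.+1).
  by rewrite -bin_sub; [congr 'C(_, _); lia | lia].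
by rewrite natrD; field.
Qed.

(** [R_pow_rec] lowers the degree of the monomial but may raise the exponent of R, so the induction
    is on [mdeg m] for all s. *)
Lemma R_powE R s m : R_equation R -> fps_exp R s m = R_pow_coef s m.
Proof.
move=> eR; have [n] := ubnP (mdeg m); elim: n => // n IH in m s *; rewrite ltnS => le.
have supp0 : (m 0%N + num_inner m = 0)%N -> m = mone.
  move=> /eqP; rewrite addn_eq0 => /andP[/eqP m0 /eqP S0]; apply: monom_eqP => i; rewrite cm1.
  case: i => [//|i]; apply/eqP; rewrite cmE_eq0; apply/negP => im.
  by move: S0; rewrite /num_inner /mbig (big_fsetD1 i.+1 im) /= => /eqP; rewrite addn_eq0 cmE_eq0 im.
case: s => [|s].
  rewrite /= /fps_one /R_pow_coef; have [->|m1] := eqVneq m mone.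
    by rewrite cm1 num_inner1 half_inner1.
  case E: (m 0 + num_inner m)%N => [|k]; first by rewrite (supp0 E) eqxx in m1.
  by rewrite !mul0r if_same.
have div_lt i : i \in finsupp m -> (mdeg (divcm m (ucm i)) < n)%N.
  rewrite -cmE_neq0 -lt0n => mi; move: le; rewrite -{1}(divcmK mi) mdegM mdegU; lia.
rewrite R_pow_rec //.
have -> : (if 0%N \in finsupp m then fps_exp R s (divcm m (ucm 0)) else 0) =
   if 0%N \in finsupp m then R_pow_coef s (divcm m (ucm 0)) else 0.
  by case: ifP => // h; rewrite IH // div_lt.
rewrite big_seq_cond (eq_bigr (fun i => (cbin i / 2) * R_pow_coef (i + s) (divcm m (ucm i)))); last first.
  by move=> i /andP[im i0]; rewrite bin_cbin // IH // div_lt.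
rewrite -big_seq_cond.
case E: (m 0 + num_inner m)%N => [|k].
  rewrite (supp0 E) mdom1 big_mkcond big_seq_fset0 in_fset0 addr0.
  by rewrite /R_pow_coef cm1 num_inner1 half_inner1.
rewrite {3}/R_pow_coef E.
have m0_step : 0%N \in finsupp m -> let m' := divcm m (ucm 0) in
   [/\ m 0%N = (m' 0%N).+1, num_inner m = num_inner m', half_inner m = half_inner m'
     & face_factor m = face_factor m'].
  rewrite -cmE_neq0 -lt0n => h m'; have mE : m = mmul (ucm 0) m' by rewrite divcmK.
  have := face_factorU 0 m'; rewrite mulr1 mul1r -mE => ->.
  by rewrite {1 2 3}mE num_innerU half_innerU cmM cmUU.
have mi_step i : i \in finsupp m -> (0 < i)%N -> let m' := divcm m (ucm i) in
   [/\ m 0%N = m' 0%N, num_inner m = (num_inner m').+1, half_inner m = (i + half_inner m')%N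
     & face_factor m * (m i)%:R = cbin i / 2 * face_factor m'].
  rewrite -cmE_neq0 -lt0n => h i0 m'; have mE : m = mmul (ucm i) m' by rewrite divcmK.
  have := face_factorU i m'; rewrite eqn0Ngt i0 /= -mE => <-.
  have -> : m i = (m' i).+1 by rewrite mE cmM cmUU.
  rewrite {1 2 3}mE num_innerU half_innerU cmM cmU !eqn0Ngt i0 /=; split=> //.
have aux1 (a b c u v : nat) : (a.+1 + b = v.+1 -> a + b = c + u -> v.+1 = c + u.+1)%N.
  by clear; lia.
have aux2 (a b c i u v : nat) : (a + b.+1 = v.+1 -> a + b = c + (i + u) -> v.+1 = i + c + u.+1)%N.
  by clear; lia.
have aux3 (a b c u v : nat) : (a.+1 + b = v.+1 -> v.+1 = c + u.+1 -> a + b = c + u)%N.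
  by clear; lia.
have aux4 (a b c i u v : nat) : (a + b.+1 = v.+1 -> v.+1 = i + c + u.+1 -> a + b = c + (i + u))%N.
  by clear; lia.
have aux5 (a b v : nat) : (a.+1 + b = v.+2 -> a + b = v.+1)%N by clear; lia.
have aux6 (a b v : nat) : (a + b.+1 = v.+2 -> a + b = v.+1)%N by clear; lia.
(* Each term of the recurrence has the same defect of balance as m, so without balance all terms
   vanish. *)
have [bal|nbal] := eqVneq k.+1 (half_inner m + s.+1)%N; last first.
  rewrite big_seq_cond big1 ?addr0.
    case: ifP => // /m0_step /= [a b c _]; rewrite /R_pow_coef ifN //.
    by apply: contra nbal => /eqP H; apply/eqP; move: E H; rewrite a b c; exact: aux1.
  move=> i /andP[im i0]; have /= [a b c _] := mi_step i im i0; rewrite /R_pow_coef ifN ?mulr0 //.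
  by apply: contra nbal => /eqP H; apply/eqP; move: E H; rewrite a b c; exact: aux2.
(* When m has degree 1, balance leaves only m = t and s = 0; the recurrence then reaches the
   separate value 1 of [R_pow_coef] at [mone]. *)
case: k E bal => [|k] E bal.
  have [h0 s0] : half_inner m = 0%N /\ s = 0%N by move: bal; clear; lia.
  have supp i : i \in finsupp m -> i = 0%N.
    move=> im; apply/eqP; rewrite -leqn0 leqNgt; apply/negP => i0.
    move: h0; rewrite /half_inner /mbig (big_fsetD1 i im) /= => /eqP.
    by rewrite addn_eq0 muln_eq0 eqn0Ngt i0 /= cmE_eq0 im.
  have n0 : num_inner m = 0%N.
    rewrite num_inner_sum big_seq_cond big1 // => i /andP[im i0].
    by rewrite (supp i im) in i0.
  have m01 : m 0%N = 1%N by move: E; rewrite n0; clear; lia.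
  have mm : m = ucm 0.
    apply: monom_eqP => -[|i]; rewrite cmU //=; apply/eqP; rewrite cmE_eq0.
    by apply/negP => /supp.
  have im : 0%N \in finsupp m by rewrite -cmE_neq0 m01.
  rewrite im big_seq_cond big1 => [|i /andP[iim i0]]; last by rewrite (supp i iim) in i0.
  have /= [_ _ _ d] := m0_step im.
  have dm : divcm m (ucm 0) = mone.
    by rewrite mm; apply: monom_eqP => i; rewrite divcmE cm1 subnn.
  rewrite s0 d dm face_factor1 /R_pow_coef cm1 num_inner1 half_inner1 m01 /=.
  by rewrite addr0 !mul1r ?divr1.
(* The common factor of all terms: t contributes [s m_0] and each [x_i] contributes [(i+s) m_i]. *)
pose X := face_factor m * (k`!%:R / (m 0%N)`!%:R).
have -> : (if 0%N \in finsupp m then R_pow_coef s (divcm m (ucm 0)) else 0)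
   = X * (s * m 0)%:R.
  case: ifP => [h|/negbT]; last by rewrite -cmE_eq0 => /eqP ->; rewrite muln0 mulr0.
  have /= [a b c d] := m0_step h; rewrite /R_pow_coef ifT; last first.
    by apply/eqP; move: E bal; rewrite a b c; exact: aux3.
  have -> : (divcm m (ucm 0) 0 + num_inner (divcm m (ucm 0)) = k.+1)%N.
    by move: E; rewrite a b; exact: aux5.
  rewrite -d /X a factS !natrM.
  have aux (x y z u v : rat) : u != 0 -> v != 0 -> x * y * (z / u) = y * (z / (v * u)) * (x * v).
    by move=> u0 v0; field; rewrite u0.
  by apply: aux; rewrite pnatr_eq0 // -lt0n fact_gt0.
have -> : \sum_(i <- finsupp m | (0 < i)%N) cbin i / 2 * R_pow_coef (i + s) (divcm m (ucm i))
   = X * (s * num_inner m + half_inner m)%:R.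
  have -> : (s * num_inner m + half_inner m = \sum_(i <- finsupp m | (0 < i)%N) (i + s) * m i)%N.
    rewrite num_inner_sum half_inner_sum big_distrr /= -big_split /=.
    by apply: eq_bigr => i _; rewrite mulnDl addnC.
  rewrite natr_sum mulr_sumr big_seq_cond [RHS]big_seq_cond.
  apply: eq_bigr => i /andP[im i0].
  have /= [a b c d] := mi_step i im i0; rewrite /R_pow_coef ifT; last first.
    by apply/eqP; move: E bal; rewrite a b c; exact: aux4.
  have -> : (divcm m (ucm i) 0 + num_inner (divcm m (ucm i)) = k.+1)%N.
    by move: E; rewrite a b; exact: aux6.
  rewrite -a /X natrM.
  have aux (c1 f1 f2 x y z : rat) : f2 * y = c1 * f1 -> c1 * (x * f1 * z) = f2 * z * (x * y).
    by move=> H; rewrite (_ : c1 * _ = c1 * f1 * x * z); [rewrite -H; ring | ring].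
  exact: aux.
rewrite -mulrDr -natrD.
(* By balance [half_inner m] is [k+1-s], and [s(k+2) + k+1-s = (s+1)(k+1)]. *)
have -> : (s * m 0 + (s * num_inner m + half_inner m) = s.+1 * k.+1)%N.
  have -> : (s * m 0 + (s * num_inner m + half_inner m) = s * (m 0 + num_inner m) + half_inner m)%N.
    by rewrite mulnDr addnA.
  by rewrite E; move: bal; rewrite !mulSn !mulnS; clear; lia.
rewrite /X factS !natrM; ring.
Qed.

End PowersOfR.

(** * Coefficients of G *)

Section Coefficients.

Implicit Types m : monom.

Lemma inner_part_sub m : (finsupp (inner_part m) `<=` finsupp m)%fset.
Proof.
apply/fsubsetP => i; rewrite -!cmE_neq0 inner_partE; by case: (i =P 0%N).
Qed.

Lemma mdeg_inner_part m : mdeg (inner_part m) = num_inner m.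
Proof.
rewrite (mdegEw (inner_part_sub m)); apply: eq_bigr => i _; exact: inner_partE.
Qed.

Lemma inner_darts_part m : inner_darts (inner_part m) = inner_darts m.
Proof.
rewrite [LHS](mbig_widen _ (fun i => muln0 i.*2) (inner_part_sub m)).
by apply: eq_bigr => i _; rewrite inner_partE; case: (i =P 0%N) => [->|].
Qed.

Lemma inner_dartsE m : inner_darts m = (half_inner m).*2.
Proof.
by rewrite -muln2 [RHS]big_distrl /=; apply: eq_bigr => i _; rewrite -muln2 mulnAC.
Qed.

Definition inner_alpha : monom -> rat :=
  mbig ( *%R : Monoid.com_law 1) (fun i k => alpha i.*2 ^+ k).

Lemma alpha_double_neq0 i : alpha i.*2 != 0.
Proof.
rewrite alpha_double; case: (i =P 0%N) => // /eqP i0.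
by rewrite mulf_neq0 ?cbin_neq0 // pnatr_eq0.
Qed.

Lemma inner_alphaU i m : inner_alpha (mmul (ucm i) m) = alpha i.*2 * inner_alpha m.
Proof.
have := @mbigU _ _ ( *%R : Monoid.com_law 1) (fun i k => alpha i.*2 ^+ k) (fun=> erefl) i m.
rewrite /= -!/(inner_alpha _) exprS mulrAC; apply: mulIf.
by rewrite expf_neq0 // alpha_double_neq0.
Qed.

Lemma inner_alpha_prod (I : finType) (A : {set I}) (k : I -> nat) :
  inner_alpha (\big[mmul/mone]_(x in A) ucm (k x)) = \prod_(x in A) alpha (k x).*2.
Proof.
elim/big_rec2: _ => [|x y m _ <-]; first exact: mbig1.
exact: inner_alphaU.
Qed.

(** Per inner face of degree 2i, the factor [binom(2i-1,i) = cbin i / 2] times the 2i rootings is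
    [alpha (2i) = i cbin i]; the factorials of the orderings cancel. *)
Lemma face_factor_inner m :
  face_factor m * (inner_sym (inner_part m))%:R = inner_alpha (inner_part m).
Proof.
rewrite /face_factor /mbig /=.
rewrite [inner_sym _](mbig_widen _ _ (inner_part_sub m)) //.
rewrite [RHS](mbig_widen _ _ (inner_part_sub m)) //.
rewrite natr_prod -big_split /=; apply: eq_bigr => i _; rewrite inner_partE.
case: (i =P 0%N) => [->|/eqP i0]; first by rewrite mulr1.
have f0 : (m i)`!%:R != 0 :> rat by rewrite pnatr_eq0 -lt0n fact_gt0.
rewrite alpha_double (negPf i0) natrM natrX mulrCA divfK // -exprMn; congr (_ ^+ _).
by rewrite -mul2n natrM; field.
Qed.

Lemma prod_alpha_faces (T : finType) r (l : 'I_r -> nat) m phi (b : {ffun 'I_r -> T}) :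
  (phi, b) \in rooted T l m ->
  \prod_(C in porbits phi) alpha #|C| = (\prod_i alpha (l i)) * inner_alpha m.
Proof.
case/rootedP=> inj sz ev <-; rewrite (big_setID [set bface phi b i | i : 'I_r]) /=.
rewrite (setIidPr _); last by apply/subsetP => _ /imsetP[i _ ->]; apply: imset_f.
rewrite big_imset /=; last by move=> i j _ _; apply: inj.
congr (_ * _); first by apply: eq_bigr => i _; rewrite sz.
by rewrite inner_alpha_prod; apply: eq_bigr => C Cin; rewrite even_halfK // ev.
Qed.

Lemma odd_faces_rooted (T : finType) r (l : 'I_r -> nat) m phi (b : {ffun 'I_r -> T}) :
  (phi, b) \in rooted T l m ->
  #|[set C in porbits phi | odd #|C|]| = #|[set i | odd (l i)]|.
Proof.
case/rootedP=> inj sz ev _; rewrite -(card_imset _ inj); congr #|pred_of_set _|.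
apply/setP => C; rewrite inE; apply/andP/imsetP => [[CP oC]|[i]].
  have : C \notin inner phi b by apply/negP => /ev; rewrite oC.
  rewrite inE CP andbT negbK => /imsetP[i _ E]; exists i => //.
  by rewrite inE -sz -E.
by rewrite inE -(sz i) => oi ->; split=> //; apply: imset_f.
Qed.

(** Here e is the number of edges and the test is Euler's relation. All rooted face permutations
    carry the same number of matchings, so the sum in [card_even_maps] is a product. *)
Lemma G_coef r (l : 'I_r -> nat) m : (0 < r)%N -> (forall i, (0 < l i)%N) ->
  #|[set i | odd (l i)]| = 0%N \/ #|[set i | odd (l i)]| = 2 ->
  let e := ((\sum_i l i)./2 + half_inner m)%N in
  G l m = if (m 0 + r + num_inner m == e + 2)%N then
     (\prod_i alpha (l i)) * face_factor m * ((e.-1)`!%:R / (m 0%N)`!%:R) else 0.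
Proof.
move=> r0 l0 oc e; rewrite /G; set D := num_darts l m.
have DE : D = (\sum_i l i + inner_darts m)%N by [].
have sl : ~~ odd (\sum_i l i) by rewrite odd_sum_card; case: oc => ->.
have De : (D./2 = e)%N.
  by rewrite DE inner_dartsE -(even_halfK sl) -doubleD doubleK.
have D0 : (0 < D)%N.
  by rewrite DE (bigD1 (Ordinal r0)) //=; have := l0 (Ordinal r0); clear; lia.
have f0 n : n`!%:R != 0 :> rat by rewrite pnatr_eq0 -lt0n fact_gt0.
(* Multiplying by D! replaces isomorphism classes by maps with numbered darts; [card_rooted] later
   provides the same D!. *)
apply: (mulIf (f0 D)); rewrite -natrM num_even_maps_fact // -/D.
have -> : #|even_maps D l m| = #|[set M : {perm 'I_D} * {perm 'I_D} * {ffun 'I_r -> 'I_D} |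
      even_map l M.1.1 M.1.2 M.2 && (map_weight M.1.1 M.1.2 M.2 == m)]|.
  by apply: eq_card => -[[s ed] b]; rewrite !inE.
rewrite card_even_maps mdeg_inner_part card_ord De.
case: eqP => [bal|_]; last by rewrite mul0r.
have cT : #|'I_D| = (\sum_i l i + inner_darts (inner_part m))%N by rewrite card_ord inner_darts_part.
have := @card_rooted 'I_D 'I_r l (inner_part m) l0 _ cT.
rewrite inner_partE card_ord => /(_ erefl) <-.
rewrite natr_sum [LHS](eq_bigr (fun _ => (\prod_i alpha (l i)) * inner_alpha (inner_part m) *
   ((e.-1)`!%:R / (m 0%N)`!%:R))); last first.
  move=> [phi b] yR /=; rewrite card_planar_matchings ?card_ord //; last by rewrite (odd_faces_rooted yR).
  rewrite (prod_alpha_faces yR) (card_porbits_rooted yR) De mdeg_inner_part.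
  by rewrite (_ : (e + 2 - _ = m 0)%N) //; rewrite -bal; clear; lia.
rewrite sumr_const -mulr_natl natrM -face_factor_inner.
ring.
Qed.

Lemma R_pow_coefE s m : (0 < s)%N -> R_pow_coef s m =
  if (m 0 + num_inner m == half_inner m + s)%N then
    s%:R * face_factor m * (((s + half_inner m).-1)`!%:R / (m 0%N)`!%:R)
  else 0.
Proof.
move=> s0; rewrite /R_pow_coef; case: eqP => // bal.
rewrite (addnC s) -bal; case E: (m 0 + num_inner m)%N => [|k] //.
by move: s0 bal; rewrite E; clear; lia.
Qed.

Lemma shift_t n m (m' := iter n (mmul (ucm 0)) m) :
  [/\ m' 0%N = (m 0 + n)%N, num_inner m' = num_inner m, half_inner m' = half_inner m
    & face_factor m' = face_factor m].
Proof.
rewrite {}/m'; elim: n => [|n [IH1 IH2 IH3 IH4]]; first by rewrite addn0.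
split=> /=.
- by rewrite cmM cmUU IH1 addnS.
- by rewrite num_innerU IH2.
- by rewrite half_innerU IH3.
- by have := face_factorU 0 (iter n (mmul (ucm 0)) m); rewrite mulr1 mul1r IH4.
Qed.

End Coefficients.

Theorem theorem1 (r : nat) (l : 'I_r -> nat) (R : fps)
    (r_ge1 : (1 <= r)%N)
    (l_gt0 : forall i, (0 < l i)%N)
    (l_odd : #|[set i | odd (l i)]| = 0%N \/ #|[set i | odd (l i)]| = 2%N)
    (R_eq : R_equation R) :
  let s := ((\sum_i l i)./2)%N in
  let c := (\prod_i alpha (l i)) * (1 / s%:R) in
  [/\ (2 <= r)%N ->
        G l =1 fps_scale c (fps_derivn (r - 2)%N (fps_exp R s)),
      r = 1%N ->
        fps_deriv (G l) =1 fps_scale c (fps_exp R s)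
    & r = 1%N -> forall a : nat, (forall i, l i = a.*2) ->
        fps_deriv (G l) =1 fps_scale ('C(a.*2, a))%:R (fps_exp R a)].
Proof.
move=> s c.
have f0 n : n`!%:R != 0 :> rat by rewrite pnatr_eq0 -lt0n fact_gt0.
have s0 : (0 < s)%N.
  have sl : ~~ odd (\sum_i l i) by rewrite odd_sum_card; case: l_odd => ->.
  rewrite -double_gt0 even_halfK // (bigD1 (Ordinal r_ge1)) //=.
  by rewrite addn_gt0 l_gt0.
have s0' : s%:R != 0 :> rat by rewrite pnatr_eq0 -lt0n.
(* The derivative reads the coefficient at [m 0 + 1]: Euler's relation with one boundary face
   becomes the balance of [R^s], and the factor [m 0 + 1] reduces (m 0 + 1)! to (m 0)!. *)
have one : r = 1%N -> fps_deriv (G l) =1 fps_scale c (fps_exp R s).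
  move=> r1 m; rewrite /fps_deriv /fps_scale R_powE // R_pow_coefE // G_coef // -/s.
  have [/= -> -> -> ->] := shift_t 1 m.
  have -> : (m 0 + 1 + r + num_inner m == s + half_inner m + 2)%N
      = (m 0 + num_inner m == half_inner m + s)%N.
    by rewrite r1; apply/eqP/eqP; clear; lia.
  case: ifP => _; last by rewrite !mulr0.
  rewrite /c addn1 factS natrM.
  have aux (N P f u v S : rat) : S != 0 -> N != 0 -> v != 0 ->
     N * (P * f * (u / (N * v))) = P * (1 / S) * (S * f * (u / v)).
    by move=> S0 N0 v0; field; rewrite v0 S0 N0.
  by apply: aux; rewrite ?f0 ?s0' ?pnatr_eq0.
split=> // [r2 m|r1 a la m].
  rewrite /fps_scale fps_derivnE R_powE // R_pow_coefE // G_coef // -/s.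
  have [-> -> -> ->] := shift_t (r - 2) m.
  have -> : (m 0 + r + num_inner m == s + half_inner m + 2)%N
      = (m 0 + (r - 2) + num_inner m == half_inner m + s)%N.
    by move: r2; clear; move=> r2; apply/eqP/eqP; lia.
  case: ifP => _; last by rewrite !mulr0.
  (* The falling factorial produced by r-2 derivatives turns the denominator (m 0 + r - 2)! into (m
     0)!. *)
  have := ffact_fact (leq_addl (m 0%N) (r - 2)); rewrite addnK.
  move/(congr1 (fun n => n%:R : rat)); rewrite natrM => E.
  rewrite -E /c.
  have aux (P f u v w S : rat) : S != 0 -> v != 0 -> w != 0 ->
     P * f * (u / v) = P * (1 / S) * (w * (S * f * (u / (w * v)))).
    by move=> S0 v0 w0; field; rewrite ?v0 ?w0 ?S0.
  apply: aux => //; rewrite pnatr_eq0 -lt0n ffact_gt0; exact: leq_addl.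
rewrite one // /fps_scale /c; subst r.
have sa : s = a by rewrite /s big_ord1 la doubleK.
rewrite sa big_ord1 la alpha_double; case: (a =P 0%N) => [a0|/eqP a0].
  by rewrite sa a0 in s0.
rewrite /cbin; congr (_ * _); field; by rewrite pnatr_eq0.
Qed.
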